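(* Let $\mathbb{K}$ be an algebraically closed field with $\operatorname{char}(\mathbb{K})=2$, and let $r,s,d,k$ be integers with $0\le s\le r-2$ and $d>k\ge0$. Assume that $d>k(r-s-1)$. Let $\ell\in[0,r-2]$ be the residue of $d-1$ modulo $r-1$ and let $$\alpha=d+2\cdot\frac{d-1-\ell}{r-1}.$$ Let $N_{d,k}$ be the normal bundle of a general map $f\colon\mathbb{P}^1\to X_{r,s}$ of degree $(d,k)$. (a) Suppose that $k<\left\lceil\frac{\ell}{r-s-1}\right\rceil$. Then $$N_{d,k}\cong\mathcal{O}(\alpha)^{r-1-\ell}\oplus\mathcal{O}(\alpha+1)^{k(r-s-1)}\oplus\mathcal{O}(\alpha+2)^{\ell-k(r-s-1)}.$$ (b) Suppose that $k<\left\lceil\frac{r-1-\ell}{s}\right\rceil$, or that $s=0$. Then $$N_{d,k}\cong\mathcal{O}(\alpha-k)^{(r-1-\ell)-ks}\oplus\mathcal{O}(\alpha-k+1)^{ks}\oplus\mathcal{O}(\alpha-k+2)^{\ell}.$$ (c) Suppose that $s\neq 0$, $k\ge\left\lceil\frac{\ell}{r-s-1}\right\rceil$ and $k\ge\left\lceil\frac{r-1-\ell}{s}\right\rceil$. Then $N_{d,k}$ is balanced.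
   Context: $X_{r,s}=\mathrm{Bl}_{\mathbb{P}^s}(\mathbb{P}^r)$ is the blow-up of $\mathbb{P}^r$ (over $\mathbb{K}$) along a linear subspace $\mathbb{P}^s$. A map $f\colon\mathbb{P}^1\to X_{r,s}$ has degree $(d,k)$ if the hyperplane class pulled back from $\mathbb{P}^r$ has degree $d$ and the exceptional divisor has degree $k$ on $\mathbb{P}^1$. The space of such maps is irreducible and ''general'' means in a suitable dense open subset; a general $f$ is unramified, and $N_{d,k}=f^*T_{X_{r,s}}/T_{\mathbb{P}^1}$ is its normal bundle. (By earlier work recalled in the paper, for $k=0$ one has $N_{d,0}\cong\mathcal{O}(\alpha)^{r-1-\ell}\oplus\mathcal{O}(\alpha+2)^{\ell}$ in characteristic $2$.) A vector bundle on $\mathbb{P}^1$ is balanced if it is isomorphic to $\mathcal{O}(a)^x\oplus\mathcal{O}(a+1)^y$ for some integers $a$ and $x,y\ge0$. *)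

(* Defs.v *)
From HB Require Import structures.
From mathcomp Require Import all_boot all_order all_algebra.
From mathcomp Require Import mpoly.

Set Implicit Arguments.
Unset Strict Implicit.
Unset Printing Implicit Defensive.

Import GRing.Theory.
Local Open Scope ring_scope.

(* A matrix C : 'M_(n, m.+1) encodes n binary forms of degree m: row i is
   \sum_j C i j S^(m-j) T^j.  [ev] is the vector of values at (S, T) = (a, b),
   [evS] and [evT] are the values of the partial derivatives; coefficients are
   transported along iota : K -> L. *)
Section Forms.
Variables (K L : comNzRingType) (iota : K -> L) (n m : nat).
Implicit Types (C : 'M[K]_(n, m.+1)) (a b : L).

Definition ev C a b : 'rV[L]_n :=
  \row_i \sum_(j < m.+1) iota (C i j) * a ^+ (m - j) * b ^+ j.

Definition evS C a b : 'rV[L]_n :=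
  \row_i \sum_(j < m.+1) iota (C i j) * (a ^+ (m - j).-1 *+ (m - j)) * b ^+ j.

Definition evT C a b : 'rV[L]_n :=
  \row_i \sum_(j < m.+1) iota (C i j) * a ^+ (m - j) * (b ^+ j.-1 *+ j).
End Forms.

(* The blow-up X_{r,s} of P^r along P^s = {z_(s+1) = ... = z_r = 0} is the
   closed subscheme of P^r x P^(r-s-1) of pairs ([z], [w]) such that
   (z_(s+1), ..., z_r) /\ w = 0.  The coordinates of P^r are split as
   s.+1 + (r - s), so (z_(s+1), ..., z_r) is rsubmx z. *)
Definition incident (L : comNzRingType) (p n : nat)
    (z : 'rV[L]_(p + n)) (w : 'rV[L]_n) : Prop :=
  forall i j, rsubmx z 0 i * w 0 j = rsubmx z 0 j * w 0 i.

(* On X_{r,s}, O(E) = O(1, -1): with H and H - E the pullbacks of the two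
   hyperplane classes, degree (d, k) means that [z] has degree d and [w] has
   degree d - k. *)
Definition coefs (K : Type) (r s d k : nat) : Type :=
  ('M[K]_(s.+1 + (r - s), d.+1) * 'M[K]_(r - s, (d - k).+1))%type.

Section Maps.
Variables (K : fieldType) (r s d k : nat).

Definition is_map (f : coefs K r s d k) : Prop :=
  forall a b : K, (a, b) <> (0, 0) ->
    [/\ ev id f.1 a b != 0, ev id f.2 a b != 0 &
        incident (ev id f.1 a b) (ev id f.2 a b)].

(* A morphism P^1 -> X_{r,s} of degree (d, k) is an element of this type, up to
   rescaling [z] and [w] independently. *)
Record map_X : Type := MapX { map_coefs :> coefs K r s d k;
                              map_coefsP : is_map map_coefs }.

Definition coord_vec (f : coefs K r s d k) :=
  row_mx (mxvec f.1) (mxvec f.2).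

(* Open sets are taken among representatives rather than modulo rescaling; the
   quotient map by rescaling is open, so this gives the same notion of general
   for properties that are invariant under rescaling. *)
Definition zariski_open (U : map_X -> Prop) : Prop :=
  forall f, U f ->
    exists G : {mpoly K[(s.+1 + (r - s)) * d.+1 + (r - s) * (d - k).+1]},
      G.@[fun i => coord_vec f 0 i] != 0 /\
      forall g : map_X, G.@[fun i => coord_vec g 0 i] != 0 -> U g.

Definition zariski_dense (U : map_X -> Prop) : Prop :=
  forall V, zariski_open V -> (exists f, V f) -> exists f, U f /\ V f.

Definition general (P : map_X -> Prop) : Prop :=
  exists U, [/\ zariski_open U, zariski_dense U, exists f, U f &
                forall f, U f -> P f].

(* df is injective at p = (a : b): the tangent space of P^1 at p is K^2 / K p,
   and that of P^r x P^(r-s-1) at ([z], [w]) is the space of pairs (z', w')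
   modulo (z, 0) and (0, w). *)
Definition unramified (f : map_X) : Prop :=
  forall a b : K, (a, b) <> (0, 0) -> forall u v g h : K,
    let: (Z, W) := map_coefs f in
    u *: evS id Z a b + v *: evT id Z a b = g *: ev id Z a b ->
    u *: evS id W a b + v *: evT id W a b = h *: ev id W a b ->
    u * b = v * a.
End Maps.

(* Sheaves on P^1, with function field K(t), t = T/S, and the two charts
   U_0 = {S != 0} = Spec K[t] and U_oo = {T != 0} = Spec K[1/t]. *)
Inductive chart := U_0 | U_oo.

Section Sheaves.
Variable K : fieldType.

Definition ratfun : fieldType := {fraction {poly K}}.

Definition cst (x : K) : ratfun := tofrac x%:P.
Definition tvar : ratfun := tofrac 'X.

(* O(a) inside the constant sheaf K(t), trivialised on U_0 by S^a:
   its sections are K[t] over U_0 and t^a K[1/t] over U_oo. *)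
Definition twist (a : int) (c : chart) (x : ratfun) : Prop :=
  match c with
  | U_0 => exists p : {poly K}, x = tofrac p
  | U_oo => exists p : {poly K}, x = tvar ^ a * (map_poly cst p).[tvar^-1]
  end.

(* A quotient num / den of two quasi-coherent subsheaves den \subset num of the
   constant sheaf K(t)^amb, each given by its sections over the two charts. *)
Record qsheaf : Type := QSheaf {
  amb : nat;
  num : chart -> 'rV[ratfun]_amb -> Prop;
  den : chart -> 'rV[ratfun]_amb -> Prop
}.

Definition split_bundle (a : seq int) (c : chart)
    (e : 'rV[ratfun]_(size a)) : Prop :=
  forall i : 'I_(size a), twist a`_i c (e 0 i).

(* N is isomorphic to the direct sum of the O(a_i).  A morphism from num to the
   direct sum is determined by its K(t)-linear action at the generic point,
   which extends to K(t)^amb and so is given by a matrix phi. *)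
Definition iso_split (N : qsheaf) (a : seq int) : Prop :=
  exists phi : 'M[ratfun]_(amb N, size a), forall c : chart,
    [/\ forall v, num c v -> split_bundle c (v *m phi),
        forall e, split_bundle c e -> exists2 v, @num N c v & v *m phi = e &
        forall v, num c v -> (v *m phi = 0 <-> den c v)].

Definition balanced (N : qsheaf) : Prop :=
  exists (a : int) (x y : nat), iso_split N (nseq x a ++ nseq y (a + 1)).
End Sheaves.

Section NormalBundle.
Variables (K : fieldType) (r s d k : nat) (f : map_X K r s d k).

Let F := ratfun K.
Let t : F := tvar K.
Let dim := (s.+1 + (r - s) + (r - s))%N.

(* The pullback to P^1 of the homogeneous coordinates and of their derivatives,
   as sections of O(d), O(d-k) and of O(d-1), O(d-k-1), evaluated at the
   generic point (S, T) = (1, t). *)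
Let z := ev (@cst K) (map_coefs f).1 1 t.
Let w := ev (@cst K) (map_coefs f).2 1 t.
Let zS := evS (@cst K) (map_coefs f).1 1 t.
Let wS := evS (@cst K) (map_coefs f).2 1 t.
Let zT := evT (@cst K) (map_coefs f).1 1 t.
Let wT := evT (@cst K) (map_coefs f).2 1 t.

(* Euler sequences on P^r and P^(r-s-1): a section of f^* T_X is a first-order
   deformation (z', w'), with z' in O(d)^(r+1) and w' in O(d-k)^(r-s),
   satisfying the linearised equations of X_{r,s}, taken modulo [euler]. *)
Definition deformations (c : chart) (v : 'rV[F]_dim) : Prop :=
  [/\ forall i, twist d%:Z c (lsubmx v 0 i),
      forall i, twist (d - k)%N%:Z c (rsubmx v 0 i) &
      forall i j,
        rsubmx (lsubmx v) 0 i * w 0 j + rsubmx z 0 i * rsubmx v 0 j =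
        rsubmx (lsubmx v) 0 j * w 0 i + rsubmx z 0 j * rsubmx v 0 i].

Definition euler (c : chart) (v : 'rV[F]_dim) : Prop :=
  exists g h : F, [/\ twist 0 c g, twist 0 c h & v = row_mx (g *: z) (h *: w)].

(* The image of df: T_(P^1) -> f^* T_X, where sections of T_(P^1) are the
   g d/dS + h d/dT with g, h in O(1), modulo S d/dS + T d/dT. *)
Definition differential (c : chart) (v : 'rV[F]_dim) : Prop :=
  exists g h : F, [/\ twist 1 c g, twist 1 c h &
    v = row_mx (g *: zS + h *: zT) (g *: wS + h *: wT)].

Definition pullback_tangent : qsheaf K := QSheaf deformations euler.

(* f^* T_X / T_(P^1) *)
Definition normal_bundle : qsheaf K :=
  QSheaf (@num _ pullback_tangent)
    (fun c v => exists v1 v2,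
       [/\ @den _ pullback_tangent c v1, differential c v2 & v = v1 + v2]).
End NormalBundle.

(* Main.v *)
Require Import Defs.
From mathcomp Require Import all_boot all_order all_algebra.
From mathcomp Require Import mpoly ring zify.

Set Implicit Arguments.
Unset Strict Implicit.
Unset Printing Implicit Defensive.

Import GRing.Theory.
Local Open Scope ring_scope.

(** Write the map f as (p, e w), w in Cox coordinates, of degrees d, k and d - k. Up to
    signs, which characteristic 2 ignores, the dual of the normal bundle consists of the
    vectors (x, y, u) killed by the rows (p, e, 0), (0, e, w) and (p', e', w'): the two
    Euler relations and the differential. To split it as the sum of the O(- a_j), it is
    enough to find r - 1 sections S_j of its twists by a_j that are linearly independent
    at every point of the line ([iso_split_of_sections]).

    The reason for the degrees in the theorem is that a polynomial in t^2 has derivative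
    zero. So a relation between the coordinates p and e w of z with coefficients
    in K[t^2], of degree de in t^2, satisfies the third equation for free and gives a
    section of degree d + 2 de ([relation_sec]). A relation of this kind between e p and
    w gives a section of degree d + k + 2 de ([corelation_sec]). In general the sections
    have degrees d + nu + 2 de with nu between 0 and k, where nu sums to k (r - s - 1)
    and nu + de to d - 1.

    Such sections can be seen on an explicit map ([D_span], [model_exists]). The
    coordinates w are chosen with r - s - 2 relations in t^2, read off from the
    even and odd parts of polynomials Bk, and the p_i are obtained by interpolation, so that
    all the relations between e p and w and between their derivatives are the
    combinations D c of the columns of an explicit matrix D with entries in K[t^2]. Such a
    combination is a section when it is divisible by e in its last components; each of
    the k zeros a_j of e imposes r - s - 1 linear conditions on c, and by the choice of the
    interpolated values these say that c_f vanishes at a_j for f in a prescribed set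
    T_j of r - s - 1 indices ([general_position]). So the sections are the c with c_f
    divisible by the product of the t - a_j with f in T_j, and nu_f is the number of these
    j, any numbers of this kind being possible ([sets_with_multiplicities]).

    The conclusion passes to general maps because the sections deform. The sections
    themselves, and the relations of the two kinds above, are solutions of linear systems in
    their coefficients. The known solutions for the explicit map show by a dimension count
    that such a system is surjective if no section of the basis has much larger degree
    ([deform_splitting]). The solutions of surjective systems extend to nearby parameters
    ([poly_solution_persists]), and the deformed sections still generate all sections of
    large degree, hence are independent at every point ([sections_general]). As the space
    of triples (p, e, w) is irreducible, this holds for a general map
    ([general_of_open]); the explicit triple need not even be a map.

    It remains to choose the pairs (nu, de). With d - 1 = q (r - 1) + l they are (0, q),
    (1, q) and (0, q + 1) in case (a), (k, q - k), (k - 1, q - k + 1) and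
    (k, q - k + 1) in case (b), and in case (c) they are such that nu + 2 de takes only
    two consecutive values ([balanced_pairs]). *)

(** * Algebras of functions and linear systems depending on parameters *)

(** Polynomial functions on a line, functions of the coefficients of (p, e, w) and germs of
    regular functions on the space of maps are used as rings of functions; only
    this much of their structure matters. *)
Record funalg (K : comNzRingType) (T : Type) (P : (T -> K) -> Prop) : Prop :=
  Funalg {
    fa_ext : forall f g, f =1 g -> P f -> P g;
    fa_cst : forall c, P (fun=> c);
    fa_add : forall f g, P f -> P g -> P (fun t => f t + g t);
    fa_mul : forall f g, P f -> P g -> P (fun t => f t * g t) }.

Section FunAlg.
Variables (K : comNzRingType) (T : Type) (P : (T -> K) -> Prop).
Hypothesis hP : funalg P.

Lemma fa_opp f : P f -> P (fun t => - f t).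
Proof.
move=> Pf; apply: (fa_ext hP _ (fa_mul hP (fa_cst hP (-1)) Pf)) => t.
by rewrite mulN1r.
Qed.

Lemma fa_sum (I : Type) (r : seq I) (Q : pred I) (F : I -> T -> K) :
  (forall i, Q i -> P (F i)) -> P (fun t => \sum_(i <- r | Q i) F i t).
Proof.
move=> hF; elim: r => [|i r IH].
  by apply: (fa_ext hP _ (fa_cst hP 0)) => t; rewrite big_nil.
case Qi: (Q i).
  by apply: (fa_ext hP _ (fa_add hP (hF i Qi) IH)) => t; rewrite big_cons Qi.
by apply: (fa_ext hP _ IH) => t; rewrite big_cons Qi.
Qed.

Lemma fa_prod (I : Type) (r : seq I) (Q : pred I) (F : I -> T -> K) :
  (forall i, Q i -> P (F i)) -> P (fun t => \prod_(i <- r | Q i) F i t).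
Proof.
move=> hF; elim: r => [|i r IH].
  by apply: (fa_ext hP _ (fa_cst hP 1)) => t; rewrite big_nil.
case Qi: (Q i).
  by apply: (fa_ext hP _ (fa_mul hP (hF i Qi) IH)) => t; rewrite big_cons Qi.
by apply: (fa_ext hP _ IH) => t; rewrite big_cons Qi.
Qed.

Definition fa_mx n m (A : T -> 'M[K]_(n, m)) :=
  forall i j, P (fun t => A t i j).

Lemma fa_mx_cst n m (B : 'M[K]_(n, m)) : fa_mx (fun=> B).
Proof. by move=> i j; apply: fa_cst. Qed.

Lemma fa_mulmx n m p (A : T -> 'M[K]_(n, m)) (B : T -> 'M[K]_(m, p)) :
  fa_mx A -> fa_mx B -> fa_mx (fun t => A t *m B t).
Proof.
move=> hA hB i j.
apply: (@fa_ext _ _ _ hP (fun t => \sum_l A t i l * B t l j)).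
  by move=> t; rewrite mxE.
by apply: fa_sum => l _; apply: fa_mul.
Qed.

Lemma fa_det n (A : T -> 'M[K]_n) : fa_mx A -> P (fun t => \det (A t)).
Proof.
move=> hA; apply: fa_sum => s _; apply: fa_mul => //; first exact: fa_cst.
by apply: fa_prod => i _; apply: hA.
Qed.

Lemma fa_adj n (A : T -> 'M[K]_n) : fa_mx A -> fa_mx (fun t => \adj (A t)).
Proof.
move=> hA i j.
apply: (@fa_ext _ _ _ hP (fun t => cofactor (A t) j i)).
  by move=> t; rewrite mxE.
apply: fa_mul => //; first exact: fa_cst.
apply: fa_det => a b.
by apply: (fa_ext hP _ (hA (lift j a) (lift i b))) => t; rewrite !mxE.
Qed.

Definition fa_poly (p : T -> {poly K}) := forall b, P (fun t => (p t)`_b).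

Lemma fa_poly_cst p : fa_poly (fun=> p).
Proof. by move=> b; apply: fa_cst. Qed.

Lemma fa_poly_ext p q : p =1 q -> fa_poly p -> fa_poly q.
Proof. by move=> pq hp b; apply: (fa_ext hP _ (hp b)) => t; rewrite pq. Qed.

Lemma fa_poly_add p q :
  fa_poly p -> fa_poly q -> fa_poly (fun t => p t + q t).
Proof.
move=> hp hq b; apply: (fa_ext hP _ (fa_add hP (hp b) (hq b))) => t.
by rewrite coefD.
Qed.

Lemma fa_poly_opp p : fa_poly p -> fa_poly (fun t => - p t).
Proof.
by move=> hp b; apply: (fa_ext hP _ (fa_opp (hp b))) => t; rewrite coefN.
Qed.

Lemma fa_poly_mul p q :
  fa_poly p -> fa_poly q -> fa_poly (fun t => p t * q t).
Proof.
move=> hp hq b.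
apply: (@fa_ext _ _ _ hP (fun t => \sum_(i < b.+1) (p t)`_i * (q t)`_(b - i))).
  by move=> t; rewrite coefM.
by apply: fa_sum => i _; apply: fa_mul.
Qed.

Lemma fa_poly_sum (I : Type) (r : seq I) (Q : pred I) (F : I -> T -> {poly K}) :
  (forall i, Q i -> fa_poly (F i)) ->
  fa_poly (fun t => \sum_(i <- r | Q i) F i t).
Proof.
move=> hF b; apply: (@fa_ext _ _ _ hP
   (fun t => \sum_(i <- r | Q i) (F i t)`_b)).
  by move=> t; rewrite coef_sum.
by apply: fa_sum => i Qi; apply: hF.
Qed.

Lemma fa_poly_deriv p : fa_poly p -> fa_poly (fun t => (p t)^`()).
Proof.
move=> hp b; apply: (fa_ext hP _ (fa_mul hP (hp b.+1) (fa_cst hP b.+1%:R))).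
by move=> t; rewrite coef_deriv mulr_natr.
Qed.

Lemma fa_poly_comp n p :
  (0 < n)%N -> fa_poly p -> fa_poly (fun t => p t \Po 'X^n).
Proof.
move=> n0 hp b; apply: (@fa_ext _ _ _ hP
   (fun t => if (n %| b)%N then (p t)`_(b %/ n) else 0)).
  by move=> t; rewrite coef_comp_poly_Xn.
by case: (n %| b)%N; [apply: hp | apply: fa_cst].
Qed.

Definition fa_pmx n m (A : T -> 'M[{poly K}]_(n, m)) :=
  forall i j, fa_poly (fun t => A t i j).

Lemma fa_pmx_mul n m p (A : T -> 'M[{poly K}]_(n, m)) B :
  fa_pmx A -> fa_pmx B -> fa_pmx (fun t => A t *m B t : 'M_(n, p)).
Proof.
move=> hA hB i j.
apply: (@fa_poly_ext (fun t => \sum_l A t i l * B t l j)).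
  by move=> t; rewrite mxE.
by apply: fa_poly_sum => l _; apply: fa_poly_mul.
Qed.

Lemma fa_pmx_cst n m (B : 'M[{poly K}]_(n, m)) : fa_pmx (fun=> B).
Proof. by move=> i j b; apply: fa_cst. Qed.

Lemma fa_pmx_scalar (p : T -> {poly K}) :
  fa_poly p -> fa_pmx (fun t => (p t)%:M : 'M_1).
Proof.
move=> hp i j; apply: (@fa_poly_ext p) => // t.
by rewrite mxE !ord1 eqxx mulr1n.
Qed.

Lemma fa_pmx_scale n m (p : T -> {poly K}) (A : T -> 'M_(n, m)) :
  fa_poly p -> fa_pmx A -> fa_pmx (fun t => p t *: A t).
Proof.
move=> hp hA i j; apply: (@fa_poly_ext (fun t => p t * A t i j)).
  by move=> t; rewrite mxE.
exact: fa_poly_mul.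
Qed.

Lemma fa_pmx_row n m1 m2 (A : T -> 'M_(n, m1)) (B : T -> 'M_(n, m2)) :
  fa_pmx A -> fa_pmx B -> fa_pmx (fun t => row_mx (A t) (B t)).
Proof.
move=> hA hB i j; rewrite -(splitK j); case: (split j) => l /=.
  by apply: (fa_poly_ext _ (hA i l)) => t; rewrite row_mxEl.
by apply: (fa_poly_ext _ (hB i l)) => t; rewrite row_mxEr.
Qed.

Lemma fa_pmx_col n1 n2 m (A : T -> 'M_(n1, m)) (B : T -> 'M_(n2, m)) :
  fa_pmx A -> fa_pmx B -> fa_pmx (fun t => col_mx (A t) (B t)).
Proof.
move=> hA hB i j; rewrite -(splitK i); case: (split i) => l /=.
  by apply: (fa_poly_ext _ (hA l j)) => t; rewrite col_mxEu.
by apply: (fa_poly_ext _ (hB l j)) => t; rewrite col_mxEd.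
Qed.

Lemma fa_pmx_map n m (A : T -> 'M[{poly K}]_(n, m)) (g : {poly K} -> {poly K}) :
  (forall p, fa_poly p -> fa_poly (fun t => g (p t))) ->
  fa_pmx A -> fa_pmx (fun t => map_mx g (A t)).
Proof.
move=> hg hA i j; apply: (fa_poly_ext _ (hg _ (hA i j))) => t.
by rewrite mxE.
Qed.

Lemma fa_pmx_usub n1 n2 m (A : T -> 'M[{poly K}]_(n1 + n2, m)) :
  fa_pmx A -> fa_pmx (fun t => usubmx (A t)).
Proof.
by move=> hA i j; apply: (fa_poly_ext _ (hA (lshift _ i) j)) => t; rewrite mxE.
Qed.

Lemma fa_pmx_dsub n1 n2 m (A : T -> 'M[{poly K}]_(n1 + n2, m)) :
  fa_pmx A -> fa_pmx (fun t => dsubmx (A t)).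
Proof.
by move=> hA i j; apply: (fa_poly_ext _ (hA (rshift _ i) j)) => t; rewrite mxE.
Qed.
End FunAlg.

Section Persist.
Variables (K : fieldType) (T : Type) (P : (T -> K) -> Prop) (hP : funalg P).

(** If R is a right inverse of A at t0, then det (R A) is invertible near t0,
    and v0 - v0 A (R A)^-1 R solves the system; multiplying by the determinant
    clears the denominators. *)
Lemma solution_persists n m (A : T -> 'M[K]_(n, m)) t0 (v0 : 'rV_n) :
    fa_mx P A -> row_full (A t0) -> v0 *m A t0 = 0 ->
  exists v : T -> 'rV_n,
    [/\ fa_mx P v, forall t, v t *m A t = 0 & v t0 = v0].
Proof.
move=> hA /row_fullP[R RA] v0A.
pose v t := \det (R *m A t) *: v0 - v0 *m A t *m \adj (R *m A t) *m R.
have hRA : fa_mx P (fun t => R *m A t) by apply: fa_mulmx => //; apply: fa_mx_cst.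
exists v; split.
- move=> i j.
  have h1 : fa_mx P (fun t => v0 *m A t *m \adj (R *m A t) *m R).
    apply: fa_mulmx => //; last exact: fa_mx_cst.
    apply: fa_mulmx => //; last exact: fa_adj.
    by apply: fa_mulmx => //; apply: fa_mx_cst.
  apply: (@fa_ext _ _ _ hP (fun t => \det (R *m A t) * v0 i j
             + - (v0 *m A t *m \adj (R *m A t) *m R) i j)).
    by move=> t; rewrite !mxE.
  apply: fa_add => //; last by apply: fa_opp => //; apply: h1.
  by apply: fa_mul => //; [apply: fa_det | apply: fa_cst].
- move=> t; rewrite /v mulmxBl -scalemxAl -!mulmxA mul_adj_mx mul_mx_scalar.
  by rewrite -scalemxAr subrr.
- by rewrite /v v0A !mul0mx RA det1 scale1r subr0.
Qed.

Lemma row_full_persists n m (A : T -> 'M[K]_(n, m)) t0 :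
    fa_mx P A -> row_full (A t0) ->
  exists H : T -> K, [/\ P H, H t0 != 0 & forall t, H t != 0 -> row_full (A t)].
Proof.
move=> hA /row_fullP[R RA]; exists (fun t => \det (R *m A t)); split.
- by apply: fa_det => //; apply: fa_mulmx => //; apply: fa_mx_cst.
- by rewrite RA det1 oner_eq0.
- move=> t; rewrite -unitfE -[_ \is a GRing.unit]unitmxE => hu.
  by apply/row_fullP; exists (invmx (R *m A t) *m R); rewrite -mulmxA mulVmx.
Qed.

Lemma row_free_persists n m (A : T -> 'M[K]_(n, m)) t0 :
    fa_mx P A -> row_free (A t0) ->
  exists H : T -> K, [/\ P H, H t0 != 0 & forall t, H t != 0 -> row_free (A t)].
Proof.
move=> hA /row_freeP[R AR]; exists (fun t => \det (A t *m R)); split.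
- by apply: fa_det => //; apply: fa_mulmx => //; apply: fa_mx_cst.
- by rewrite AR det1 oner_eq0.
- move=> t; rewrite -unitfE -[_ \is a GRing.unit]unitmxE => hu.
  by apply/row_freeP; exists (R *m invmx (A t *m R)); rewrite mulmxA mulmxV.
Qed.
End Persist.

(** * Systems of polynomial equations with bounded degrees *)

Section PolyVec.
Variable K : fieldType.

Section Index.
Variables (N : nat) (nn : 'I_N -> nat).

(** Index of the coefficients of a vector of polynomials of sizes at most nn, so that
    linear systems on such vectors become matrices. *)
Definition pidx : finType := {i : 'I_N & 'I_(nn i)}.
Definition pfst (a : 'I_#|pidx|) : 'I_N := tag (enum_val a).
Definition psnd (a : 'I_#|pidx|) : 'I_(nn (pfst a)) := tagged (enum_val a).
Definition pmk i (b : 'I_(nn i)) : 'I_#|pidx| :=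
  enum_rank (Tagged (fun i => 'I_(nn i)) b : pidx).

Lemma pmkK a : pmk (psnd a) = a.
Proof.
have tagK (u : pidx) : (Tagged (fun i => 'I_(nn i)) (tagged u) : pidx) = u.
  by case: u.
by rewrite -[RHS]enum_valK; congr enum_rank; apply: tagK.
Qed.

Lemma pfst_pmk i (b : 'I_(nn i)) : pfst (pmk b) = i.
Proof. by rewrite /pfst /pmk enum_rankK. Qed.

Lemma psnd_pmk i (b : 'I_(nn i)) : psnd (pmk b) = b :> nat.
Proof. by rewrite /psnd /pmk /pfst enum_rankK. Qed.

Lemma big_pidx (V : nmodType) (F : forall i, 'I_(nn i) -> V) :
  \sum_i \sum_(b < nn i) F i b = \sum_a F (pfst a) (psnd a).
Proof.
rewrite (@sig_big_dep _ _ _ _ (fun i => 'I_(nn i)) xpredT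
  (fun _ _ => true) F) /=.
rewrite (reindex (@enum_val pidx (mem predT))) //=.
by apply: onW_bij; apply: enum_val_bij.
Qed.

Lemma card_pidx : #|pidx| = (\sum_i nn i)%N.
Proof.
rewrite card_tagged sumnE big_map big_enum /=.
by apply: eq_bigr => i _; rewrite card_ord.
Qed.

Definition sized (s : 'cV[{poly K}]_N) :=
  forall i, (size (s i ord0) <= nn i)%N.

Definition pv (s : 'cV[{poly K}]_N) : 'rV[K]_#|pidx| :=
  \row_a (s (pfst a) ord0)`_(psnd a).

Definition vp (v : 'rV[K]_#|pidx|) : 'cV[{poly K}]_N :=
  \col_i \sum_(b < nn i) v ord0 (pmk b) *: 'X^b.

Lemma sized_vp v : sized (vp v).
Proof.
move=> i; rewrite mxE; apply: (leq_trans (size_sum _ _ _)).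
apply/bigmax_leqP => b _; apply: (leq_trans (size_scale_leq _ _)).
by rewrite size_polyXn.
Qed.

Lemma coef_vp v i (b : 'I_(nn i)) : (vp v i ord0)`_b = v ord0 (pmk b).
Proof.
rewrite mxE coef_sum (bigD1 b) //= coefZ coefXn eqxx mulr1 big1 ?addr0 //.
move=> c; rewrite coefZ coefXn -val_eqE eq_sym /= => /negbTE ->.
by rewrite mulr0.
Qed.

Lemma vpK : cancel vp pv.
Proof. by move=> v; apply/rowP => a; rewrite mxE coef_vp pmkK. Qed.

Lemma pvE s i (b : 'I_(nn i)) : pv s ord0 (pmk b) = (s i ord0)`_b.
Proof. by rewrite mxE psnd_pmk pfst_pmk. Qed.

Lemma pvK s : sized s -> vp (pv s) = s.
Proof.
move=> hs; apply/colP => i; apply/polyP => b.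
case: (ltnP b (nn i)) => hb.
  by rewrite (coef_vp _ (Ordinal hb)) pvE.
by rewrite !nth_default // ?(leq_trans (hs i)) ?(leq_trans (sized_vp _ i)).
Qed.

Lemma pv_inj s1 s2 : sized s1 -> sized s2 -> pv s1 = pv s2 -> s1 = s2.
Proof. by move=> h1 h2 e; rewrite -(pvK h1) e pvK. Qed.

Lemma pv0 : pv 0 = 0.
Proof. by apply/rowP => a; rewrite !mxE coef0. Qed.

Lemma sized0 : sized 0.
Proof. by move=> i; rewrite mxE size_poly0. Qed.
End Index.

(** The matrix of q |-> S q on the vectors of coefficients. *)
Definition multiples N R (nn : 'I_N -> nat) (ll : 'I_R -> nat)
    (S : 'M[{poly K}]_(N, R)) : 'M[K]_(#|pidx ll|, #|pidx nn|) :=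
  \matrix_(a, c) ('X^(psnd a) * S (pfst c) (pfst a))`_(psnd c).

Lemma pv_mul N R (nn : 'I_N -> nat) (ll : 'I_R -> nat) S q :
  sized ll q -> pv nn (S *m q) = pv ll q *m multiples nn ll S.
Proof.
move=> hq; apply/rowP => c; rewrite !mxE coef_sum.
transitivity (\sum_f \sum_(j < ll f) pv ll q ord0 (pmk j) *
   ('X^j * S (pfst c) f)`_(psnd c)).
  apply: eq_bigr => f _; rewrite -[in LHS](pvK hq) [vp _ _ _]mxE mulr_sumr.
  rewrite coef_sum; apply: eq_bigr => j _.
  by rewrite -scalerAr coefZ mulrC [_ * 'X^j]mulrC mulrC.
rewrite big_pidx; apply: eq_bigr => a _.
by rewrite pmkK [multiples _ _ _ _ _]mxE.
Qed.

(** The coefficients of M s(t^st) of low degree. The stretch st is 1 for all vectors and 2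
    for those with coefficients in the square of the variable. *)
Definition coef_system N E st (JJ : 'I_E -> nat) (M : 'M[{poly K}]_(E, N))
    (s : 'cV_N) :=
  forall e b, (b < JJ e)%N -> ((M *m map_mx (comp_poly 'X^st) s) e ord0)`_b = 0.

Definition sysmx N E st (nn : 'I_N -> nat) (JJ : 'I_E -> nat)
    (M : 'M[{poly K}]_(E, N)) : 'M[K]_(#|pidx nn|, #|pidx JJ|) :=
  \matrix_(a, c) (M (pfst c) (pfst a) * 'X^(st * psnd a))`_(psnd c).

Lemma pv_sysmx N E st (nn : 'I_N -> nat) (JJ : 'I_E -> nat) M s :
  sized nn s ->
  pv nn s *m sysmx st nn JJ M = pv JJ (M *m map_mx (comp_poly 'X^st) s).
Proof.
move=> hs; apply/rowP => c; rewrite !mxE coef_sum.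
transitivity (\sum_f \sum_(j < nn f) pv nn s ord0 (pmk j) *
   (M (pfst c) f * 'X^(st * j))`_(psnd c)).
  rewrite big_pidx; apply: eq_bigr => a _.
  by rewrite pmkK [sysmx _ _ _ _ _ _]mxE.
apply: eq_bigr => f _; rewrite mxE -[in RHS](pvK hs) [vp _ _ _]mxE.
rewrite linear_sum mulr_sumr coef_sum; apply: eq_bigr => j _.
by rewrite linearZ /= comp_Xn_poly -exprM -scalerAr coefZ.
Qed.

Lemma coef_systemP N E st (nn : 'I_N -> nat) (JJ : 'I_E -> nat) M s :
  sized nn s -> coef_system st JJ M s <-> pv nn s *m sysmx st nn JJ M = 0.
Proof.
move=> hs; rewrite pv_sysmx //; split.
  by move=> h; apply/rowP => a; rewrite mxE h ?mxE.
by move=> h e b hb; rewrite -(pvE _ (Ordinal hb)) h mxE.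
Qed.

(** Rank-nullity: if the solutions are spanned by the multiples of the columns
    of S, and there are at most as many of these as unknowns minus equations,
    then the system is surjective. *)
Lemma sysmx_full N E R st (nn : 'I_N -> nat) (JJ : 'I_E -> nat)
    (ll : 'I_R -> nat) (M : 'M[{poly K}]_(E, N)) (S : 'M[{poly K}]_(N, R)) :
  (forall s, sized nn s -> coef_system st JJ M s ->
     exists2 q, sized ll q & s = S *m q) ->
  (\sum_i ll i + \sum_i JJ i <= \sum_i nn i)%N ->
  row_full (sysmx st nn JJ M).
Proof.
move=> hker; rewrite -!card_pidx => hcard; rewrite /row_full eqn_leq.
rewrite rank_leq_col /=; set A := sysmx _ _ _ _.
have hk : (kermx A <= multiples nn ll S)%MS.
  apply/rV_subP => v /sub_kermxP hv.
  have [|q hq E1] := hker (vp v) (@sized_vp _ _ v).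
    by apply/(coef_systemP st JJ M (sized_vp v)); rewrite vpK.
  by apply/submxP; exists (pv ll q); rewrite -pv_mul // -E1 vpK.
have := leq_trans (mxrankS hk) (rank_leq_row _); rewrite mxrank_ker.
move=> h; have := rank_leq_row A; move: hcard h.
have arith a b c n : (b + c <= n -> n - a <= b -> a <= n -> c <= a)%N by lia.
exact: arith.
Qed.

(** Rank-nullity in the other direction: the independent multiples of the columns of S are
    as many as the dimension of the space of solutions. *)
Lemma sysmx_full_span N E R st (nn : 'I_N -> nat) (JJ : 'I_E -> nat)
    (ll : 'I_R -> nat) (M : 'M[{poly K}]_(E, N)) (S : 'M[{poly K}]_(N, R)) :
  row_full (sysmx st nn JJ M) ->
  (\sum_i nn i <= \sum_i ll i + \sum_i JJ i)%N ->
  (forall q, sized ll q -> sized nn (S *m q)) ->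
  (forall q, sized ll q -> coef_system st JJ M (S *m q)) ->
  (forall q, sized ll q -> S *m q = 0 -> q = 0) ->
  forall s, sized nn s -> coef_system st JJ M s -> exists2 q, sized ll q & s = S *m q.
Proof.
rewrite -!card_pidx => /eqP hA hcard hsz hsol hind s hs.
move=> /(coef_systemP st JJ M hs) hv; set A := sysmx _ _ _ _ in hA hv.
have hB : row_free (multiples nn ll S).
  apply/row_freeP/row_freeP; rewrite -kermx_eq0; apply/rowV0P => v.
  move/sub_kermxP => hv0; rewrite -[v]vpK -pv_mul in hv0; last exact: sized_vp.
  rewrite -[v]vpK; rewrite (hind (vp v)) ?pv0 //; first exact: sized_vp.
  apply: (@pv_inj _ nn) => //; first by apply: hsz; apply: sized_vp.
    exact: sized0.
  by rewrite hv0 pv0.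
have hk : (multiples nn ll S <= kermx A)%MS.
  apply/rV_subP => v /submxP[u ->]; apply/sub_kermxP.
  rewrite -[u]vpK -pv_mul; last exact: sized_vp.
  apply/(coef_systemP st JJ M (hsz _ (sized_vp u))).
  by apply: hsol; apply: sized_vp.
have : (kermx A <= multiples nn ll S)%MS.
  rewrite -(geq_leqif (mxrank_leqif_sup hk)) mxrank_ker hA (eqP hB).
  by rewrite leq_subLR addnC.
move=> /(submx_trans (_ : (pv nn s <= kermx A)%MS)) h.
have /submxP[u hu] : (pv nn s <= multiples nn ll S)%MS.
  by apply: h; apply/sub_kermxP.
exists (vp u); first exact: sized_vp.
apply: (@pv_inj _ nn) => //; first by apply: hsz; apply: sized_vp.
by rewrite (@pv_mul _ _ nn ll) ?vpK //; apply: sized_vp.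
Qed.

Lemma multiples_free N R (nn : 'I_N -> nat) (ll : 'I_R -> nat)
    (S : 'M[{poly K}]_(N, R)) :
  (forall q, sized ll q -> sized nn (S *m q)) ->
  (forall q, sized ll q -> S *m q = 0 -> q = 0) <->
  row_free (multiples nn ll S).
Proof.
move=> hsz; split=> [hind|hB q hq Sq].
  rewrite -kermx_eq0; apply/rowV0P => v.
  move/sub_kermxP => hv0; rewrite -[v]vpK -pv_mul in hv0; last exact: sized_vp.
  rewrite -[v]vpK; rewrite (hind (vp v)) ?pv0 //; first exact: sized_vp.
  apply: (@pv_inj _ nn) => //; first by apply: hsz; apply: sized_vp.
    exact: sized0.
  by rewrite hv0 pv0.
apply: (@pv_inj _ ll) => //; first exact: sized0.
rewrite pv0; apply/eqP; rewrite -(mulmx_free_eq0 _ hB) -pv_mul //.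
by rewrite Sq pv0.
Qed.
End PolyVec.

(** The system is a matrix in the coefficients, so this is solution_persists. *)
Lemma poly_solution_persists (K : fieldType) (T : Type) (P : (T -> K) -> Prop)
    N E st (nn : 'I_N -> nat) (JJ : 'I_E -> nat)
    (M : T -> 'M[{poly K}]_(E, N)) t0 s0 :
  funalg P -> fa_pmx P M -> row_full (sysmx st nn JJ (M t0)) ->
  sized nn s0 -> coef_system st JJ (M t0) s0 ->
  exists s : T -> 'cV_N, [/\ fa_pmx P s, forall t, sized nn (s t),
    forall t, coef_system st JJ (M t) (s t) & s t0 = s0].
Proof.
move=> hP hM hfull hs0 /coef_systemP - /(_ _ hs0) hv0.
have hA : fa_mx P (fun t => sysmx st nn JJ (M t)).
  move=> a c; have h := fa_poly_mul hP (hM (pfst c) (pfst a))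
    (fa_poly_cst hP 'X^(st * psnd a)).
  by apply: (fa_ext hP _ (h (psnd c))) => t; rewrite [RHS]mxE.
have [v [h1 h2 h3]] := solution_persists hP hA hfull hv0.
exists (fun t => vp (v t)); split.
- move=> i j b; rewrite (ord1 j); case: (ltnP b (nn i)) => hb.
    apply: (fa_ext hP _ (h1 ord0 (pmk (Ordinal hb)))) => t.
    by rewrite (coef_vp _ (Ordinal hb)).
  apply: (fa_ext hP _ (fa_cst hP 0)) => t.
  by rewrite nth_default //; apply: (leq_trans (sized_vp _ _)).
- by move=> t; apply: sized_vp.
- by move=> t; apply/(coef_systemP st JJ (M t) (sized_vp (v t))); rewrite vpK.
- by rewrite h3 pvK.
Qed.

Lemma sysmx_fa (K : fieldType) (T : Type) (P : (T -> K) -> Prop)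
    N E st (nn : 'I_N -> nat) (JJ : 'I_E -> nat)
    (M : T -> 'M[{poly K}]_(E, N)) :
  funalg P -> fa_pmx P M -> fa_mx P (fun t => sysmx st nn JJ (M t)).
Proof.
move=> hP hM a c; have h := fa_poly_mul hP (hM (pfst c) (pfst a))
  (fa_poly_cst hP 'X^(st * psnd a)).
by apply: (fa_ext hP _ (h (psnd c))) => t; rewrite [RHS]mxE.
Qed.

Lemma multiples_fa (K : fieldType) (T : Type) (P : (T -> K) -> Prop)
    N R (nn : 'I_N -> nat) (ll : 'I_R -> nat) (S : T -> 'M[{poly K}]_(N, R)) :
  funalg P -> fa_pmx P S -> fa_mx P (fun t => multiples nn ll (S t)).
Proof.
move=> hP hS a c; have h := fa_poly_mul hP (fa_poly_cst hP 'X^(psnd a))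
  (hS (pfst c) (pfst a)).
by apply: (fa_ext hP _ (h (psnd c))) => t; rewrite [RHS]mxE.
Qed.

(** * Polynomial matrices of full rank at every point *)

Section Unimodular.
Variable K : closedFieldType.

Notation "M .@ b" := (map_mx (horner_eval b) M) (at level 2, format "M .@ b").

Lemma row_bezout m (v : 'rV[{poly K}]_m) :
  exists (u : 'cV_m) (d : {poly K}), v *m u = d%:M /\ forall j, d %| v 0 j.
Proof.
elim: m v => [|m IH] v.
  exists 0, 0; split; last by case.
  by rewrite mulmx0; apply/matrixP => i j; rewrite !mxE mul0rn.
rewrite -[m.+1]/(1 + m)%N in v *; have [u [d [vu hd]]] := IH (rsubmx v).
have [[a b] /= /eqp_dvdl hab] := Bezoutp (v 0 0) d.
exists (col_mx a%:M (b *: u)), (a * v 0 0 + b * d); split.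
  rewrite -[X in X *m _]hsubmxK mul_row_col -scalemxAr vu mul_mx_scalar.
  apply/matrixP => i j; rewrite !mxE !ord1 eqxx !mulr1n; congr (a * v _ _ + _).
  exact: val_inj.
move=> j; rewrite hab -(splitK j); case: (split j) => l /=.
  by rewrite (ord1 l) lshift0 dvdp_gcdl.
by apply: (dvdp_trans (dvdp_gcdr _ _)); have := hd l; rewrite mxE.
Qed.

(** A generator of the ideal of the entries has no root. *)
Lemma row_unimod m (v : 'rV[{poly K}]_m) :
  (forall b, v.@b != 0) -> exists u : 'cV_m, v *m u = 1%:M.
Proof.
move=> hv; have [u [d [vu hd]]] := row_bezout v.
have d1 : size d == 1%N.
  apply/negP => /negP /closed_rootP[b /eqP db].
  move/eqP: (hv b); apply; apply/rowP => j; rewrite !mxE /horner_eval.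
  by have /dvdpP[q ->] := hd j; rewrite hornerM db mulr0.
have [c c0 dc] := size_poly1P _ d1.
exists (c^-1%:P *: u); rewrite -scalemxAr vu dc scale_scalar_mx -polyCM.
by rewrite mulVf.
Qed.

Lemma row_free_block n1 n2 m (A : 'M[K]_(n1, m)) (B : 'M[K]_(n2, m)) :
  row_free (col_mx A B) ->
  forall (x : 'rV_n1) (y : 'rV_n2), x *m A + y *m B = 0 -> x = 0 /\ y = 0.
Proof.
move=> hf x y; rewrite -mul_row_col => h.
have : row_mx x y == 0 by rewrite -(mulmx_free_eq0 _ hf) h.
by rewrite row_mx_eq0 => /andP[/eqP-> /eqP->].
Qed.

(** Induction on the number of rows: if v u = 1 for the first row v, then
    the other rows times the projection 1 - u v still have full rank at every
    point, because u v is the identity on multiples of v. *)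
Lemma unimod n m (M : 'M[{poly K}]_(n, m)) :
  (forall b, row_free M.@b) -> exists R : 'M_(m, n), M *m R = 1%:M.
Proof.
elim: n M => [|n IH] M hM.
  by exists 0; apply/matrixP; case.
rewrite -[n.+1]/(1 + n)%N in M hM *.
pose v := usubmx M; pose M' := dsubmx M.
have MvM : M = col_mx v M' by rewrite vsubmxK.
have hb b : row_free (col_mx v.@b M'.@b) by rewrite -map_col_mx -MvM.
have [u vu] : exists u : 'cV_m, v *m u = 1%:M.
  apply: row_unimod => b; apply/negP => /eqP v0.
  have := row_free_block (hb b) (x := 1%:M) (y := 0).
  rewrite v0 mulmx0 mul0mx addr0 => /(_ erefl)[/matrixP /(_ 0 0)].
  by rewrite !mxE => /eqP; rewrite oner_eq0.
pose Q := 1%:M - u *m v.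
have vQ : v *m Q = 0 by rewrite mulmxBr mulmx1 mulmxA vu mul1mx subrr.
have [R' hR'] : exists R : 'M_(m, n), (M' *m Q) *m R = 1%:M.
  apply: IH => b; rewrite -kermx_eq0; apply/rowV0P => x /sub_kermxP.
  rewrite map_mxM map_mxB map_mx1 map_mxM mulmxBr mulmx1 mulmxBr => hx.
  have hx' : (- (x *m M'.@b *m u.@b)) *m v.@b + x *m M'.@b = 0.
    by rewrite addrC mulNmx -[RHS]hx !mulmxA.
  by have [] := row_free_block (hb b) hx'.
exists (row_mx (u - Q *m R' *m (M' *m u)) (Q *m R')).
rewrite MvM mul_col_row !mulmxBr vu !mulmxA vQ !mul0mx subr0 hR' mul1mx subrr.
by rewrite -scalar_mx_block.
Qed.

(** With a right inverse R of T and a left inverse L of S such that L R = 0, the square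
    matrices (T; L) and (R, S) are inverse to each other, so R T + S L = 1. *)
Lemma split_exact n m p (T : 'M[{poly K}]_(n, m)) (S : 'M_(m, p)) :
  (n + p = m)%N -> (forall b, row_free T.@b) -> (forall b, row_free (S.@b)^T) ->
  T *m S = 0 ->
  (forall r : 'rV_m, r *m S = 0 -> exists x : 'rV_n, r = x *m T) /\
  (forall e : 'rV_p, exists r : 'rV_m, r *m S = e).
Proof.
move=> enm hT hS TS; have [R TR] := unimod hT.
have [L0 SL] : exists L0 : 'M_(m, p), S^T *m L0 = 1%:M.
  by apply: unimod => b; rewrite -map_trmx.
pose L := L0^T *m (1%:M - R *m T).
have LS : L *m S = 1%:M.
  rewrite /L -mulmxA mulmxBl mul1mx -mulmxA TS mulmx0 subr0.
  by rewrite -[S]trmxK -trmx_mul SL trmx1.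
have LR : L *m R = 0.
  by rewrite /L -mulmxA mulmxBl mul1mx -mulmxA TR mulmx1 subrr mulmx0.
move: T S hT hS TS R TR L0 SL L LS LR; rewrite -enm.
move=> T S hT hS TS R TR L0 SL L LS LR.
have : col_mx T L *m row_mx R S = 1%:M.
  by rewrite mul_col_row TR TS LR LS -scalar_mx_block.
move/mulmx1C; rewrite mul_row_col => J; split=> [r rS|e].
  by exists (r *m R); rewrite -[LHS]mulmx1 -J mulmxDr !mulmxA rS mul0mx addr0.
by exists (e *m L); rewrite -mulmxA LS mulmx1.
Qed.
End Unimodular.

(** * The two charts of the projective line *)

Section Reversal.
Variable R : comNzRingType.
Implicit Types p q : {poly R}.

(** The polynomial of the form of degree n with dehomogenization p, in the
    chart at infinity. *)
Definition rev_poly n (p : {poly R}) := \poly_(j < n.+1) p`_(n - j).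

Lemma size_rev_poly n p : (size (rev_poly n p) <= n.+1)%N.
Proof. exact: size_poly. Qed.

Lemma coef_rev_poly n p j :
  (rev_poly n p)`_j = if (j <= n)%N then p`_(n - j) else 0.
Proof. by rewrite coef_poly ltnS. Qed.

Lemma rev_polyK n p : (size p <= n.+1)%N -> rev_poly n (rev_poly n p) = p.
Proof.
move=> hp; apply/polyP => j; rewrite !coef_rev_poly leq_subr.
by case: leqP => h; [rewrite subKn | rewrite nth_default ?(leq_trans hp)].
Qed.

Lemma rev_polyD n p q : rev_poly n (p + q) = rev_poly n p + rev_poly n q.
Proof.
apply/polyP => j; rewrite coefD !coef_rev_poly coefD.
by case: ifP; rewrite ?addr0.
Qed.

Lemma horner_rev0 n p : (rev_poly n p).[0] = p`_n.
Proof. by rewrite horner_coef0 coef_rev_poly subn0. Qed.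

(** Euler's relation, dehomogenized at infinity. *)
Lemma deriv_rev n (p : {poly R}) : (size p <= n.+1)%N ->
  'X * p^`() = rev_poly n ((rev_poly n p) *+ n - 'X * (rev_poly n p)^`()).
Proof.
move=> hp; apply/polyP => j.
rewrite coef_rev_poly coefXM coefB coefMn coefXM !coef_deriv !coef_rev_poly.
rewrite leq_subr; case: (leqP j n) => hj; last first.
  case: j hj => // j hj; rewrite nth_default ?mul0rn //=.
  by rewrite (leq_trans hp).
rewrite subKn //; case: j hj => [|j] hj /=.
  rewrite subn0; case: (n =P 0)%N => [->|/eqP n0]; first by rewrite mulr0n subr0.
  by rewrite prednK ?lt0n // leqnn subnn subrr.
case: (n - j.+1 =P 0)%N => h0.
  by rewrite (_ : j.+1 = n) ?subr0 //; lia.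
rewrite prednK ?lt0n ?leq_subr; last by apply/eqP.
by rewrite subKn // -mulrnBr; [congr (_ *+ _); lia | lia].
Qed.
End Reversal.

Section HornerRev.
Variable K : fieldType.
Lemma horner_rev n (p : {poly K}) b : (size p <= n.+1)%N -> b != 0 ->
  (rev_poly n p).[b] = b ^+ n * p.[b^-1].
Proof.
move=> hp b0; rewrite (horner_coef_wide _ hp) horner_poly mulr_sumr.
rewrite (reindex_inj rev_ord_inj) /=; apply: eq_bigr => j _.
rewrite subSS subKn -1?ltnS //; rewrite mulrCA; congr (_ * _).
rewrite -[X in _ = b ^+ X * _](@subnK j n) -1?ltnS // exprD -mulrA -exprMn.
by rewrite mulfV // expr1n mulr1.
Qed.
End HornerRev.

Section Charts.
Variable K : closedFieldType.

Implicit Types p q : {poly K}.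
Notation F := (ratfun K).
Notation t := (tvar K).

Lemma tvar_neq0 : t != 0.
Proof. by rewrite tofrac_eq0 polyX_eq0. Qed.

Definition chart_coord (c : chart) : F :=
  match c with U_0 => t | U_oo => t^-1 end.

(** The restriction to the generic point of the functions on a chart. *)
Definition io (c : chart) : {rmorphism {poly K} -> F} :=
  horner_eval (chart_coord c) \o map_poly (@tofrac {poly K} \o polyC).

Lemma ioE c p : io c p = (map_poly (@cst K) p).[chart_coord c].
Proof. by []. Qed.

Lemma io_U0 p : io U_0 p = tofrac p.
Proof.
rewrite ioE /= (_ : map_poly _ p = map_poly (@tofrac {poly K}) (map_poly polyC p)).
  by rewrite /chart_coord /tvar horner_map -[p^:P.['X]]/(p \Po 'X) comp_polyXr.
by rewrite -[RHS]map_poly_comp.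
Qed.

Lemma ioX c : io c 'X = chart_coord c.
Proof. by rewrite /= map_polyX /horner_eval hornerX. Qed.

(** The generator S^n or T^n of O(n) on a chart, in terms of S^n. *)
Definition mu (c : chart) n : F := match c with U_0 => 1 | U_oo => t ^+ n end.

Lemma mu_neq0 c n : mu c n != 0.
Proof. by case: c; rewrite /= ?oner_eq0 // expf_neq0 // tvar_neq0. Qed.

Lemma muD c n m : mu c (n + m) = mu c n * mu c m.
Proof. by case: c; rewrite /= ?mulr1 // exprD. Qed.

Lemma mu0 c : mu c 0 = 1.
Proof. by case: c. Qed.

Definition ch (c : chart) n (p : {poly K}) :=
  match c with U_0 => p | U_oo => rev_poly n p end.

Lemma io_sum c n p : (size p <= n)%N ->
  io c p = \sum_(j < n) cst p`_j * chart_coord c ^+ j.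
Proof.
move=> hp; rewrite ioE (horner_coef_wide (n := n)); last first.
  exact: leq_trans (size_poly _ _) hp.
by apply: eq_bigr => j _; rewrite coef_map_id0 ?raddf0.
Qed.

Lemma chK n p c : (size p <= n.+1)%N -> tofrac p = mu c n * io c (ch c n p).
Proof.
case: c => hp; first by rewrite /mu mul1r io_U0.
rewrite -io_U0 (io_sum _ hp) (io_sum _ (size_rev_poly n p)) mulr_sumr.
rewrite [RHS](reindex_inj rev_ord_inj) /=; apply: eq_bigr => j _.
rewrite coef_rev_poly subSS leq_subr subKn -1?ltnS // mulrCA; congr (_ * _).
rewrite -[X in t ^+ X * _](@subnKC j n) -1?ltnS // exprD -mulrA -exprMn.
by rewrite mulfV ?tvar_neq0 // expr1n mulr1.
Qed.

Lemma io_inj c : injective (io c).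
Proof.
move=> p q /eqP; rewrite -subr_eq0 -rmorphB => /eqP.
set u := p - q => hu; apply/eqP; rewrite -subr_eq0 -/u.
case: c hu => hu; first by rewrite io_U0 in hu; rewrite -tofrac_eq0 hu.
have hs : (size (rev_poly (size u) u) <= (size u).+1)%N by apply: size_rev_poly.
have := @chK (size u) _ U_oo hs; rewrite /= rev_polyK ?leqnSn //.
rewrite -[_ * _]/(_ * io U_oo u) hu mulr0 => /eqP; rewrite tofrac_eq0 => /eqP h.
by rewrite -(@rev_polyK _ (size u) u) // h; apply/eqP/polyP => j;
  rewrite coef_rev_poly !coef0; case: ifP.
Qed.
End Charts.

Lemma size_mul_bound (R : comNzRingType) n m (p q : {poly R}) :
  (size p <= n.+1)%N -> (size q <= m.+1)%N -> (size (p * q)%R <= (n + m).+1)%N.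
Proof. by move=> hp hq; apply: (leq_trans (size_polyMleq _ _)); lia. Qed.

Lemma vfield_alg0 (F : fieldType) n (t g h p q : F) :
  g * (p *+ n - t * q) + h * q = g * (p *+ n) + (h - g * t) * q.
Proof. ring. Qed.

Lemma vfield_alg1 (F : fieldType) n (t x y T a b B : F) :
  t != 0 -> t * B = T * (a *+ n - t^-1 * b) ->
  t * x * ((T * a) *+ n - t * B) + t * y * B =
  T * (y * (a *+ n) + (x - y * t^-1) * b).
Proof.
move=> t0 h.
have -> : t * x * ((T * a) *+ n - t * B) + t * y * B =
  t * x * ((T * a) *+ n - t * B) + y * (t * B) by ring.
by rewrite h -mulrnAr; field.
Qed.

Section ChartRing.
Variable K : closedFieldType.
Notation F := (ratfun K).
Notation t := (tvar K).
Notation io := (@io K).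
Notation mu := (@mu K).
Implicit Types p q : {poly K}.

Lemma ch0 c n : ch c n (0 : {poly K}) = 0.
Proof.
case: c => //=; apply/polyP => j; rewrite coef_rev_poly !coef0.
by case: ifP.
Qed.

Lemma chD c n p q : ch c n (p + q) = ch c n p + ch c n q.
Proof. by case: c => //=; apply: rev_polyD. Qed.

Lemma ch_sum c n (I : Type) (r : seq I) (Q : pred I) (G : I -> {poly K}) :
  ch c n (\sum_(i <- r | Q i) G i) = \sum_(i <- r | Q i) ch c n (G i).
Proof.
elim/big_rec2: _ => [|i x y _ <-]; first exact: ch0.
exact: chD.
Qed.

Lemma ch_eq c n p q : (size p <= n.+1)%N ->
  tofrac p = mu c n * io c q :> F -> ch c n p = q.
Proof.
move=> hp; rewrite (chK c hp) => /(mulfI (mu_neq0 _ _ _)).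
exact: io_inj.
Qed.

Lemma chM c n m p q : (size p <= n.+1)%N -> (size q <= m.+1)%N ->
  ch c (n + m) (p * q) = ch c n p * ch c m q.
Proof.
move=> hp hq; apply: ch_eq; first exact: size_mul_bound.
by rewrite tofracM (chK c hp) (chK c hq) muD rmorphM mulrACA.
Qed.

Lemma twistP (a : nat) c (x : F) :
  twist a%:Z c x <-> exists q, x = mu c a * io c q.
Proof.
case: c; last by [].
by split=> -[q ->]; exists q; rewrite /mu mul1r io_U0.
Qed.

(** In both charts, the vector fields g d/dS + h d/dT become polynomial multiples of
    the derivative along the chart, up to multiples of the Euler field. *)
Lemma differential_chart c (g h : F) : twist 1 c g -> twist 1 c h ->
  exists al ga : {poly K}, forall n p, (size p <= n.+1)%N ->
    g * (tofrac p *+ n - t * tofrac p^`()) + h * tofrac p^`() =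
    mu c n * io c (al * (ch c n p *+ n) + ga * (ch c n p)^`()).
Proof.
move=> /(twistP 1)[G ->] /(twistP 1)[H ->].
case: c.
  exists G, (H - G * 'X) => n p hp; rewrite /mu /ch !mul1r !io_U0.
  by rewrite vfield_alg0 tofracD !tofracM tofracB tofracM tofracMn.
exists H, (G - H * 'X) => n p hp.
have e1 := chK U_oo hp.
have e2 : t * tofrac p^`() =
    t ^+ n * io U_oo (rev_poly n p *+ n - 'X * (rev_poly n p)^`()).
  rewrite -tofracM (deriv_rev hp) (chK U_oo (size_rev_poly _ _)).
  rewrite /ch rev_polyK //; apply/leq_sizeP => j hj.
  rewrite coefB coefMn coefXM coef_deriv !coef_rev_poly leqNgt hj mul0rn.
  by case: j hj => [|j] hj; rewrite //= leqNgt hj mul0rn subrr.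
rewrite e1 [mu U_oo 1]expr1 /mu.
rewrite (@vfield_alg1 _ _ t (io U_oo G) (io U_oo H) (t ^+ n)
  (io U_oo (ch U_oo n p)) (io U_oo (rev_poly n p)^`())).
- by rewrite rmorphD !rmorphM rmorphB rmorphM ioX rmorphMn.
- exact: tvar_neq0.
- by rewrite e2 rmorphB rmorphM ioX rmorphMn.
Qed.
End ChartRing.

(** * From sections of the conormal bundle to a splitting *)

Section Conormal.
Variables (K : fieldType) (S M : nat).

(** The Euler relations and the derivative of a map (p, e w), w to the blow-up,
    in the Cox coordinates (p, e, w); signs do not matter in characteristic 2.
    The conormal bundle is the kernel. *)
Definition Tmx (p : 'rV[{poly K}]_S) (e : {poly K}) (w : 'rV[{poly K}]_M) :
    'M[{poly K}]_(1 + (1 + 1), S + (1 + M)) :=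
  col_mx (row_mx p (row_mx e%:M 0))
    (col_mx (row_mx 0 (row_mx e%:M w))
       (row_mx (map_mx deriv p) (row_mx (e^`())%:M (map_mx deriv w)))).

Definition xpart R (s : 'M[{poly K}]_(S + (1 + M), R)) := usubmx s.
Definition ypart R (s : 'M[{poly K}]_(S + (1 + M), R)) := usubmx (dsubmx s).
Definition upart R (s : 'M[{poly K}]_(S + (1 + M), R)) := dsubmx (dsubmx s).

Lemma Tmx_mul R p e w (s : 'M_(_, R)) :
  Tmx p e w *m s =
  col_mx (p *m xpart s + e *: ypart s)
    (col_mx (e *: ypart s + w *m upart s)
       (map_mx deriv p *m xpart s + e^`() *: ypart s
          + map_mx deriv w *m upart s)).
Proof.
rewrite -{1}[s]vsubmxK -[dsubmx s]vsubmxK !mul_col_mx !mul_row_col.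
by rewrite !mul_scalar_mx !mul0mx add0r addr0 addrA.
Qed.

Lemma Tmx0P R p e w (s : 'M_(_, R)) :
  Tmx p e w *m s = 0 <->
  [/\ p *m xpart s + e *: ypart s = 0, e *: ypart s + w *m upart s = 0 &
      map_mx deriv p *m xpart s + e^`() *: ypart s
        + map_mx deriv w *m upart s = 0].
Proof.
rewrite Tmx_mul; split=> [/eqP|[-> -> ->]]; last by rewrite !col_mx0.
by rewrite !col_mx_eq0 => /and3P[/eqP-> /eqP-> /eqP->].
Qed.

Definition wt d k (i : 'I_(S + (1 + M))) : nat :=
  match split i with
  | inl _ => d
  | inr j => match split j with inl _ => k | inr _ => d - k end
  end.

Lemma wt_l d k i : wt d k (lshift _ i) = d.
Proof. by rewrite /wt (unsplitK (inl i)). Qed.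
Lemma wt_rl d k i : wt d k (rshift _ (lshift _ i)) = k.
Proof. by rewrite /wt (unsplitK (inr _)) (unsplitK (inl i)). Qed.
Lemma wt_rr d k i : wt d k (rshift _ (rshift _ i)) = (d - k)%N.
Proof. by rewrite /wt (unsplitK (inr _)) (unsplitK (inr i)). Qed.

Lemma wt_le d k i : (k <= d)%N -> (wt d k i <= d)%N.
Proof.
move=> h; rewrite /wt; case: (split i) => // j; case: (split j) => // _.
exact: leq_subr.
Qed.
End Conormal.

Definition polyrow (K : fieldType) n m (C : 'M[K]_(n, m)) : 'rV[{poly K}]_n :=
  \row_i rVpoly (row i C).

Lemma size_deriv_le (R : nzRingType) (p : {poly R}) m :
  (size p <= m.+1)%N -> (size p^`() <= m)%N.
Proof.
move=> hp; apply/leq_sizeP => j hj; rewrite coef_deriv nth_default ?mul0rn //.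
exact: leq_trans hp _.
Qed.

Section Eval.
Variable K : closedFieldType.
Notation F := (ratfun K).
Notation t := (tvar K).
Notation io := (@io K).
Notation mu := (@mu K).
Variables n m : nat.
Implicit Types C : 'M[K]_(n, m.+1).

Lemma size_polyrow C i : (size (polyrow C ord0 i) <= m.+1)%N.
Proof. by rewrite mxE size_poly. Qed.

Lemma coef_polyrow C i (j : 'I_m.+1) : (polyrow C 0 i)`_j = C i j.
Proof. by rewrite mxE coef_rVpoly_ord mxE. Qed.

Lemma ev_gen C : ev (@cst K) C 1 t = map_mx (@tofrac _) (polyrow C).
Proof.
apply/rowP => i; rewrite !mxE -io_U0 (io_sum _ (size_poly _ _)).
by apply: eq_bigr => j _; rewrite expr1n mulr1 coef_rVpoly_ord mxE.
Qed.

Lemma evT_gen C : evT (@cst K) C 1 t = map_mx (@tofrac _ \o deriv) (polyrow C).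
Proof.
apply/rowP => i; rewrite !mxE /= -io_U0 (@io_sum _ _ m.+1); last first.
  by apply: leqW; apply: size_deriv_le; apply: size_poly.
rewrite big_ord_recl [RHS]big_ord_recr /= mulr0n mulr0 add0r.
rewrite coef_deriv nth_default ?size_poly // mul0rn /cst rmorph0 mul0r addr0.
apply: eq_bigr => j _; rewrite expr1n mulr1 coef_deriv /bump /=.
have -> := @coef_rVpoly_ord _ _ (row i C) (lift ord0 j).
by rewrite mxE /cst rmorphMn rmorphMn mulrnAr mulrnAl.
Qed.

Lemma evS_gen C : evS (@cst K) C 1 t =
  \row_i (tofrac (polyrow C 0 i) *+ m - t * tofrac (polyrow C 0 i)^`()).
Proof.
apply/rowP => i; rewrite !mxE.
have -> : tofrac (rVpoly (row i C)) = ev (@cst K) C 1 t 0 i.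
  by rewrite ev_gen !mxE.
have -> : tofrac (rVpoly (row i C))^`() = evT (@cst K) C 1 t 0 i.
  by rewrite evT_gen !mxE.
rewrite !mxE -sumrMnl mulr_sumr -sumrB; apply: eq_bigr => j _.
rewrite !expr1n !mulr1.
have -> : t * (cst (C i j) * (t ^+ j.-1 *+ j)) = cst (C i j) * t ^+ j *+ j.
  by case: (j : nat) => [|l]; rewrite ?mulr0n ?mulr0 //= exprS -!mulrnAr; ring.
by rewrite mulr_natr mulrnAl mulrnBr // -ltnS.
Qed.

Definition chpt (c : chart) (b : K) : K * K :=
  match c with U_0 => (1, b) | U_oo => (b, 1) end.

Lemma ev_pt C c b : ev id C (chpt c b).1 (chpt c b).2 =
  map_mx (fun p => (ch c m p).[b]) (polyrow C).
Proof.
apply/rowP => i; rewrite !mxE; case: c => /=.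
  rewrite (horner_coef_wide _ (size_poly _ _)); apply: eq_bigr => j _.
  by rewrite expr1n mulr1 coef_rVpoly_ord mxE.
rewrite horner_poly (reindex_inj rev_ord_inj) /=; apply: eq_bigr => j _.
rewrite subSS subKn -1?ltnS // expr1n mulr1.
by have -> := @coef_rVpoly_ord _ _ (row i C) (rev_ord j); rewrite mxE.
Qed.

Lemma evD_pt C c b :
  (match c with U_0 => evT id C 1 b | U_oo => evS id C b 1 end) =
  map_mx (fun p => (ch c m p)^`().[b]) (polyrow C).
Proof.
apply/rowP => i; case: c; rewrite !mxE /=.
  rewrite (@horner_coef_wide _ m.+1); last first.
    by apply: leqW; apply: size_deriv_le; apply: size_poly.
  rewrite big_ord_recl [RHS]big_ord_recr /= mulr0n mulr0 add0r.
  rewrite coef_deriv nth_default ?size_poly // mul0rn mul0r addr0.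
  apply: eq_bigr => j _; rewrite expr1n mulr1 coef_deriv /bump /=.
  have -> := @coef_rVpoly_ord _ _ (row i C) (lift ord0 j).
  by rewrite mxE mulrnAr mulrnAl.
rewrite (@horner_coef_wide _ m.+1); last first.
  by apply: leqW; apply: size_deriv_le; apply: size_poly.
rewrite big_ord_recr [RHS]big_ord_recr /= subnn mulr0n mulr0 mul0r addr0.
rewrite coef_deriv coef_rev_poly ltnn mul0rn mul0r addr0.
rewrite (reindex_inj rev_ord_inj) /=; apply: eq_bigr => j _.
rewrite expr1n mulr1 coef_deriv coef_rev_poly ltn_ord subKn ?ltn_ord //.
have -> : (m - j.+1)%N = widen_ord (leqnSn m) (rev_ord j) by [].
by rewrite coef_rVpoly_ord mxE /= mulrnAr mulrnAl.
Qed.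
End Eval.

Lemma vfield_alg2 (F : fieldType) n (t T A a b B : F) :
  t != 0 -> A = T * a -> t * B = T * (a *+ n - t^-1 * b) ->
  T * b = t * (A *+ n) - t ^+ 2 * B.
Proof.
move=> t0 -> h.
have -> : t ^+ 2 * B = t * (t * B) by ring.
by rewrite h -mulrnAr; field.
Qed.

Lemma vfield_alg3 (F : fieldType) (t A B C D : F) d k :
  2%:R = 0 :> F -> (k <= d)%N -> B + C + D = 0 ->
  t * (- A *+ d) - t ^+ 2 * B + (t * (A *+ k) - t ^+ 2 * C)
    + (t * (- A *+ (d - k)) - t ^+ 2 * D) = 0.
Proof.
move=> c2 hkd h.
have -> : t * (- A *+ d) - t ^+ 2 * B + (t * (A *+ k) - t ^+ 2 * C)
    + (t * (- A *+ (d - k)) - t ^+ 2 * D) =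
  - t ^+ 2 * (B + C + D) - t * A * (d%:R - k%:R + (d - k)%N%:R) by ring.
rewrite h natrB // mulr0 sub0r -mulr2n -[_ *+ 2]mulr_natr c2; ring.
Qed.

Lemma mxaddE (V : nmodType) n m (A B : 'M[V]_(n, m)) i j :
  (A + B) i j = A i j + B i j.
Proof. exact: mxE. Qed.

Section ChartSections.
Variable K : closedFieldType.
Notation F := (ratfun K).
Notation t := (tvar K).
Notation io := (@io K).
Notation mu := (@mu K).

Lemma deriv_oo n (p : {poly K}) : (size p <= n.+1)%N ->
  t ^+ n * io U_oo (rev_poly n p)^`() =
  t * (tofrac p *+ n) - t ^+ 2 * tofrac p^`().
Proof.
move=> hp; apply: (vfield_alg2 (tvar_neq0 K) (chK U_oo hp)).
rewrite -tofracM (deriv_rev hp) (chK U_oo (size_rev_poly _ _)).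
rewrite /ch rev_polyK.
  by rewrite rmorphB rmorphM ioX rmorphMn.
apply/leq_sizeP => j hj.
rewrite coefB coefMn coefXM coef_deriv !coef_rev_poly leqNgt hj mul0rn.
by case: j hj => [|j] hj; rewrite //= leqNgt hj mul0rn subrr.
Qed.

Variables (R : nat) (a : 'I_R -> nat).

Definition chrow c n m (v : 'rV[{poly K}]_m) := map_mx (ch c n) v.
Definition chmx c n m (X : 'M[{poly K}]_(m, R)) :=
  \matrix_(i, j) ch c (a j - n) (X i j).

Section One.
Variables (n m : nat) (v : 'rV[{poly K}]_m) (X : 'M[{poly K}]_(m, R)).
Hypothesis hn : forall j, (n <= a j)%N.
Hypothesis hv : forall i, (size (v 0%R i) <= n.+1)%N.
Hypothesis hX : forall i j, (size (X i j) <= (a j - n).+1)%N.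

Lemma chmul c j : (chrow c n v *m chmx c n X) 0 j = ch c (a j) ((v *m X) 0 j).
Proof.
rewrite !mxE ch_sum; apply: eq_bigr => i _; rewrite !mxE.
by rewrite -{2}(subnKC (hn j)) chM.
Qed.

Lemma dchmul j :
  t ^+ (a j) * io U_oo ((map_mx deriv (chrow U_oo n v) *m chmx U_oo n X) 0 j) =
  t * (tofrac ((v *m X) 0 j) *+ n) - t ^+ 2 * tofrac ((map_mx deriv v *m X) 0 j).
Proof.
rewrite !mxE !rmorph_sum !mulr_sumr -sumrMnl mulr_sumr -sumrB.
apply: eq_bigr => i _; rewrite !mxE !rmorphM.
rewrite -{1}(subnKC (hn j)) exprD mulrACA deriv_oo // -(chK U_oo (hX i j)).
by rewrite mulrBl -!mulrA -mulrnAl.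
Qed.
End One.

Variables (S M d k : nat) (hkd : (k <= d)%N).
Hypothesis charK : 2%N \in [pchar K].
Hypothesis ha : forall j, (d <= a j)%N.
Variables (p : 'rV[{poly K}]_S) (e : {poly K}) (w : 'rV[{poly K}]_M).
Hypothesis hp : forall i, (size (p 0%R i) <= d.+1)%N.
Hypothesis he : (size e <= k.+1)%N.
Hypothesis hw : forall i, (size (w 0%R i) <= (d - k).+1)%N.
Variable s : 'M[{poly K}]_(S + (1 + M), R).
Hypothesis hs : forall i j, (size (s i j) <= (a j - wt d k i).+1)%N.
Hypothesis Ts : Tmx p e w *m s = 0.

Definition chS c := \matrix_(i, j) ch c (a j - wt d k i) (s i j).

Let hak j : (k <= a j)%N. Proof. exact: leq_trans (ha j). Qed.
Let hadk j : (d - k <= a j)%N. Proof. exact: leq_trans (leq_subr _ _) (ha j). Qed.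

Lemma xpart_chS c : xpart (chS c) = chmx c d (xpart s).
Proof. by apply/matrixP => i j; rewrite !mxE wt_l. Qed.
Lemma ypart_chS c : ypart (chS c) = chmx c k (ypart s).
Proof. by apply/matrixP => i j; rewrite !mxE wt_rl. Qed.
Lemma upart_chS c : upart (chS c) = chmx c (d - k) (upart s).
Proof. by apply/matrixP => i j; rewrite !mxE wt_rr. Qed.

Let hsx i j : (size (xpart s i j) <= (a j - d).+1)%N.
Proof. by have := hs (lshift _ i) j; rewrite wt_l mxE. Qed.
Let hsy i j : (size (ypart s i j) <= (a j - k).+1)%N.
Proof. by have := hs (rshift _ (lshift _ i)) j; rewrite wt_rl !mxE. Qed.
Let hsu i j : (size (upart s i j) <= (a j - (d - k)).+1)%N.
Proof. by have := hs (rshift _ (rshift _ i)) j; rewrite wt_rr !mxE. Qed.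
Let he1 i : (size ((e%:M : 'rV_1) 0%R i) <= k.+1)%N.
Proof. by rewrite mxE (ord1 i) eqxx mulr1n. Qed.

Let chrow_scalar c n (q : {poly K}) : chrow c n (q%:M : 'rV_1) = (ch c n q)%:M.
Proof. by apply/matrixP => i j; rewrite !mxE !ord1 eqxx !mulr1n. Qed.
Let deriv_scalar (q : {poly K}) : map_mx deriv (q%:M : 'rV_1) = q^`()%:M.
Proof. by apply/matrixP => i j; rewrite !mxE !ord1 eqxx !mulr1n. Qed.

Lemma Tmx_chS c :
  Tmx (chrow c d p) (ch c k e) (chrow c (d - k) w) *m chS c = 0.
Proof.
have /Tmx0P[T1 T2 T3] := Ts.
have {}T1 j : (p *m xpart s) 0 j + (e%:M *m ypart s) 0 j = 0.
  by rewrite mul_scalar_mx; move/rowP: T1 => /(_ j); rewrite !mxE.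
have {}T2 j : (e%:M *m ypart s) 0 j + (w *m upart s) 0 j = 0.
  by rewrite mul_scalar_mx; move/rowP: T2 => /(_ j); rewrite !mxE.
have {}T3 j : (map_mx deriv p *m xpart s) 0 j
   + (map_mx deriv (e%:M : 'rV_1) *m ypart s) 0 j
   + (map_mx deriv w *m upart s) 0 j = 0.
  by rewrite deriv_scalar mul_scalar_mx; move/rowP: T3 => /(_ j); rewrite !mxE.
apply/Tmx0P; rewrite xpart_chS ypart_chS upart_chS -!mul_scalar_mx.
rewrite -deriv_scalar -chrow_scalar.
split; apply/rowP => j; rewrite !mxaddE [RHS]mxE.
- by rewrite !chmul // -chD T1 ch0.
- by rewrite !chmul // -chD T2 ch0.
case: c; last first.
  apply: (@io_inj _ U_oo); apply: (mulfI (expf_neq0 (a j) (tvar_neq0 K))).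
  rewrite rmorph0 mulr0 !rmorphD !mulrDr !dchmul //.
  have c2 : 2%:R = 0 :> F by rewrite -(rmorph_nat (io U_oo)) -polyC_natr
     (pcharf0 charK) rmorph0.
  have e1 : tofrac ((p *m xpart s) 0 j) = - tofrac ((e%:M *m ypart s) 0 j) :> F.
    by apply/eqP; rewrite -addr_eq0 -rmorphD T1 rmorph0.
  have e2 : tofrac ((w *m upart s) 0 j) = - tofrac ((e%:M *m ypart s) 0 j) :> F.
    by apply/eqP; rewrite -addr_eq0 addrC -rmorphD T2 rmorph0.
  have e3 : tofrac ((map_mx deriv p *m xpart s) 0 j)
     + tofrac ((map_mx deriv (e%:M : 'rV_1) *m ypart s) 0 j)
     + tofrac ((map_mx deriv w *m upart s) 0 j) = 0 :> F.
    by rewrite -!rmorphD T3 rmorph0.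
  rewrite e1 e2.
  exact: vfield_alg3.
rewrite -[RHS](T3 j) /chrow; congr (_ + _ + _); rewrite !mxE;
  apply: eq_bigr => i _; by rewrite !mxE.
Qed.
End ChartSections.

Lemma mxscaleE (V : pzRingType) n m (c : V) (A : 'M[V]_(n, m)) i j :
  (c *: A) i j = c * A i j.
Proof. exact: mxE. Qed.

Lemma map_mxE' (A B : Type) n m (g : A -> B) (X : 'M[A]_(n, m)) i j :
  map_mx g X i j = g (X i j).
Proof. exact: mxE. Qed.

Lemma mulmxE' (A : pzRingType) n m l (X : 'M[A]_(n, m)) (Y : 'M_(m, l)) i j :
  (X *m Y) i j = \sum_h X i h * Y h j.
Proof. exact: mxE. Qed.

Lemma chmxE (K : closedFieldType) R (a : 'I_R -> nat) c n m
    (X : 'M[{poly K}]_(m, R)) i j :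
  chmx a c n X i j = ch c (a j - n) (X i j).
Proof. exact: mxE. Qed.

Lemma scale_cancel (F : comNzRingType) (V : lmodType F) (A B U Z : V) (x y : F) :
  A + (B + x *: (y *: Z)) + (y *: U - y *: (x *: Z)) = A + B + y *: U.
Proof.
rewrite !scalerA [y * x]mulrC; move: (_ *: Z) (_ *: U) => z u.
by rewrite !addrA [X in X - z]addrAC addrK.
Qed.

Lemma unramifiedE (K : fieldType) r s d k (f : map_X K r s d k) :
  unramified f -> forall a b, (a, b) <> (0, 0) -> forall u v g h,
    u *: evS id (map_coefs f).1 a b + v *: evT id (map_coefs f).1 a b
      = g *: ev id (map_coefs f).1 a b ->
    u *: evS id (map_coefs f).2 a b + v *: evT id (map_coefs f).2 a b
      = h *: ev id (map_coefs f).2 a b -> u * b = v * a.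
Proof.
rewrite /unramified; case: (map_coefs f) => Z W H a b hab u v g h.
exact: H.
Qed.

Section IsoSplit.
Variable K : closedFieldType.
Hypothesis charK : 2%N \in [pchar K].
Notation F := (ratfun K).
Notation t := (tvar K).
Notation io := (@io K).
Notation mu := (@mu K).
Notation "M .@ b" := (map_mx (horner_eval b) M) (at level 2, format "M .@ b").

Variables (r s d k : nat) (f : map_X K r s d k).
Hypothesis hkd : (k <= d)%N.
Notation M := (r - s)%N.
Notation S := s.+1.
Variables (p : 'rV[{poly K}]_S) (e : {poly K}) (w : 'rV[{poly K}]_M).
Hypothesis hp : forall i, (size (p 0%R i) <= d.+1)%N.
Hypothesis he : (size e <= k.+1)%N.
Hypothesis hw : forall i, (size (w 0%R i) <= (d - k).+1)%N.
Hypothesis hfz : polyrow (map_coefs f).1 = row_mx p (e *: w).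
Hypothesis hfw : polyrow (map_coefs f).2 = w.

Let pc c := chrow c d p.
Let ec c := ch c k e.
Let wc c := chrow c (d - k) w.

Lemma chpt_neq0 c (b : K) : ((chpt c b).1, (chpt c b).2) <> (0, 0).
Proof. by case: c => /= -[] => [/eqP|_ /eqP]; rewrite oner_eq0. Qed.

Lemma ch_ew c i : ch c d (e * w 0 i) = ec c * wc c 0 i.
Proof. by rewrite mxE -chM // subnKC. Qed.

Lemma ev_z c b : ev id (map_coefs f).1 (chpt c b).1 (chpt c b).2 =
  row_mx (pc c).@b ((ec c).[b] *: (wc c).@b).
Proof.
rewrite ev_pt hfz; apply/rowP => i; rewrite -(splitK i).
case: (split i) => j /=; rewrite mxE ?row_mxEl ?row_mxEr ?mxE //.
by rewrite ch_ew hornerM [wc _ _ _]mxE.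
Qed.

Lemma ev_w c b : ev id (map_coefs f).2 (chpt c b).1 (chpt c b).2 = (wc c).@b.
Proof. by rewrite ev_pt hfw; apply/rowP => i; rewrite !mxE. Qed.

Let wc_neq0 c b : (wc c).@b != 0.
Proof. by have [_ h _] := map_coefsP f (@chpt_neq0 c b); rewrite -ev_w. Qed.

Let z_neq0 c b : row_mx (pc c).@b ((ec c).[b] *: (wc c).@b) != 0.
Proof. by have [h _ _] := map_coefsP f (@chpt_neq0 c b); rewrite -ev_z. Qed.

Let c2 : 2%:R = 0 :> K := pcharf0 charK.

(** A dependence between the rows at a point is a tangent vector of the line that
    the differential sends to a multiple of the Euler fields. *)
Lemma T_row_free : unramified f ->
  forall c b, row_free (Tmx (pc c) (ec c) (wc c)).@b.
Proof.
move=> hur c b; rewrite -kermx_eq0; apply/rowV0P => x /sub_kermxP.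
rewrite -[x]hsubmxK; move: (lsubmx x) (rsubmx x) => x1 x23 {x}.
rewrite -[x23]hsubmxK; move: (lsubmx x23) (rsubmx x23) => x2 x3 {x23}.
rewrite /Tmx !map_col_mx !mul_row_col !map_row_mx !map_scalar_mx !map_mx0.
rewrite !mul_mx_row !mulmx0 !add_row_mx => /eqP.
rewrite [x1]mx11_scalar [x2]mx11_scalar [x3]mx11_scalar.
move: (x1 0 0) (x2 0 0) (x3 0 0) => {}x1 {}x2 {}x3.
rewrite !mul_scalar_mx add0r !row_mx_eq0 => /and3P[/eqP e1 /eqP e2 /eqP e3].
rewrite add0r in e3.
have {}e2 : (x1 + x2) * (ec c).[b] + x3 * (ec c)^`().[b] = 0.
  by move/rowP: e2 => /(_ 0); rewrite !mxE /= !mulr1n /horner_eval => <-; ring.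
have x30 : x3 = 0.
  have := unramifiedE hur (@chpt_neq0 c b).
  pose u := if c is U_0 then 0 else x3; pose v := if c is U_0 then x3 else 0.
  have evE m n (C : 'M[K]_(n, m.+1)) : u *: evS id C (chpt c b).1 (chpt c b).2 +
      v *: evT id C (chpt c b).1 (chpt c b).2 =
      x3 *: map_mx (fun p => (ch c m p)^`().[b]) (polyrow C).
    rewrite -evD_pt /u /v; case: (c); first by rewrite scale0r add0r.
    by rewrite scale0r addr0.
  move=> /(_ u v (- x1) (- x2)); rewrite !evE ev_z ev_w.
  suff h1 : x3 *: map_mx (fun p => (ch c d p)^`().[b]) (polyrow (map_coefs f).1)
      = - x1 *: row_mx (pc c).@b ((ec c).[b] *: (wc c).@b).
    suff h2 : x3 *: map_mx (fun p => (ch c (d - k) p)^`().[b])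
        (polyrow (map_coefs f).2) = - x2 *: (wc c).@b.
      move=> /(_ h1 h2); rewrite /u /v.
      by case: (c) => /=; rewrite !mulr1 mul0r.
    rewrite hfw; apply/rowP => i; move/rowP: e3 => /(_ i).
    by rewrite !mxE /horner_eval => /eqP; rewrite addrC addr_eq0 mulNr => /eqP.
  rewrite hfz; apply/rowP => i; rewrite -(splitK i); case: (split i) => j /=.
    rewrite mxE mxE row_mxEl [RHS]mxE row_mxEl; move/rowP: e1 => /(_ j).
    by rewrite !mxE /horner_eval => /eqP; rewrite addrC addr_eq0 mulNr => /eqP.
  rewrite mxE mxE row_mxEr [RHS]mxE row_mxEr; move/rowP: e3 => /(_ j).
  rewrite !mxE /= /horner_eval ch_ew [wc _ _ _]mxE derivM hornerD !hornerM.
  move: (ec c).[b] (ec c)^`().[b] e2 (ch _ _ _).[b] (ch _ _ _)^`().[b].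
  move=> E E' h W W' h'.
  have -> : x3 * (E' * W + E * W') =
    W * ((x1 + x2) * E + x3 * E') + E * (x2 * W + x3 * W')
     - (x1 * E * W + x2 * (E * W) * 2%:R) by ring.
  by rewrite h h' c2; ring.
rewrite x30 !scale0r !addr0 in e1 e3 *.
have x20 : x2 = 0.
  by apply/eqP; move/eqP: e3; rewrite scaler_eq0 (negbTE (wc_neq0 c b)) orbF.
rewrite x30 x20 mul0r !addr0 in e2 *.
have x10 : x1 = 0.
  apply/eqP; have := z_neq0 c b; apply: contraNT => x1n.
  rewrite row_mx_eq0; apply/andP; split.
    by move/eqP: e1; rewrite scaler_eq0 (negbTE x1n).
  by move/eqP: e2; rewrite mulf_eq0 (negbTE x1n) /= => /eqP->; rewrite scale0r.
by rewrite x10 !raddf0 !row_mx0.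
Qed.

Hypothesis hsr : (s <= r)%N.
Hypothesis hur : unramified f.
Variable a : seq nat.
Hypothesis hsize : (3 + size (map Posz a) = S + (1 + M))%N.
Notation R := (size (map Posz a)).
Notation aj := (nth 0%N a).
Hypothesis ha : forall j : 'I_R, (d <= aj j)%N.
Variable s0 : 'M[{poly K}]_(S + (1 + M), R).
Hypothesis hs : forall i j, (size (s0 i j) <= (aj j - wt d k i).+1)%N.
Hypothesis Ts : Tmx p e w *m s0 = 0.
Hypothesis full_aff : forall b, row_free (s0.@b)^T.
Hypothesis full_inf :
  row_free (\matrix_(i, j) (s0 i j)`_(aj j - wt d k i))^T.

Let sc c := chS (fun j : 'I_R => aj j) d k s0 c.

Lemma S_row_free c b : row_free ((sc c).@b)^T.
Proof.
case: c; first by rewrite (_ : sc U_0 = s0) //; apply/matrixP => i j; rewrite mxE.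
have [->|b0] := eqVneq b 0.
  rewrite (_ : (sc U_oo).@0 = \matrix_(i, j) (s0 i j)`_(aj j - wt d k i)) //.
  by apply/matrixP => i j; rewrite !mxE /horner_eval horner_rev0.
rewrite -kermx_eq0; apply/rowV0P => x /sub_kermxP hx.
pose y : 'rV[K]_R := \row_j (x 0 j * b ^+ aj j).
have hy : y *m (s0.@(b^-1))^T = 0.
  apply/rowP => i; move/rowP: hx => /(_ i); rewrite !mxE => hx.
  apply: (mulfI (expf_neq0 (wt d k i) (invr_neq0 b0))).
  rewrite mulr0 -[RHS]hx mulr_sumr; apply: eq_bigr => j _; rewrite !mxE.
  rewrite /horner_eval horner_rev //.
  have hw' : (wt d k i <= aj j)%N by apply: leq_trans (ha j); apply: wt_le.
  rewrite -{1}(subnKC hw') exprD.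
  transitivity ((b^-1 * b) ^+ wt d k i *
     (x 0 j * (b ^+ (aj j - wt d k i) * (s0 i j).[b^-1]))).
    by rewrite exprMn; ring.
  by rewrite mulVf // expr1n mul1r.
have : y == 0 by rewrite -(mulmx_free_eq0 _ (full_aff b^-1)) hy.
move/eqP/rowP => h; apply/rowP => j; move: (h j); rewrite !mxE => /eqP.
by rewrite mulf_eq0 expf_eq0 (negbTE b0) andbF orbF => /eqP.
Qed.

Let dim := (S + M + M)%N.

(** The deformation with Cox coordinates rho. *)
Definition emb c (rho : 'rV[{poly K}]_(S + (1 + M))) : 'rV[F]_dim :=
  row_mx (row_mx (mu c d *: map_mx (io c) (lsubmx rho))
     (mu c d *: map_mx (io c) (lsubmx (rsubmx rho) 0 0 *: wc c
                                 + ec c *: rsubmx (rsubmx rho))))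
    (mu c (d - k) *: map_mx (io c) (rsubmx (rsubmx rho))).

Let z_gen c : ev (@cst K) (map_coefs f).1 1 t =
  mu c d *: map_mx (io c) (row_mx (pc c) (ec c *: wc c)).
Proof.
rewrite ev_gen hfz; apply/rowP => i; rewrite -(splitK i).
case: (split i) => j /=; rewrite [LHS]mxE [RHS]mxE [in RHS]mxE ?row_mxEl ?row_mxEr.
  by rewrite [in RHS]mxE (chK c (hp j)).
rewrite mxE [in RHS]mxE -ch_ew -chK //.
by rewrite -(subnKC hkd); apply: size_mul_bound.
Qed.

Let w_gen c : ev (@cst K) (map_coefs f).2 1 t =
  mu c (d - k) *: map_mx (io c) (wc c).
Proof. by rewrite ev_gen hfw; apply/rowP => i; rewrite !mxE (chK c (hw i)). Qed.

Lemma emb_l c rho i : lsubmx (emb c rho) 0 (lshift _ i) =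
  mu c d * io c (rho 0 (lshift _ i)).
Proof. by rewrite /emb row_mxKl row_mxEl !mxE. Qed.

Lemma emb_r c rho i : lsubmx (emb c rho) 0 (rshift _ i) =
  mu c d * io c (lsubmx (rsubmx rho) 0 0 * wc c 0 i
                 + ec c * rsubmx (rsubmx rho) 0 i).
Proof. by rewrite /emb row_mxKl row_mxEr 2!mxE !mxaddE !mxscaleE. Qed.

Lemma emb_w c rho i : rsubmx (emb c rho) 0 i =
  mu c (d - k) * io c (rsubmx (rsubmx rho) 0 i).
Proof. by rewrite /emb row_mxKr 2!mxE. Qed.

(** Since w has no zero, the linearised equations force the last coordinates of a
    deformation of z to be of the form y w + e u. *)
Lemma num_emb c (v : 'rV[F]_dim) : @num K (normal_bundle f) c v <-> exists rho, v = emb c rho.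
Proof.
have zr i : rsubmx (ev (@cst K) (map_coefs f).1 1 t) 0 i =
    mu c d * io c (ec c * wc c 0 i).
  by rewrite (z_gen c) mxE 2!mxE row_mxEr [in LHS]mxE.
have wronskian i : ev (@cst K) (map_coefs f).2 1 t 0 i = mu c (d - k) * io c (wc c 0 i).
  by rewrite (w_gen c) 2!mxE.
have mm : mu c d * mu c (d - k) != 0 by rewrite mulf_neq0 // mu_neq0.
split=> [[hz hw' hlin]|[rho ->]]; last first.
  split=> [i|i|i j].
  - rewrite -(splitK i); case: (split i) => j /=; rewrite ?emb_l ?emb_r;
      by apply/twistP; eexists.
  - by rewrite emb_w; apply/twistP; eexists.
  - rewrite !wronskian !zr ![rsubmx (lsubmx _) _ _]mxE !emb_r !emb_w !rmorphD !rmorphM.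
    ring.
have [Q hQ] : exists Q : 'I_(S + M) -> {poly K},
    forall i, lsubmx v 0 i = mu c d * io c (Q i).
  by apply: (fin_all_exists (P := fun i q => lsubmx v 0 i = mu c d * io c q));
    move=> i; apply/twistP; apply: hz.
have [W hW] : exists W : 'I_M -> {poly K},
    forall i, rsubmx v 0 i = mu c (d - k) * io c (W i).
  by apply: (fin_all_exists (P := fun i q => rsubmx v 0 i = mu c _ * io c q));
    move=> i; apply/twistP; apply: hw'.
have [u wu] : exists u : 'cV_M, wc c *m u = 1%:M.
  by apply: row_unimod => b; apply: wc_neq0.
pose q i := Q (rshift S i) - ec c * W i.
have hq i j : q i * wc c 0 j = q j * wc c 0 i.
  apply: (@io_inj _ c); apply: (mulfI mm).
  have := hlin i j; rewrite !wronskian !zr ![rsubmx (lsubmx _) _ _]mxE !hQ !hW.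
  rewrite /q !rmorphM !rmorphB !rmorphM => h.
  move: h; move: (mu c d) (mu c (d - k)) (io _ _) (io _ _) (io _ _) (io _ _)
    (io _ _) (io _ _) (io _ _) => A B x1 x2 x3 x4 x5 x6 x7 h.
  apply/eqP; rewrite -subr_eq0; move/eqP: h; rewrite -subr_eq0 => /eqP h.
  by apply/eqP; rewrite -[RHS]h; ring.
pose e1 := \sum_j q j * u j 0.
have he1 i : Q (rshift S i) = e1 * wc c 0 i + ec c * W i.
  apply/eqP; rewrite -subr_eq; apply/eqP.
  have h1 : \sum_j wc c 0 j * u j 0 = 1.
    by move/matrixP: wu => /(_ 0 0); rewrite [LHS]mxE [RHS]mxE mulr1n.
  rewrite -/(q i) -[LHS]mulr1 -h1 mulr_sumr mulr_suml; apply: eq_bigr => j _.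
  by rewrite mulrA hq mulrAC.
pose rho : 'rV_(S + (1 + M)) :=
  row_mx (\row_i Q (lshift M i)) (row_mx e1%:M (\row_i W i)).
exists rho; apply/rowP => i; rewrite -(splitK i); case: (split i) => j /=.
  have -> : v 0 (lshift M j) = lsubmx v 0 j by rewrite mxE.
  have -> : emb c rho 0 (lshift M j) = lsubmx (emb c rho) 0 j by rewrite [RHS]mxE.
  rewrite hQ -(splitK j); case: (split j) => l /=.
    by rewrite emb_l row_mxEl mxE.
  rewrite emb_r he1 /rho row_mxKr row_mxKl row_mxKr.
  by rewrite [_%:M _ _]mxE mulr1n [in RHS]mxE.
have -> : v 0 (rshift (S + M) j) = rsubmx v 0 j by rewrite mxE.
have -> : emb c rho 0 (rshift (S + M) j) = rsubmx (emb c rho) 0 j by rewrite [RHS]mxE.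
by rewrite hW emb_w !row_mxKr mxE.
Qed.

Lemma emb_T c x1 x2 x3 (rho := row_mx x1%:M (row_mx x2%:M x3%:M)
    *m Tmx (pc c) (ec c) (wc c)) :
  emb c rho = row_mx
    (row_mx (\row_i (mu c d * io c (x1 * ch c d (p 0 i)
                                    + x3 * (ch c d (p 0 i))^`())))
       (\row_i (mu c d * io c (x1 * ch c d (e * w 0 i)
                               + x3 * (ch c d (e * w 0 i))^`()))))
    (\row_i (mu c (d - k) * io c (x2 * ch c (d - k) (w 0 i)
                               + x3 * (ch c (d - k) (w 0 i))^`()))).
Proof.
have erho : rho = row_mx (x1 *: pc c + x3 *: map_mx deriv (pc c))
    (row_mx ((x1 + x2) * ec c + x3 * (ec c)^`())%:M
       (x2 *: wc c + x3 *: map_mx deriv (wc c))).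
  rewrite /rho /Tmx !mul_row_col !mul_mx_row !mulmx0 !add_row_mx !mul_scalar_mx.
  rewrite !add0r; congr (row_mx _ (row_mx _ _)).
  by apply/matrixP => i j; rewrite !mxE !ord1 eqxx !mulr1n; ring.
have c2' : 2%:R = 0 :> {poly K} by rewrite -polyC_natr c2.
rewrite /emb erho !row_mxKl !row_mxKr !row_mxKl; congr (row_mx (row_mx _ _) _);
  apply/rowP => i; rewrite !mxE //.
congr (_ * io c _); rewrite ch_ew derivM [wc _ _ _]mxE mulr1n.
move: (ec c) (ch c _ (w 0 i)) => E W.
rewrite -[RHS]addr0 -(mulr0 (x2 * E * W)) -c2'; ring.
Qed.

(** The two Euler fields and the differential are the rows of Tmx. *)
Lemma den_emb c (v : 'rV[F]_dim) : @den K (normal_bundle f) c v <->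
  exists x : 'rV_(1 + (1 + 1)), v = emb c (x *m Tmx (pc c) (ec c) (wc c)).
Proof.
have hew i : (size (e * w 0%R i)%R <= d.+1)%N.
  by rewrite -(subnKC hkd); apply: size_mul_bound.
have zE : ev (@cst K) (map_coefs f).1 1 t =
    row_mx (\row_i tofrac (p 0 i)) (\row_i tofrac (e * w 0 i)).
  rewrite ev_gen hfz map_row_mx; congr row_mx; apply/rowP => i; rewrite !mxE //.
have wE : ev (@cst K) (map_coefs f).2 1 t = \row_i tofrac (w 0 i).
  by rewrite ev_gen hfw; apply/rowP => i; rewrite !mxE.
have zTE : evT (@cst K) (map_coefs f).1 1 t =
    row_mx (\row_i tofrac (p 0 i)^`()) (\row_i tofrac (e * w 0 i)^`()).
  rewrite evT_gen hfz map_row_mx; congr row_mx; apply/rowP => i; rewrite !mxE //.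
have wTE : evT (@cst K) (map_coefs f).2 1 t = \row_i tofrac (w 0 i)^`().
  by rewrite evT_gen hfw; apply/rowP => i; rewrite !mxE.
have zSE : evS (@cst K) (map_coefs f).1 1 t = row_mx
   (\row_i (tofrac (p 0 i) *+ d - t * tofrac (p 0 i)^`()))
   (\row_i (tofrac (e * w 0 i) *+ d - t * tofrac (e * w 0 i)^`())).
  rewrite evS_gen hfz; apply/rowP => i; rewrite mxE -(splitK i).
  by case: (split i) => j /=; rewrite ?row_mxEl ?row_mxEr ?mxE.
have wSE : evS (@cst K) (map_coefs f).2 1 t =
   \row_i (tofrac (w 0 i) *+ (d - k) - t * tofrac (w 0 i)^`()).
  by rewrite evS_gen hfw; apply/rowP => i; rewrite !mxE.
split.
- move=> [v1 [v2 [[g1 [h1 [/(twistP 0)[G1 ->] /(twistP 0)[H1 ->] ->]]]]]].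
  move=> [g [h [hg hh ->]] ->].
  have [al [ga hag]] := differential_chart hg hh.
  exists (row_mx (G1 + al *+ d)%:M (row_mx (H1 + al *+ (d - k))%:M ga%:M)).
  have key n (q : {poly K}) G : (size q <= n.+1)%N ->
      io c G * tofrac q + (g * (tofrac q *+ n - t * tofrac q^`()) +
        h * tofrac q^`()) =
      mu c n * io c ((G + al *+ n) * ch c n q + ga * (ch c n q)^`()).
    move=> hq; rewrite hag // (chK c hq) !rmorphD !rmorphM rmorphD.
    by rewrite !rmorphMn; ring.
  rewrite emb_T zE wE zTE wTE zSE wSE !mu0 !mul1r.
  rewrite !scale_row_mx !add_row_mx; congr (row_mx (row_mx _ _) _);
    by apply/rowP => i; rewrite !mxE key.
- move=> [x ->]; rewrite -[x]hsubmxK -[rsubmx x]hsubmxK.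
  rewrite [lsubmx x]mx11_scalar [lsubmx (rsubmx x)]mx11_scalar.
  rewrite [rsubmx (rsubmx x)]mx11_scalar emb_T.
  move: (lsubmx x 0 0) (lsubmx (rsubmx x) 0 0) (rsubmx (rsubmx x) 0 0).
  move=> x1 x2 x3.
  have [g [h [hg hh hag]]] : exists g h : F, [/\ twist 1 c g, twist 1 c h &
     forall n (q : {poly K}), (size q <= n.+1)%N ->
     g * (tofrac q *+ n - t * tofrac q^`()) + h * tofrac q^`() =
     mu c n * io c (x3 * (ch c n q)^`())].
    case: (c).
      exists 0, (io U_0 x3); split; first by apply/(twistP 1); exists 0;
        rewrite rmorph0 mulr0.
        by apply/(twistP 1); exists x3; rewrite /mu mul1r.
      by move=> n q hq; rewrite mul0r add0r /ch /mu mul1r rmorphM !io_U0.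
    exists (t * io U_oo x3), 0; split; first by apply/(twistP 1); exists x3.
      by apply/(twistP 1); exists 0; rewrite rmorph0 mulr0.
    move=> n q hq; rewrite mul0r addr0 /mu rmorphM mulrCA deriv_oo //.
    by ring.
  exists (emb c (row_mx x1%:M (row_mx x2%:M 0%:M)
     *m Tmx (pc c) (ec c) (wc c))).
  exists (emb c (row_mx 0%:M (row_mx 0%:M x3%:M)
     *m Tmx (pc c) (ec c) (wc c))); split.
  + exists (io c x1), (io c x2); split; try by apply/(twistP 0); eexists;
      rewrite mu0 mul1r.
    rewrite emb_T zE wE !scale_row_mx; congr (row_mx (row_mx _ _) _);
    apply/rowP => i; rewrite !mxE mul0r addr0 rmorphM mulrCA -chK //.
  + exists g, h; split=> //; rewrite emb_T zSE wSE zTE wTE.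
    rewrite !scale_row_mx !add_row_mx; congr (row_mx (row_mx _ _) _);
      by apply/rowP => i; rewrite !mxE mul0r add0r hag.
  + rewrite !emb_T !add_row_mx; congr (row_mx (row_mx _ _) _);
    by apply/rowP => i; rewrite !mxE !mul0r addr0 add0r !rmorphD mulrDr.
Qed.
Lemma split_emb c (x : 'rV[F]_R) : @split_bundle K (map Posz a) c x <->
  exists y : 'rV[{poly K}]_R, x = \row_j (mu c (aj j) * io c (y 0 j)).
Proof.
have hn (i : 'I_R) : (map Posz a)`_i = Posz (aj i).
  by rewrite (nth_map 0%N) // -(size_map Posz).
split=> [h|[y ->] i]; last by rewrite hn mxE; apply/twistP; eexists.
have [y hy] : exists y : 'I_R -> {poly K},
    forall i, x 0 i = mu c (aj i) * io c (y i).
  apply: (fin_all_exists (P := fun i q => x 0 i = mu c (aj i) * io c q)) => i.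
  by apply/twistP; rewrite -hn; apply: h.
by exists (\row_i y i); apply/rowP => i; rewrite !mxE hy.
Qed.

(** The pairing with deformations identifies N with the dual of the bundle
    generated by the sections. *)
Theorem iso_split_of_sections : iso_split (normal_bundle f) (map Posz a).
Proof.
pose tf n m (A : 'M[{poly K}]_(n, m)) := map_mx (@tofrac {poly K}) A.
have [q wq] : exists q : 'cV_M, w *m q = 1%:M.
  apply: row_unimod => b; have := wc_neq0 U_0 b.
  by congr (_.@b != 0); apply/rowP => i; rewrite mxE.
pose phi : 'M[F]_(dim, R) :=
  col_mx (col_mx (tf _ _ (xpart s0)) (tf _ _ (q *m ypart s0)))
    (tf _ _ (upart s0 - e *: (q *m ypart s0))).
have phiE c rho :
    emb c rho *m phi = \row_j (mu c (aj j) * io c ((rho *m sc c) 0 j)).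
  rewrite /phi /emb !mul_row_col.
  have mud : mu c d = mu c k * mu c (d - k) by rewrite -muD subnKC.
  pose P := lsubmx rho; pose e1 := lsubmx (rsubmx rho) 0 0.
  pose W := rsubmx (rsubmx rho).
  have -> : mu c d *: map_mx (io c) (e1 *: wc c + ec c *: W) =
      (mu c k * io c e1) *: tf _ _ w
      + tofrac e *: (mu c (d - k) *: map_mx (io c) W).
    apply/rowP => i; rewrite !mxE rmorphD !rmorphM (chK c (hw i)) (chK c he).
    by rewrite mud /ec; ring.
  rewrite /tf map_mxB map_mxZ map_mxM -/(tf _ _ q).
  rewrite mulmxDl mulmxBr -!scalemxAl -scalemxAr.
  rewrite mulmxA -map_mxM wq map_mx1 mul1mx.
  rewrite scale_cancel.
  have -> : rho *m sc c = P *m chmx (fun j : 'I_R => aj j) c d (xpart s0)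
     + e1 *: chmx (fun j : 'I_R => aj j) c k (ypart s0)
     + W *m chmx (fun j : 'I_R => aj j) c (d - k) (upart s0).
    have hx := @xpart_chS K R (fun j => aj j) S M d k s0 c.
    have hy := @ypart_chS K R (fun j => aj j) S M d k s0 c.
    have hu := @upart_chS K R (fun j => aj j) S M d k s0 c.
    rewrite -hx -hy -hu -/(sc c).
    rewrite -[in LHS](vsubmxK (sc c)) -[dsubmx (sc c)]vsubmxK.
    rewrite -{1}[rho]hsubmxK -[rsubmx rho]hsubmxK !mul_row_col addrA.
    by rewrite [lsubmx (rsubmx rho)]mx11_scalar mul_scalar_mx.
  apply/rowP => j; rewrite mxE !mxaddE !rmorphD !mulrDr.
  have hak : (k <= aj j)%N by apply: leq_trans (ha j).
  have hadk : (d - k <= aj j)%N.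
    by apply: leq_trans (leq_subr _ _) (ha j).
  have hsx i : (size (xpart s0 i j) <= (aj j - d).+1)%N.
    by have := hs (lshift _ i) j; rewrite wt_l mxE.
  have hsy i : (size (ypart s0 i j) <= (aj j - k).+1)%N.
    by have := hs (rshift _ (lshift _ i)) j; rewrite wt_rl !mxE.
  have hsu i : (size (upart s0 i j) <= (aj j - (d - k)).+1)%N.
    by have := hs (rshift _ (rshift _ i)) j; rewrite wt_rr !mxE.
  have key n (x y : {poly K}) : (n <= aj j)%N -> (size y <= (aj j - n).+1)%N ->
      mu c n * io c x * tofrac y =
      mu c (aj j) * io c (x * ch c (aj j - n) y).
    move=> hn hy; rewrite (chK c hy) -{3}(subnKC hn) muD rmorphM; ring.
  congr (_ + _ + _).
  - rewrite mxscaleE !mulmxE' rmorph_sum !mulr_sumr; apply: eq_bigr => i _.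
    by rewrite !map_mxE' chmxE mulrA key.
  - by rewrite !mxscaleE map_mxE' chmxE key.
  - rewrite mxscaleE !mulmxE' rmorph_sum !mulr_sumr; apply: eq_bigr => i _.
    by rewrite !map_mxE' chmxE mulrA key.
exists phi => c.
have [ker_im onto] := split_exact hsize (T_row_free hur c) (S_row_free c)
  (Tmx_chS hkd charK ha hp he hw hs Ts c).
split.
- move=> v /num_emb[rho ->]; apply/split_emb; exists (rho *m sc c).
  exact: phiE.
- move=> x /split_emb[y ->]; have [rho hrho] := onto y.
  by exists (emb c rho); [apply/num_emb; exists rho | rewrite phiE hrho].
- move=> v hv; split=> [h|/den_emb[x ->]]; last first.
    rewrite phiE -mulmxA (Tmx_chS hkd charK ha hp he hw hs Ts c) mulmx0.
    by apply/rowP => j; rewrite !mxE rmorph0 mulr0.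
  have /num_emb[rho e1] := hv; rewrite e1 phiE in h.
  have [x hx] : exists x : 'rV_(1 + (1 + 1)), rho = x *m Tmx (pc c) (ec c) (wc c).
    apply: ker_im; apply/rowP => j; move/rowP: h => /(_ j).
    rewrite !mxE => /eqP; rewrite mulf_eq0 (negbTE (mu_neq0 _ _ _)) orFb => /eqP h.
    by apply: (@io_inj _ c); rewrite h rmorph0.
  by rewrite e1 hx; apply/den_emb; exists x.
Qed.
End IsoSplit.

(** * Open conditions on forms without common zeros *)

Lemma exists_nonroot (K : closedFieldType) (p : {poly K}) :
  p != 0 -> exists x, p.[x] != 0.
Proof. by move/closed_nonrootP. Qed.

Section NoCommonZero.
Variable K : closedFieldType.

Definition coprime_forms n1 n2 (D1 D2 : {poly K}) : Prop :=
  (forall b, D1.[b] = 0 -> D2.[b] = 0 -> False) /\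
  (D1`_n1 = 0 -> D2`_n2 = 0 -> False).

Definition nowhere_zero n m (v : 'rV[{poly K}]_m) : Prop :=
  (forall b, map_mx (horner_eval b) v != 0) /\ (map_mx (fun p : {poly K} => p`_n) v != 0).

Variables (T : Type) (P : (T -> K) -> Prop) (hP : funalg P) (t0 : T).

(** The Sylvester matrix of two forms, the second one multiplied by an auxiliary linear
    form so that degree zero is not special. *)
Lemma coprime_forms_open n1 n2 (D1 D2 : T -> {poly K}) :
  fa_poly P D1 -> fa_poly P D2 ->
  (forall t, (size (D1 t) <= n1.+1)%N) -> (forall t, (size (D2 t) <= n2.+1)%N) ->
  D1 t0 != 0 -> coprime_forms n1 n2 (D1 t0) (D2 t0) ->
  exists H : T -> K, [/\ P H, H t0 != 0 &
    forall t, H t != 0 -> coprime_forms n1 n2 (D1 t) (D2 t)].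
Proof.
move=> h1 h2 s1 s2 D10 [hco hinf].
have [th hth] := exists_nonroot D10.
pose L : {poly K} := 'X - th%:P.
pose S t : 'M[{poly K}]_(1, 1 + 1) := row_mx (D1 t)%:M (L * D2 t)%:M.
pose ll (i : 'I_(1 + 1)) := if split i is inl _ then n2.+1 else n1.
pose nn (_ : 'I_1) := (n1 + n2).+1.
have SE t q : (S t *m q) 0 0 = D1 t * q (lshift 1 0) 0 + L * D2 t * q (rshift 1 0) 0.
  rewrite -[q in LHS]vsubmxK mul_row_col !mul_scalar_mx !mxE.
  by congr (_ * q _ _ + _ * q _ _); apply: val_inj.
have lll : ll (lshift 1 0) = n2.+1 by rewrite /ll (unsplitK (inl _)).
have llr : ll (rshift 1 0) = n1 by rewrite /ll (unsplitK (inr _)).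
have hsz t q : sized ll q -> sized nn (S t *m q).
  move=> hq i; rewrite (ord1 i) SE /nn; apply: (leq_trans (size_polyD _ _)).
  have := hq (lshift 1 0); rewrite lll => hq0.
  have := hq (rshift 1 0); rewrite llr => hq1.
  rewrite geq_max (size_mul_bound (s1 t) hq0) /=.
  have [->|] := eqVneq (q (rshift 1 0) 0) 0; first by rewrite mulr0 size_poly0.
  rewrite -size_poly_gt0 => q1.
  apply: (leq_trans (size_polyMleq _ _)).
  have := leq_trans (size_polyMleq L (D2 t)) (leqnn _).
  rewrite /L size_XsubC; move: (s2 t) hq1 q1.
  by case: (size (D2 t)); case: (size _); lia.
have hfree : row_free (multiples nn ll (S t0)).
  apply/(multiples_free (hsz t0)) => q hq Sq.
  have := hq (lshift 1 0); rewrite lll => hq0.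
  have := hq (rshift 1 0); rewrite llr => hq1.
  move/matrixP: Sq => /(_ 0 0); rewrite SE mxE => /eqP; rewrite addr_eq0 => /eqP E.
  suff [e0 e1] : q (lshift 1 0) 0 = 0 /\ q (rshift 1 0) 0 = 0.
    apply/colP => i; rewrite mxE -(splitK i).
    by case: (split i) => j; rewrite (ord1 j).
  move: (q (lshift 1 0) 0) hq0 E => A sA.
  move: (q (rshift 1 0) 0) hq1 => B sB E.
  have cop : coprimep (D1 t0) (L * D2 t0).
    apply: Pdiv.ClosedField.root_coprimep => x /eqP x1.
    rewrite hornerM mulf_neq0 //; last by apply/eqP => /(hco _ x1).
    by rewrite hornerXsubC subr_eq0; apply: contra_neq hth => <-.
  have dB : D1 t0 %| B.
    by rewrite -(Gauss_dvdpr _ cop) -dvdpNr -E dvdp_mulr.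
  have [B0|B0] := eqVneq B 0.
    move: E; rewrite B0 mulr0 oppr0 => /eqP; rewrite mulf_eq0 (negbTE D10) /=.
    by move/eqP.
  have := dvdp_leq B0 dB => sD.
  have top : (D1 t0)`_n1 = 0.
    by rewrite nth_default // (leq_trans sD).
  have top2 : (D2 t0)`_n2 != 0 by apply/eqP => /(hinf top).
  have s2' : size (D2 t0) = n2.+1.
    apply/eqP; rewrite eqn_leq s2 /= ltnNge; apply: contraNN top2 => h.
    by rewrite nth_default.
  have dA : L * D2 t0 %| A.
    rewrite coprimep_sym in cop.
    by rewrite -(Gauss_dvdpr _ cop) E -mulrN dvdp_mulr.
  have D20 : D2 t0 != 0 by rewrite -size_poly_gt0 s2'.
  have [A0|A0] := eqVneq A 0.
    move: E; rewrite A0 mulr0 => /esym/eqP; rewrite oppr_eq0 !mulf_eq0.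
    by rewrite (negbTE D20) (negbTE B0) polyXsubC_eq0.
  have := leq_trans (dvdp_leq A0 dA) sA.
  by rewrite size_mul ?polyXsubC_eq0 // size_XsubC s2' ltnn.
have hS : fa_pmx P S.
  apply: (fa_pmx_row hP); apply: (fa_pmx_scalar hP) => //.
  by apply: fa_poly_mul => //; apply: fa_poly_cst.
have [H [PH H0 hH]] := row_free_persists hP (@multiples_fa _ _ _ _ _ nn ll _ hP hS) hfree.
exists H; split=> // t /hH hf.
have card : #|pidx ll| = #|pidx nn|.
  rewrite !card_pidx big_split_ord !big_ord1 /= lll llr /nn. by rewrite addSn addnC.
have hsurj (v : {poly K}) : (size v <= (n1 + n2).+1)%N ->
    exists A B : {poly K}, [/\ (size A <= n2.+1)%N, (size B <= n1)%N &
      D1 t * A + L * D2 t * B = v].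
  move=> sv; have hfull : row_full (multiples nn ll (S t)).
    by rewrite /row_full (eqP hf) card.
  have /submxP[x hx] : (pv nn (const_mx v) <= multiples nn ll (S t))%MS.
    exact: submx_full.
  exists (vp x (lshift 1 0) 0), (vp x (rshift 1 0) 0); rewrite -SE.
  split; rewrite -?lll -?llr; try exact: sized_vp.
  have hs := hsz t _ (@sized_vp _ _ ll x).
  have -> : S t *m vp x = const_mx v.
    apply: (@pv_inj _ _ nn) => //; first by move=> i; rewrite mxE.
    by rewrite (@pv_mul _ _ _ nn ll) ?vpK ?hx //; apply: sized_vp.
  by rewrite mxE.
split=> [b b1 b2|b1 b2].
  have [|A [B [_ _]]] := hsurj 1; first by rewrite size_poly1.
  move/(congr1 (fun p => p.[b])); rewrite hornerD !hornerM b1 b2 mulr0 !mul0r.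
  by rewrite hornerC addr0 => /eqP; rewrite eq_sym oner_eq0.
have drop m (p : {poly K}) : (size p <= m.+1)%N -> p`_m = 0 -> (size p <= m)%N.
  move=> sp pm; apply/leq_sizeP => j; rewrite leq_eqVlt => /orP[/eqP<- //|hj].
  by rewrite nth_default // (leq_trans sp).
have [|A [B [sA sB]]] := hsurj 'X^(n1 + n2); first by rewrite size_polyXn.
have s1' := drop _ _ (s1 t) b1; have s2' := drop _ _ (s2 t) b2.
move/(congr1 (fun p : {poly K} => p`_(n1 + n2))).
rewrite coefD coefXn eqxx !nth_default ?addr0 => [/eqP||].
- by rewrite eq_sym oner_eq0.
- apply: (leq_trans (size_polyMleq _ _)).
  have := size_polyMleq L (D2 t); rewrite size_XsubC.
  by move: s2' sB; case: (size (D2 t)); case: (size B); lia.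
- by apply: (leq_trans (size_polyMleq _ _)); lia.
Qed.
End NoCommonZero.

Section NzOpen.
Variable K : closedFieldType.
Variables (T : Type) (P : (T -> K) -> Prop) (hP : funalg P) (t0 : T).

(** A vector is seen as a polynomial th |-> sum c_i th^i, so that almost all the linear
    combinations with coefficients th^i of finitely many nonzero vectors are not zero. *)
Lemma rowpoly_neq0 m (c : 'rV[K]_m) : c != 0 -> rVpoly c != 0.
Proof. by apply: contra_neq => h; rewrite -[c]rVpolyK h raddf0. Qed.

Lemma horner_rowpoly m (c : 'rV[K]_m) th :
  (rVpoly c).[th] = \sum_i c 0 i * th ^+ i.
Proof.
rewrite (horner_coef_wide _ (size_poly _ _)).
by apply: eq_bigr => i _; rewrite coef_rVpoly_ord.
Qed.

(** An entry and a linear combination of all of them that is not zero at the zeros of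
    this entry have no common zero, also nearby. *)
Lemma nowhere_zero_open n m (q : T -> 'rV[{poly K}]_m) :
  fa_pmx P q -> (forall t i, (size (q t 0%R i) <= n.+1)%N) -> nowhere_zero n (q t0) ->
  exists H : T -> K, [/\ P H, H t0 != 0 & forall t, H t != 0 -> nowhere_zero n (q t)].
Proof.
move=> hq sq [haff hinf].
have [i0 qi0] : exists i, q t0 0 i != 0.
  have /rV0Pn[i] := haff 0; rewrite mxE => h; exists i.
  by apply: contra_neq h => ->; rewrite raddf0.
pose D1 t : {poly K} := q t 0 i0.
have [rs Ers] := closed_field_poly_normal (D1 t0).
pose Th := (\prod_(x <- rs) rVpoly (map_mx (horner_eval x) (q t0)))
  * rVpoly (map_mx (fun p : {poly K} => p`_n) (q t0)).
have Th0 : Th != 0.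
  rewrite mulf_neq0 ?rowpoly_neq0 // prodf_seq_neq0.
  by apply/allP => x _ /=; apply: rowpoly_neq0.
have [th] := exists_nonroot Th0; rewrite hornerM mulf_eq0 negb_or => /andP[h1 h2].
pose D2 t : {poly K} := \sum_(i < m) th ^+ i *: q t 0 i.
have D2b t b : (D2 t).[b] = \sum_i (map_mx (horner_eval b) (q t)) 0 i * th ^+ i.
  by rewrite horner_sum; apply: eq_bigr => i _; rewrite hornerZ mxE mulrC.
have D2n t : (D2 t)`_n =
    \sum_i (map_mx (fun p : {poly K} => p`_n) (q t)) 0 i * th ^+ i.
  by rewrite coef_sum; apply: eq_bigr => i _; rewrite coefZ mxE mulrC.
have [||||||H [PH H0 hH]] := @coprime_forms_open K T P hP t0 n n D1 D2.
- exact: hq.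
- apply: (fa_poly_sum hP) => i _ b.
  apply: (fa_ext hP _ (fa_mul hP (fa_cst hP (th ^+ i)) (hq 0 i b))) => t.
  by rewrite coefZ.
- by move=> t; apply: sq.
- move=> t; apply: (leq_trans (size_sum _ _ _)); apply/bigmax_leqP => i _.
  exact: leq_trans (size_scale_leq _ _) (sq _ _).
- exact: qi0.
- split=> [b|_].
    rewrite D2b -horner_rowpoly => /eqP; rewrite Ers hornerZ mulf_eq0.
    rewrite lead_coef_eq0 (negbTE qi0) /= => /eqP hb /eqP.
    have : b \in rs by rewrite -root_prod_XsubC rootE hb.
    move=> b_rs; apply/negP; move: h1; rewrite horner_prod prodf_seq_neq0.
    by move/allP => /(_ b b_rs).
  by rewrite D2n -horner_rowpoly => /eqP; apply/negP.
exists H; split=> // t /hH[g1 g2]; split=> [b|]; apply/eqP => e.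
  apply: (g1 b); last by rewrite D2b e big1 // => i _; rewrite mxE mul0r.
  by move/rowP: e => /(_ i0); rewrite !mxE.
apply: g2; last by rewrite D2n e big1 // => i _; rewrite mxE mul0r.
by move/rowP: e => /(_ i0); rewrite !mxE.
Qed.
End NzOpen.

(** * General maps to the blow-up *)

Section Eval2.
Variables (K : closedFieldType) (n m : nat).
Implicit Types C : 'M[K]_(n, m.+1).

Lemma ev_scale C (c a b : K) : ev id C (c * a) (c * b) = c ^+ m *: ev id C a b.
Proof.
apply/rowP => i; rewrite !mxE mulr_sumr; apply: eq_bigr => j _.
have -> : c ^+ m = c ^+ (m - j) * c ^+ j by rewrite -exprD subnK -1?ltnS.
by rewrite !exprMn; ring.
Qed.

Lemma evS_scale C (c a b : K) :
  evS id C (c * a) (c * b) = c ^+ m.-1 *: evS id C a b.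
Proof.
apply/rowP => i; rewrite !mxE mulr_sumr; apply: eq_bigr => j _.
have := ltn_ord j; rewrite ltnS => jm; case E: (m - j)%N => [|l].
  by rewrite !mulr0n !mulr0 !mul0r mulr0.
have -> : m.-1 = (l + j)%N by lia.
by rewrite /= !exprMn exprD; ring.
Qed.

Lemma evT_scale C (c a b : K) :
  evT id C (c * a) (c * b) = c ^+ m.-1 *: evT id C a b.
Proof.
apply/rowP => i; rewrite !mxE mulr_sumr; apply: eq_bigr => j _.
have := ltn_ord j; rewrite ltnS; case E: (nat_of_ord j) => [|l] hl.
  by rewrite !mulr0n !mulr0.
have -> : m.-1 = ((m - l.+1) + l)%N by lia.
by rewrite /= !exprMn exprD; ring.
Qed.

Lemma euler_id C (a b : K) :
  a *: evS id C a b + b *: evT id C a b = m%:R *: ev id C a b.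
Proof.
apply/rowP => i; rewrite !mxE !mulr_sumr -big_split; apply: eq_bigr => j _ /=.
have := ltn_ord j; rewrite ltnS => jm.
have -> : a * (id (C i j) * (a ^+ (m - j).-1 *+ (m - j)) * b ^+ j) =
    (m - j)%:R * (C i j * a ^+ (m - j) * b ^+ j).
  case: (m - j)%N => [|l]; first by rewrite !mulr0n !mulr0 !mul0r mulr0.
  by rewrite exprS /=; ring.
have -> : b * (id (C i j) * a ^+ (m - j) * (b ^+ j.-1 *+ j)) =
    j%:R * (C i j * a ^+ (m - j) * b ^+ j).
  case: (nat_of_ord j) => [|l]; first by rewrite !mulr0n !mulr0 !mul0r.
  by rewrite exprS /=; ring.
by rewrite -mulrDl -natrD subnK.
Qed.
End Eval2.

Lemma point_chart (K : closedFieldType) (a b : K) : (a, b) <> (0, 0) ->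
  exists c (x y : K), [/\ x != 0, a = x * (chpt c y).1 & b = x * (chpt c y).2].
Proof.
move=> hab; have [a0|a0] := eqVneq a 0; last first.
  by exists U_0, a, (b / a); rewrite a0 /= mulr1 mulrC divfK.
exists U_oo, b, 0; rewrite a0 /= mulr0 mulr1; split=> //.
by apply/eqP => b0; apply: hab; rewrite a0 b0.
Qed.

Section Params.
Variables (K : closedFieldType) (r s d k : nat).
Hypothesis hkd : (k <= d)%N.
Notation M := (r - s)%N.
Notation map_X := (map_X K r s d k).

Definition par : Type :=
  ('M[K]_(s.+1, d.+1) * 'rV[K]_k.+1 * 'M[K]_(M, (d - k).+1))%type.
Definition pp (x : par) := polyrow x.1.1.
Definition pe (x : par) := rVpoly x.1.2.
Definition pw (x : par) := polyrow x.2.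
Definition pz (x : par) : 'rV[{poly K}]_(s.+1 + M) := row_mx (pp x) (pe x *: pw x).

Definition coefmx n m (v : 'rV[{poly K}]_n) : 'M[K]_(n, m) :=
  \matrix_(i, j) (v 0 i)`_j.

Lemma coefmxK n m (v : 'rV[{poly K}]_n) :
  (forall i, (size (v 0%R i) <= m)%N) -> polyrow (coefmx m v) = v.
Proof.
move=> hv; apply/rowP => i; rewrite mxE; apply/polyP => j; rewrite coef_rVpoly.
case: insubP => [l _ <-|]; first by rewrite !mxE.
by rewrite -leqNgt => h; rewrite nth_default // (leq_trans (hv i)).
Qed.

Lemma polyrow_inj n m : injective (@polyrow K n m).
Proof.
move=> A B h; apply/row_matrixP => i; apply: (can_inj rVpolyK).
by move/rowP: h => /(_ i); rewrite !mxE.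
Qed.

Definition par_of p e w : par :=
  (coefmx d.+1 p, poly_rV e, coefmx (d - k).+1 w).

Lemma par_ofE (p : 'rV[{poly K}]_s.+1) (e : {poly K}) (w : 'rV[{poly K}]_M) :
  (forall i, (size (p 0%R i) <= d.+1)%N) ->
  (size e <= k.+1)%N -> (forall i, (size (w 0%R i) <= (d - k).+1)%N) ->
  [/\ pp (par_of p e w) = p, pe (par_of p e w) = e & pw (par_of p e w) = w].
Proof. by move=> hp he hw; rewrite /pp /pe /pw /= !coefmxK // poly_rV_K. Qed.

Lemma size_pp x i : (size (pp x 0%R i) <= d.+1)%N.
Proof. exact: size_polyrow. Qed.
Lemma size_pe x : (size (pe x) <= k.+1)%N.
Proof. exact: size_poly. Qed.
Lemma size_pw x i : (size (pw x 0%R i) <= (d - k).+1)%N.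
Proof. exact: size_polyrow. Qed.
Lemma size_pz x i : (size (pz x 0%R i) <= d.+1)%N.
Proof.
rewrite -(splitK i); case: (split i) => j /=; rewrite ?row_mxEl ?row_mxEr.
  exact: size_pp.
rewrite mxE -(subnKC hkd); apply: size_mul_bound; last exact: size_pw.
exact: size_pe.
Qed.

Definition valid x := nowhere_zero d (pz x) /\ nowhere_zero (d - k) (pw x).

Definition coefs_of x : coefs K r s d k := (coefmx d.+1 (pz x), x.2).

Lemma polyrow_coefs x : polyrow (coefs_of x).1 = pz x.
Proof. by apply: coefmxK => i; apply: size_pz. Qed.

Lemma nowhere_zero_ch n m (v : 'rV[{poly K}]_m) c b :
  (forall i, (size (v 0%R i) <= n.+1)%N) -> nowhere_zero n v ->
  map_mx (fun p => (ch c n p).[b]) v != 0.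
Proof.
move=> sv [h1 h2]; case: c => /=.
  by have := h1 b; congr (_ != 0).
have [->|b0] := eqVneq b 0.
  have := h2; congr (_ != 0); apply/rowP => i; rewrite !mxE.
  by rewrite horner_rev0.
have /rV0Pn[i] := h1 b^-1; rewrite mxE => hi.
by apply/rV0Pn; exists i; rewrite mxE horner_rev // mulf_neq0 ?expf_neq0.
Qed.

Lemma nowhere_zero_of_ch n m (v : 'rV[{poly K}]_m) :
  (forall c b, map_mx (fun p => (ch c n p).[b]) v != 0) -> nowhere_zero n v.
Proof.
move=> h; split=> [b|]; first exact: (h U_0 b).
have := h U_oo 0; congr (_ != 0); apply/rowP => i; rewrite !mxE.
by rewrite /= horner_rev0.
Qed.

Lemma is_map_coefs x : valid x -> is_map (coefs_of x).
Proof.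
move=> [hz hw] a b hab; have [c [u [y [u0 -> ->]]]] := point_chart hab.
rewrite !ev_scale !ev_pt polyrow_coefs.
split.
- rewrite scaler_eq0 expf_eq0 (negbTE u0) andbF /=.
  by apply: nowhere_zero_ch => // i; apply: size_pz.
- rewrite scaler_eq0 expf_eq0 (negbTE u0) andbF /=.
  by apply: nowhere_zero_ch => // i; apply: size_pw.
- move=> i j.
  have rs (A : 'rV[K]_(s.+1 + M)) l : rsubmx A 0 l = A 0 (rshift _ l).
    exact: mxE.
  have hh l : ch c d (pe x * pw x 0 l) = ch c k (pe x) * ch c (d - k) (pw x 0 l).
    by rewrite -chM ?subnKC ?size_pe ?size_pw.
  rewrite !rs !mxscaleE !map_mxE' /pz !row_mxEr !mxscaleE !hh !hornerM.
  ring.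
Qed.

Definition map_of x (hx : valid x) : map_X := MapX (is_map_coefs hx).

(** Every map comes from a unique triple (p, e, w): since w has no common zero,
    e is the combination of the last coordinates of z whose coefficients combine w to 1. *)
Lemma par_exists (f : map_X) : exists x,
  [/\ polyrow (map_coefs f).1 = pz x, polyrow (map_coefs f).2 = pw x & valid x].
Proof.
set Z := polyrow (map_coefs f).1; set W := polyrow (map_coefs f).2.
have sZ i : (size (Z 0%R i) <= d.+1)%N by apply: size_polyrow.
have sW i : (size (W 0%R i) <= (d - k).+1)%N by apply: size_polyrow.
have nzZ : nowhere_zero d Z.
  apply: nowhere_zero_of_ch => c b; rewrite -ev_pt.
  by have [] := map_coefsP f (@chpt_neq0 K c b).
have nzW : nowhere_zero (d - k) W.
  apply: nowhere_zero_of_ch => c b; rewrite -ev_pt.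
  by have [] := map_coefsP f (@chpt_neq0 K c b).
have poly_eq (p q : {poly K}) : (forall b, p.[b] = q.[b]) -> p = q.
  move=> h; apply/eqP; rewrite -subr_eq0; apply/negPn/negP => /exists_nonroot[b].
  by rewrite hornerD hornerN h subrr eqxx.
have inc i j : Z 0 (rshift _ i) * W 0 j = Z 0 (rshift _ j) * W 0 i.
  apply: poly_eq => b; have [_ _ /(_ i j)] := map_coefsP f (@chpt_neq0 K U_0 b).
  rewrite !ev_pt ![rsubmx _ _ _]mxE !map_mxE' /= !hornerM; exact.
have [u Wu] : exists u : 'cV_M, W *m u = 1%:M by apply: row_unimod; case: nzW.
pose e := \sum_j Z 0 (rshift _ j) * u j 0.
have Ze i : Z 0 (rshift _ i) = e * W 0 i.
  have h1 : \sum_j W 0 j * u j 0 = 1.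
    by move/matrixP: Wu => /(_ 0 0); rewrite [LHS]mxE [RHS]mxE mulr1n.
  rewrite -[LHS]mulr1 -h1 mulr_sumr mulr_suml; apply: eq_bigr => j _.
  by rewrite mulrA inc mulrAC.
have se : (size e <= k.+1)%N.
  case: nzW => _ /rV0Pn[i]; rewrite mxE => hi.
  have [->|e0] := eqVneq e 0; first by rewrite size_poly0.
  have W0 : W 0 i != 0 by apply: contra_neq hi => ->; rewrite coef0.
  have sWi : size (W 0 i) = (d - k).+1.
    apply/eqP; rewrite eqn_leq sW /= ltnNge; apply: contraNN hi => h.
    by rewrite nth_default.
  have := sZ (rshift _ i); rewrite Ze size_mul // sWi.
  move: e0; rewrite -size_poly_gt0; case: (size e) => // n _.
  by rewrite addSn /= addnS ltnS -{2}(subnKC hkd) leq_add2r.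
have sZl i : (size (lsubmx Z 0%R i) <= d.+1)%N by rewrite mxE.
have [ep ee ew] := @par_ofE (lsubmx Z) e W sZl se sW.
exists (par_of (lsubmx Z) e W).
have eZ : pz (par_of (lsubmx Z) e W) = Z.
  rewrite /pz ep ee ew -[RHS]hsubmxK; congr row_mx.
  by apply/rowP => i; rewrite mxscaleE [RHS]mxE Ze.
by rewrite /valid eZ ew.
Qed.

Lemma par_unique x y : valid x -> pz x = pz y -> pw x = pw y -> x = y.
Proof.
move=> [_ [hw _]] hz hxy.
have h2 : x.2 = y.2 by apply: polyrow_inj.
have [h11 he] : pp x = pp y /\ pe x *: pw x = pe y *: pw x.
  by move: hz; rewrite /pz hxy => /eq_row_mx.
have h1 : x.1.1 = y.1.1 by apply: polyrow_inj.
have h12 : x.1.2 = y.1.2.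
  apply: (can_inj rVpolyK); have /rV0Pn[i] := hw 0; rewrite mxE => hi.
  have wi : pw x 0 i != 0 by apply: contra_neq hi => ->; rewrite raddf0.
  by apply: (mulIf wi); move/rowP: he => /(_ i); rewrite !mxE.
by move: h1 h12 h2; case: x {hw hz hxy h11 he} => [[? ?] ?];
  case: y => [[? ?] ?] /= -> -> ->.
Qed.
End Params.

Section Open.
Variables (K : closedFieldType) (r s d k : nat).
Hypothesis hkd : (k <= d)%N.
Notation M := (r - s)%N.
Notation map_X := (map_X K r s d k).
Notation par := (par K r s d k).

Definition fa_par T (P : (T -> K) -> Prop) (phi : T -> par) :=
  [/\ fa_mx P (fun t => (phi t).1.1), fa_mx P (fun t => (phi t).1.2) &
      fa_mx P (fun t => (phi t).2)].

(** Such functions become polynomials on lines in the space of parameters, and germs of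
    regular functions near a map. *)
Definition openfun (H : par -> K) : Prop :=
  forall (T : Type) (P : (T -> K) -> Prop), funalg P ->
  forall phi, fa_par P phi -> P (fun t => H (phi t)).

Lemma openfun_alg : funalg openfun.
Proof.
split.
- by move=> f g fg hf T P hP phi h; apply: (fa_ext hP _ (hf _ _ hP _ h)).
- by move=> c T P hP phi h; apply: fa_cst.
- by move=> f g hf hg T P hP phi h; apply: (fa_add hP (hf _ _ hP _ h) (hg _ _ hP _ h)).
- by move=> f g hf hg T P hP phi h; apply: (fa_mul hP (hf _ _ hP _ h) (hg _ _ hP _ h)).
Qed.

Lemma fa_polyrow T (P : (T -> K) -> Prop) (hP : funalg P) n m
    (A : T -> 'M[K]_(n, m)) : fa_mx P A -> fa_pmx P (fun t => polyrow (A t)).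
Proof.
move=> hA i j b; rewrite (ord1 i); case: (ltnP b m) => hb.
  apply: (fa_ext hP _ (hA j (Ordinal hb))) => t.
  by rewrite mxE (coef_rVpoly_ord _ (Ordinal hb)) mxE.
apply: (fa_ext hP _ (fa_cst hP 0)) => t.
by rewrite mxE nth_default // (leq_trans (size_poly _ _)).
Qed.

Lemma fa_par_self : fa_par openfun id.
Proof. by split=> i j T P hP phi [h1 h2 h3]; [apply: h1|apply: h2|apply: h3]. Qed.

Lemma pp_open : fa_pmx openfun (@pp K r s d k).
Proof. by case: fa_par_self => h _ _; apply: (fa_polyrow openfun_alg h). Qed.

Lemma pw_open : fa_pmx openfun (@pw K r s d k).
Proof. by case: fa_par_self => _ _ h; apply: (fa_polyrow openfun_alg h). Qed.

Lemma pe_open : fa_poly openfun (@pe K r s d k).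
Proof.
case: fa_par_self => _ h _ b; have := fa_polyrow openfun_alg h 0 0 b.
apply: (fa_ext openfun_alg) => x; rewrite mxE.
by congr (rVpoly _)`_b; apply/rowP => j; rewrite mxE.
Qed.

Lemma pz_open : fa_pmx openfun (@pz K r s d k).
Proof.
have hA := openfun_alg; apply: (fa_pmx_row hA); first exact: pp_open.
by apply: (fa_pmx_scale hA); [apply: pe_open | apply: pw_open].
Qed.

Definition pline (x y : par) (t : K) : par :=
  ((1 - t) *: x.1.1 + t *: y.1.1, (1 - t) *: x.1.2 + t *: y.1.2,
   (1 - t) *: x.2 + t *: y.2).

Definition polyfun (g : K -> K) := exists q : {poly K}, forall t, g t = q.[t].

Lemma polyfun_alg : funalg polyfun.
Proof.
split.
- by move=> f g fg [q hq]; exists q => t; rewrite -fg.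
- by move=> c; exists c%:P => t; rewrite hornerC.
- by move=> f g [p hp] [q hq]; exists (p + q) => t; rewrite hornerD hp hq.
- by move=> f g [p hp] [q hq]; exists (p * q) => t; rewrite hornerM hp hq.
Qed.

Lemma pline_fa x y : fa_par polyfun (pline x y).
Proof.
by split=> i j; [exists ((1 - 'X) * (x.1.1 i j)%:P + 'X * (y.1.1 i j)%:P)
  | exists ((1 - 'X) * (x.1.2 i j)%:P + 'X * (y.1.2 i j)%:P)
  | exists ((1 - 'X) * (x.2 i j)%:P + 'X * (y.2 i j)%:P)] => t;
  rewrite !mxE !hornerE.
Qed.

Lemma pline0 x y : pline x y 0 = x.
Proof.
by case: x => [[a b] c]; rewrite /pline /= subr0 !scale1r !scale0r !addr0.
Qed.

Lemma pline1 x y : pline x y 1 = y.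
Proof.
by case: y => [[a b] c]; rewrite /pline /= subrr !scale1r !scale0r !add0r.
Qed.

Lemma valid_open x0 : valid x0 -> exists H : par -> K,
  [/\ openfun H, H x0 != 0 & forall x, H x != 0 -> valid x].
Proof.
move=> [hz hw].
have [H1 [o1 n1 h1]] := nowhere_zero_open openfun_alg pz_open (@size_pz _ _ _ _ _ hkd) hz.
have [H2 [o2 n2 h2]] := nowhere_zero_open openfun_alg pw_open (@size_pw _ _ _ _ _) hw.
exists (fun x => H1 x * H2 x); split.
- exact: (fa_mul openfun_alg).
- by rewrite mulf_neq0.
- by move=> x; rewrite mulf_eq0 negb_or => /andP[/h1 ? /h2 ?].
Qed.

(** The parameter space is irreducible: on the line joining two points, each of the
    conditions holds for all but finitely many points. *)
Lemma line_meet (g1 g2 g3 : K -> K) : polyfun g1 -> polyfun g2 -> polyfun g3 ->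
  (exists t, g1 t != 0) -> (exists t, g2 t != 0) -> (exists t, g3 t != 0) ->
  exists t, [/\ g1 t != 0, g2 t != 0 & g3 t != 0].
Proof.
move=> [q1 e1] [q2 e2] [q3 e3] [t1 h1] [t2 h2] [t3 h3].
have nz g (q : {poly K}) t : (forall t, g t = q.[t]) -> g t != 0 -> q != 0.
  by move=> e; apply: contra_neq => q0; rewrite e q0 horner0.
have : q1 * q2 * q3 != 0.
  by rewrite !mulf_neq0 // ?(nz _ _ _ e1 h1) ?(nz _ _ _ e2 h2) ?(nz _ _ _ e3 h3).
move=> /exists_nonroot[t]; rewrite !hornerM !mulf_eq0 !negb_or -e1 -e2 -e3.
by move=> /andP[/andP[? ?] ?]; exists t.
Qed.

Definition par_rel (f : map_X) (x : par) :=
  (polyrow (map_coefs f).1 == pz x) && (polyrow (map_coefs f).2 == pw x).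

Lemma par_rel_ex f : exists x, par_rel f x.
Proof.
by have [x [e1 e2 _]] := par_exists hkd f; exists x; rewrite /par_rel e1 e2 !eqxx.
Qed.

Definition par_of_map f : par := xchoose (par_rel_ex f).

Lemma par_of_mapP f : [/\ polyrow (map_coefs f).1 = pz (par_of_map f),
  polyrow (map_coefs f).2 = pw (par_of_map f) & valid (par_of_map f)].
Proof.
have /andP[/eqP e1 /eqP e2] := xchooseP (par_rel_ex f).
have [x [h1 h2 hv]] := par_exists hkd f.
by rewrite [par_of_map f](_ : _ = x) //; apply/esym/(par_unique hv);
  rewrite -?h1 -?h2.
Qed.

Lemma par_of_map_of x (hx : valid x) : par_of_map (map_of hkd hx) = x.
Proof.
have [h1 h2 hv] := par_of_mapP (map_of hkd hx).
apply/esym/(par_unique hx); first by rewrite -h1 /= polyrow_coefs.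
by rewrite -h2.
Qed.

Definition coordfun (g : map_X -> K) := exists
  G : {mpoly K[(s.+1 + M) * d.+1 + M * (d - k).+1]},
  forall f, g f = G.@[fun i => coord_vec f 0 i].

Lemma coordfun_alg : funalg coordfun.
Proof.
split.
- by move=> f g fg [q hq]; exists q => t; rewrite -fg.
- by move=> c; exists c%:MP => t; rewrite mevalC.
- by move=> f g [p hp] [q hq]; exists (p + q) => t; rewrite mevalD hp hq.
- by move=> f g [p hp] [q hq]; exists (p * q) => t; rewrite mevalM hp hq.
Qed.

Lemma coordfun_z i j : coordfun (fun f => (map_coefs f).1 i j).
Proof.
exists 'X_(lshift _ (mxvec_index i j)) => f.
by rewrite mevalXU /coord_vec row_mxEl mxvecE.
Qed.

Lemma coordfun_w i j : coordfun (fun f => (map_coefs f).2 i j).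
Proof.
exists 'X_(rshift _ (mxvec_index i j)) => f.
by rewrite mevalXU /coord_vec row_mxEr mxvecE.
Qed.

(** The local ring of the space of maps at f0, as functions on this space. *)
Definition regular (f0 : map_X) (g : map_X -> K) := exists a b,
  [/\ coordfun a, coordfun b, b f0 != 0 & forall f, g f * b f = a f].

Lemma regular_alg f0 : funalg (regular f0).
Proof.
have hA := coordfun_alg; split.
- by move=> f g fg [a [b [ha hb b0 h]]]; exists a, b; split=> // x; rewrite -fg.
- move=> c; exists (fun=> c), (fun=> 1); split; try exact: (fa_cst hA).
    exact: oner_neq0.
  by move=> x; rewrite mulr1.
- move=> f g [a [b [ha hb b0 h]]] [a' [b' [ha' hb' b0' h']]].
  exists (fun x => a x * b' x + a' x * b x), (fun x => b x * b' x); split.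
  + by apply: (fa_add hA); apply: (fa_mul hA).
  + exact: (fa_mul hA).
  + exact: mulf_neq0.
  + by move=> x; rewrite -h -h'; ring.
- move=> f g [a [b [ha hb b0 h]]] [a' [b' [ha' hb' b0' h']]].
  exists (fun x => a x * a' x), (fun x => b x * b' x); split.
  + exact: (fa_mul hA).
  + exact: (fa_mul hA).
  + exact: mulf_neq0.
  + by move=> x; rewrite -h -h'; ring.
Qed.

Lemma regular_coord f0 g : coordfun g -> regular f0 g.
Proof.
move=> hg; exists g, (fun=> 1); split=> //; first exact: (fa_cst coordfun_alg).
  exact: oner_neq0.
by move=> x; rewrite mulr1.
Qed.

(** The coefficients of e are regular functions of (z, w): e solves the linear
    system z_j = e w_j, which is injective near f0 when w_j is not zero there. *)
Lemma par_of_map_fa f0 : fa_par (regular f0) par_of_map.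
Proof.
split=> i j.
- apply: regular_coord; apply: (fa_ext coordfun_alg _ (coordfun_z (lshift _ i) j)).
  move=> f; have [h1 _ _] := par_of_mapP f.
  rewrite -(coef_polyrow (map_coefs f).1) h1 /pz row_mxEl.
  by rewrite -(coef_polyrow (par_of_map f).1.1).
- have [_ e0 [_ [hw0 _]]] := par_of_mapP f0.
  have /rV0Pn[l] := hw0 0; rewrite mxE => hl.
  have wl : pw (par_of_map f0) 0 l != 0.
    by apply: contra_neq hl => ->; rewrite raddf0.
  pose W (f : map_X) : 'M[K]_(k.+1, d.+1) :=
    \matrix_(a, b) ('X^a * polyrow (map_coefs f).2 0 l)`_b.
  have WE f (v : 'rV_k.+1) : v *m W f =
      poly_rV (rVpoly v * polyrow (map_coefs f).2 0 l).
    have -> : rVpoly v = \sum_(a < k.+1) v 0 a *: 'X^a.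
      have -> : rVpoly v = \poly_(a < k.+1) (rVpoly v)`_a.
        apply/polyP => a; rewrite coef_poly; case: ltnP => // ha.
        by rewrite nth_default // (leq_trans (size_poly _ _)).
      by rewrite poly_def; apply: eq_bigr => a _; rewrite coef_rVpoly_ord.
    apply/rowP => b; rewrite [RHS]mxE [LHS]mxE mulr_suml coef_sum.
    by apply: eq_bigr => a _; rewrite [W f a b]mxE -scalerAl coefZ.
  have hfree : row_free (W f0).
    rewrite -kermx_eq0; apply/rowV0P => v /sub_kermxP; rewrite WE e0 => hv.
    rewrite -[v]rVpolyK; have : rVpoly v * pw (par_of_map f0) 0 l = 0.
      rewrite -[LHS](@poly_rV_K _ d.+1) ?hv ?raddf0 //.
      apply: (leq_trans (size_mul_bound (size_poly _ _) (size_pw _ _))).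
      by rewrite subnKC.
    by move/eqP; rewrite mulf_eq0 (negbTE wl) orbF => /eqP ->; rewrite raddf0.
  have /row_freeP[R WR] := hfree.
  have hA := coordfun_alg.
  have hW : fa_mx coordfun W.
    move=> a b; have h : fa_pmx coordfun (fun f => polyrow (map_coefs f).2).
      by apply: (fa_polyrow hA) => a' b'; apply: coordfun_w.
    have := fa_poly_mul hA (fa_poly_cst hA 'X^a) (h 0 l) b.
    by apply: (fa_ext hA) => f; rewrite [RHS]mxE.
  have hWR : fa_mx coordfun (fun f => W f *m R).
    by apply: fa_mulmx => //; apply: fa_mx_cst.
  pose zr (f : map_X) : 'rV[K]_d.+1 := row (rshift _ l) (map_coefs f).1.
  exists (fun f => (zr f *m R *m \adj (W f *m R)) i j),
    (fun f => \det (W f *m R)); split.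
  + apply: (fa_mulmx hA); last exact: (fa_adj hA).
    apply: (fa_mulmx hA); last exact: fa_mx_cst.
    by move=> a b; apply: (fa_ext hA _ (coordfun_z (rshift _ l) b)) => f;
      rewrite mxE.
  + exact: (fa_det hA).
  + by rewrite WR det1 oner_neq0.
  + move=> f; have [h1 h2 _] := par_of_mapP f.
    have -> : zr f = (par_of_map f).1.2 *m W f.
      rewrite WE h2; apply: (can_inj rVpolyK).
      rewrite poly_rV_K; last first.
        apply: (leq_trans (size_mul_bound (size_poly _ _) (size_pw _ _))).
        by rewrite subnKC.
      move/rowP: h1 => /(_ (rshift _ l)); rewrite mxE => ->.
      by rewrite row_mxEr mxE.
    by rewrite -(mulmxA _ (W f) R) -mulmxA mul_mx_adj mul_mx_scalar mxE mulrC.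
- apply: regular_coord; apply: (fa_ext coordfun_alg _ (coordfun_w i j)).
  move=> f; have [_ h2 _] := par_of_mapP f.
  by rewrite -(coef_polyrow (map_coefs f).2) h2 -(coef_polyrow (par_of_map f).2).
Qed.

(** A property that holds where an open condition H on (p, e, w) does is general, as soon
    as H holds at one triple, be it the triple of a map or not. *)
Lemma general_of_open (Q : map_X -> Prop) (H : par -> K) x1 :
  openfun H -> H x1 != 0 -> (exists x, @valid K r s d k x) ->
  (forall f, H (par_of_map f) != 0 -> Q f) -> general Q.
Proof.
move=> oH H1 [x0 hx0] hQ; pose U f := H (par_of_map f) != 0.
have dense : zariski_dense U.
  move=> V oV [f Vf]; have [G [Gf GV]] := oV f Vf.
  have [_ _ hv] := par_of_mapP f.
  have [Hv [oHv Hv0 hHv]] := valid_open hv.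
  pose L := pline (par_of_map f) x1.
  have hL := pline_fa (par_of_map f) x1.
  have hA := polyfun_alg.
  pose cv (x : par) := coord_vec (coefs_of x).
  have hcv i : polyfun (fun t => cv (L t) 0 i).
    have hz : fa_pmx polyfun (fun t => pz (L t)).
      by move=> a b c; apply: (pz_open a b c hA hL).
    rewrite -(splitK i); case: (split i) => a /=; case/mxvec_indexP: a => a b.
      apply: (fa_ext hA _ (hz 0 a b)) => t.
      by rewrite /cv /coord_vec row_mxEl mxvecE [RHS]mxE.
    case: hL => _ _ h3; apply: (fa_ext hA _ (h3 a b)) => t.
    by rewrite /cv /coord_vec row_mxEr mxvecE.
  have [||||||t [t1 t2 t3]] := @line_meet (fun t => G.@[fun i => cv (L t) 0 i])
    (fun t => H (L t)) (fun t => Hv (L t)).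
  - apply: (@fa_ext _ _ _ hA (fun t => \sum_(m <- msupp G)
        G@_m * \prod_i cv (L t) 0 i ^+ m i)).
      by move=> t; rewrite mevalE.
    apply: (fa_sum hA) => m _; apply: (fa_mul hA); first exact: (fa_cst hA).
    apply: (fa_prod hA) => i _; elim: (m i) => [|e IH].
      by apply: (fa_ext hA _ (fa_cst hA 1)) => t; rewrite expr0.
    by apply: (fa_ext hA _ (fa_mul hA (hcv i) IH)) => t; rewrite exprS.
  - exact: (oH _ _ hA _ hL).
  - exact: (oHv _ _ hA _ hL).
  - exists 0; rewrite /L pline0 (_ : cv _ = coord_vec (map_coefs f)) //.
    have [h1 h2 _] := par_of_mapP f; rewrite /cv /coefs_of.
    have -> : (par_of_map f).2 = (map_coefs f).2 by apply: polyrow_inj.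
    rewrite -h1 (_ : coefmx _ _ = (map_coefs f).1) -?surjective_pairing //.
    by apply/matrixP => a b; rewrite mxE coef_polyrow.
  - by exists 1; rewrite /L pline1.
  - by exists 0; rewrite /L pline0.
  have hv1 := hHv _ t3; exists (map_of hkd hv1); split.
    by rewrite /U par_of_map_of.
  exact: GV.
exists U; split=> //.
- move=> f Uf; have [a [b [[Ga ha] hb b0 h]]] :=
    oH _ _ (regular_alg f) _ (par_of_map_fa f).
  exists Ga; split; first by rewrite -ha -h mulf_neq0.
  by move=> g; rewrite -ha -h mulf_eq0 negb_or => /andP[].
- have [||f [Uf _]] := dense (fun=> True); last by exists f.
    by move=> f _; exists 1; split=> //; rewrite meval1 oner_neq0.
  by exists (map_of hkd hx0).
Qed.

Lemma general_imp (P Q R : map_X -> Prop) : general P -> general Q ->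
  (forall f, P f -> Q f -> R f) -> general R.
Proof.
move=> [U [oU dU [f Uf] UP]] [V [oV dV [g Vg] VQ]] PQR.
exists (fun f => U f /\ V f); split.
- move=> x [Ux Vx]; have [G [G1 G2]] := oU x Ux; have [H [H1 H2]] := oV x Vx.
  exists (G * H); rewrite mevalM mulf_neq0 //; split=> // y.
  by rewrite mevalM mulf_eq0 negb_or => /andP[/G2 ? /H2 ?].
- move=> W oW [x Wx]; have [y [Uy Wy]] := dU W oW (ex_intro _ x Wx).
  have [||z [Vz [Uz Wz]]] := dV (fun x => U x /\ W x).
  + move=> u [Uu Wu]; have [G [G1 G2]] := oU u Uu; have [H [H1 H2]] := oW u Wu.
    exists (G * H); rewrite mevalM mulf_neq0 //; split=> // v.
    by rewrite mevalM mulf_eq0 negb_or => /andP[/G2 ? /H2 ?].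
  + by exists y.
  by exists z.
- by have [y [Vy Uy]] := dV U oU (ex_intro _ f Uf); exists y.
- by move=> x [/UP Px /VQ Qx]; apply: PQR.
Qed.
End Open.

(** * A general map is unramified *)

Section Wronskian.
Variable K : fieldType.
Implicit Types f g : {poly K}.

Definition wronskian f g := f * g^`() - f^`() * g.

Lemma coef_lead f g n m : (size f <= n.+1)%N -> (size g <= m.+1)%N ->
  (f * g)`_(n + m) = f`_n * g`_m.
Proof.
move=> hf hg; rewrite coefM.
have hm : (n < (n + m).+1)%N by rewrite ltnS leq_addr.
rewrite (bigD1 (Ordinal hm)) //= addKn big1 ?addr0 // => -[i hi] /=.
rewrite -val_eqE /= => im; case: (ltngtP i n) im => // h _.
  by rewrite [g`__]nth_default ?mulr0 //; apply: leq_trans hg _; lia.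
by rewrite nth_default ?mul0r //; apply: leq_trans hf _.
Qed.

Lemma coef_top f g m : (size f <= m.+1)%N -> (size g <= m.+1)%N ->
  (f * g)`_(m + m) = f`_m * g`_m.
Proof. exact: coef_lead. Qed.

Lemma coef_top1 f g m : (size f <= m.+2)%N -> (size g <= m.+2)%N ->
  (f * g)`_(m + m).+1 = f`_m.+1 * g`_m + f`_m * g`_m.+1.
Proof.
move=> hf hg; rewrite coefM.
have hm : (m < (m + m).+2)%N by lia.
have hm1 : (m.+1 < (m + m).+2)%N by lia.
rewrite (bigD1 (Ordinal hm1)) // (bigD1 (Ordinal hm)) /=; last first.
  by rewrite -val_eqE /= neq_ltn ltnSn.
have -> : ((m + m).+1 - m.+1 = m)%N by lia.
have -> : ((m + m).+1 - m = m.+1)%N by lia.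
rewrite big1 ?addr0 // => -[i hi]; rewrite -!val_eqE /= => /andP[i1 i2].
case: (leqP i m.+1) => h.
  by rewrite [g`__]nth_default ?mulr0 //; apply: leq_trans hg _; lia.
by rewrite nth_default ?mul0r //; apply: leq_trans hf _.
Qed.

Lemma coefXderiv f j : ('X * f^`())`_j = f`_j *+ j.
Proof. by rewrite coefXM coef_deriv; case: j => //; rewrite mulr0n. Qed.

Lemma size_Xderiv f m : (size f <= m)%N -> (size ('X * f^`())%R <= m)%N.
Proof.
move=> hf; apply/leq_sizeP => j hj.
by rewrite coefXderiv nth_default ?mul0rn // (leq_trans hf).
Qed.

Lemma wronskian_top f g m : (size f <= m.+2)%N -> (size g <= m.+2)%N ->
  (wronskian f g)`_(m + m) = f`_m * g`_m.+1 - f`_m.+1 * g`_m.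
Proof.
move=> hf hg; have -> : (wronskian f g)`_(m + m) = ('X * wronskian f g)`_(m + m).+1.
  by rewrite coefXM.
have -> : 'X * wronskian f g = f * ('X * g^`()) - 'X * f^`() * g by rewrite /wronskian; ring.
rewrite coefB !coef_top1 ?size_Xderiv // !coefXderiv !mulrSr; ring.
Qed.

Lemma size_wronskian f g m : (size f <= m.+2)%N -> (size g <= m.+2)%N ->
  (size (wronskian f g) <= (m + m).+1)%N.
Proof.
move=> hf hg; apply/leq_sizeP => j hj.
have -> : (wronskian f g)`_j = ('X * wronskian f g)`_j.+1 by rewrite coefXM.
have -> : 'X * wronskian f g = f * ('X * g^`()) - 'X * f^`() * g by rewrite /wronskian; ring.
have [->|hj2] := eqVneq j.+1 (m.+1 + m.+1)%N.
  by rewrite coefB !coef_top ?size_Xderiv // !coefXderiv mulrnAr mulrnAl subrr.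
rewrite nth_default //; apply: (leq_trans (size_polyD _ _)).
rewrite size_polyN geq_max.
have h (x y : {poly K}) : (size x <= m.+2)%N -> (size y <= m.+2)%N ->
    (size (x * y)%R <= j.+1)%N.
  by move=> hx hy; apply: (leq_trans (size_mul_bound hx hy)); lia.
by rewrite !h ?size_Xderiv.
Qed.
End Wronskian.

Section Unramified.
Variables (K : closedFieldType) (r s d k : nat).
Hypothesis hkd : (k < d)%N.
Hypothesis hsr : (s + 2 <= r)%N.
Notation M := (r - s)%N.
Notation map_X := (map_X K r s d k).
Notation par := (par K r s d k).

Let hM0 : (0 < M)%N. Proof. by rewrite subn_gt0; lia. Qed.
Let hM1 : (1 < M)%N. Proof. by rewrite ltn_subRL; lia. Qed.
Let j0 : 'I_M := Ordinal hM0.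
Let j1 : 'I_M := Ordinal hM1.
Let hkd' : (k <= d)%N := ltnW hkd.

(** Two Wronskians without common zero show that the map is unramified: where the
    first is not zero the map w is an immersion, and elsewhere z is. *)
Definition form_w (x : par) := wronskian (pw x 0 j0) (pw x 0 j1).
Definition form_z (x : par) :=
  wronskian (pp x 0 0) (pe x * (pw x 0 j0 + pw x 0 j1)).

Lemma mxoppE (V : zmodType) n m (A : 'M[V]_(n, m)) i j : (- A) i j = - A i j.
Proof. exact: mxE. Qed.

(** Subtracting a multiple of the Euler field, the velocity becomes the one of a chart. *)
Lemma velocity (a b u v : K) : (a, b) <> (0, 0) -> u * b <> v * a ->
  exists c y, (c = U_0 \/ (c = U_oo /\ y = 0)) /\
    forall n m (C : 'M[K]_(n, m.+1)) g, (0 < m)%N ->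
    u *: evS id C a b + v *: evT id C a b = g *: ev id C a b ->
    exists h, forall i, (ch c m (polyrow C 0 i))^`().[y] =
              h * (ch c m (polyrow C 0 i)).[y].
Proof.
move=> hab huv.
have [a0|a0] := eqVneq a 0.
  have b0 : b != 0 by apply/eqP => b0; apply: hab; rewrite a0 b0.
  have u0 : u != 0.
    by apply/eqP => u0; apply: huv; rewrite u0 a0 mul0r mulr0.
  exists U_oo, 0; split; first by right.
  move=> n [//|m] C g _.
  have -> : a = b * 0 by rewrite mulr0.
  rewrite -{2 4 6}[b]mulr1 evS_scale evT_scale ev_scale => e.
  have := euler_id C 0 1; rewrite scale0r add0r scale1r => e2.
  rewrite e2 in e; move: e.
  have -> := evD_pt C U_oo 0; have -> := ev_pt C U_oo 0 => /= e.
  exists ((g * b - v * m.+1%:R) / u) => i.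
  move/rowP: e => /(_ i); rewrite !mxscaleE mxaddE !mxscaleE !map_mxE' exprS => e.
  apply: (mulfI (mulf_neq0 u0 (expf_neq0 m b0))); move: e => /=.
  move: (_.[0]) (_.[0]) (b ^+ m) (m.+1%:R) => X V0 B N e.
  have -> : u * B * ((g * b - v * N) / u * X) = g * (b * B * X) - v * (B * (N * X)).
    by field.
  by rewrite -e; ring.
pose y := b / a.
have du : v - u * y != 0.
  apply/eqP => h; apply: huv; apply/eqP; rewrite -subr_eq0; apply/eqP.
  by rewrite -[RHS](mulr0 (- a)) -h /y; field.
exists U_0, y; split; first by left.
move=> n [//|m] C g _.
have -> : b = a * y by rewrite /y mulrC divfK.
rewrite -{1 3 5}[a]mulr1 evS_scale evT_scale ev_scale => e.
have := euler_id C 1 y; rewrite scale1r => /eqP; rewrite eq_sym -subr_eq => /eqP e2.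
rewrite -e2 in e; move: e.
have -> := evD_pt C U_0 y; have -> := ev_pt C U_0 y => /= e.
exists ((g * a - u * m.+1%:R) / (v - u * y)) => i.
move/rowP: e => /(_ i); rewrite !(mxscaleE, mxaddE, mxoppE).
rewrite !map_mxE' exprS => e.
apply: (mulfI (mulf_neq0 du (expf_neq0 m a0))); move: e => /=.
move: (_.[y]) (_.[y]) (a ^+ m) (m.+1%:R) => V X B N e.
have -> : (v - u * y) * B * ((g * a - u * N) / (v - u * y) * X) =
  g * (a * B * X) - u * (B * (N * X)) by field.
by rewrite -e; ring.
Qed.

Lemma wronskian_chart c y m (F G : {poly K}) h : (0 < m)%N ->
  c = U_0 \/ (c = U_oo /\ y = 0) ->
  (size F <= m.+1)%N -> (size G <= m.+1)%N ->
  (ch c m F)^`().[y] = h * (ch c m F).[y] ->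
  (ch c m G)^`().[y] = h * (ch c m G).[y] ->
  if c is U_0 then (wronskian F G).[y] = 0 else (wronskian F G)`_(m.-1.*2) = 0.
Proof.
case: m => // m _ [->|[-> ->]] sF sG /= hF hG.
  by rewrite /wronskian hornerD hornerN !hornerM hF hG; ring.
move: hF hG; rewrite -addnn wronskian_top // !horner_coef0 !coef_deriv !coef_rev_poly.
by rewrite leq0n subn0 subSS subn0 !mulr1n => -> ->; ring.
Qed.

Lemma unramified_of_forms (f : map_X) :
  coprime_forms (d - k).-1.*2 d.-1.*2 (form_w (par_of_map hkd' f))
    (form_z (par_of_map hkd' f)) -> unramified f.
Proof.
set x := par_of_map hkd' f => hco; rewrite /unramified.
have [hz hw _] := par_of_mapP hkd' f.
case E : (map_coefs f) => [Z W] a b hab u v g h ez ew.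
have [//|/eqP huv] := eqVneq (u * b) (v * a); exfalso.
have {hz} hz : polyrow Z = pz x by rewrite -hz E.
have {hw} hw : polyrow W = pw x by rewrite -hw E.
have [c [y [hc vel]]] := velocity hab huv.
have d0 : (0 < d)%N by apply: leq_ltn_trans hkd.
have dk0 : (0 < d - k)%N by rewrite subn_gt0.
have [h1 vz] := vel _ _ _ _ d0 ez; have [h2 vw] := vel _ _ _ _ dk0 ew.
rewrite hz in vz; rewrite hw in vw.
have zw := wronskian_chart dk0 hc (size_pw x j0) (size_pw x j1) (vw j0) (vw j1).
have vz0 := vz (lshift _ 0); have vzr j := vz (rshift _ j).
have eF : pz x 0 (lshift M 0) = pp x 0 0 by rewrite /pz row_mxEl.
have eR j : pz x 0 (rshift _ j) = pe x * pw x 0 j by rewrite /pz row_mxEr mxE.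
have sz j : (size (pe x * pw x 0%R j)%R <= d.+1)%N.
  by rewrite -eR; apply: size_pz.
have sG : (size (pe x * (pw x 0%R j0 + pw x 0%R j1))%R <= d.+1)%N.
  rewrite mulrDr; apply: (leq_trans (size_polyD _ _)).
  by rewrite geq_max !sz.
have dF : (ch c d (pp x 0 0))^`().[y] = h1 * (ch c d (pp x 0 0)).[y].
  by rewrite -eF vz0.
have dG : (ch c d (pe x * (pw x 0 j0 + pw x 0 j1)))^`().[y] =
    h1 * (ch c d (pe x * (pw x 0 j0 + pw x 0 j1))).[y].
  by rewrite mulrDr chD derivD !hornerD -!eR !vzr mulrDr.
have zz := wronskian_chart d0 hc (size_pp x 0) sG dF dG.
by case: hco => g1 g2; case: (c) zw zz => z1 z2; [apply: (g1 y) | apply: g2].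
Qed.

Lemma form_w_open : fa_poly (@openfun K r s d k) form_w.
Proof.
have hA := @openfun_alg K r s d k.
have h0 := @pw_open K r s d k 0 j0; have h1 := @pw_open K r s d k 0 j1.
apply: (fa_poly_add hA); first by apply: (fa_poly_mul hA) => //; apply: fa_poly_deriv.
by apply: (fa_poly_opp hA); apply: (fa_poly_mul hA) => //; apply: fa_poly_deriv.
Qed.

Lemma form_z_open : fa_poly (@openfun K r s d k) form_z.
Proof.
have hA := @openfun_alg K r s d k.
have h0 := @pp_open K r s d k 0 0.
have h1 : fa_poly (@openfun K r s d k)
    (fun x => pe x * (pw x 0 j0 + pw x 0 j1)).
  apply: (fa_poly_mul hA); first exact: pe_open.
  by apply: (fa_poly_add hA); apply: pw_open.
apply: (fa_poly_add hA); first by apply: (fa_poly_mul hA) => //; apply: fa_poly_deriv.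
by apply: (fa_poly_opp hA); apply: (fa_poly_mul hA) => //; apply: fa_poly_deriv.
Qed.

Let d0 : (0 < d)%N. Proof. exact: leq_ltn_trans hkd. Qed.
Let dk0 : (0 < d - k)%N. Proof. by rewrite subn_gt0. Qed.

Lemma size_form_w x : (size (form_w x) <= (d - k).-1.*2.+1)%N.
Proof.
rewrite -addnn; apply: size_wronskian; rewrite prednK //; apply: size_pw.
Qed.

Lemma size_form_z x : (size (form_z x) <= d.-1.*2.+1)%N.
Proof.
rewrite -addnn; apply: size_wronskian; rewrite prednK //; first exact: size_pp.
have eR j : pz x 0 (rshift _ j) = pe x * pw x 0 j by rewrite /pz row_mxEr mxE.
rewrite mulrDr; apply: (leq_trans (size_polyD _ _)).
by rewrite -!eR geq_max !size_pz.
Qed.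

Hypothesis charK : 2%N \in [pchar K].

(** For w = (1, t^n) or (1, t^n + t), e = (t - 1)^k, p = (t + c t^(d-1), 0), the map w
    ramifies at most at 0 and at infinity, where z does not. *)
Lemma unramified_example : exists x : par,
  [/\ valid x, form_w x != 0 &
      coprime_forms (d - k).-1.*2 d.-1.*2 (form_w x) (form_z x)].
Proof.
have c2 : 2%:R = 0 :> {poly K} by rewrite -polyC_natr (pcharf0 charK).
have c2K : 2%:R = 0 :> K by rewrite (pcharf0 charK).
have [c hc] : exists c : K, (c != 0) && (1 + c != 0).
  have : ('X * ('X - (-1)%:P) : {poly K}) != 0.
    by rewrite mulf_neq0 ?polyX_eq0 ?polyXsubC_eq0.
  move=> /exists_nonroot[c]; rewrite hornerM hornerX hornerXsubC opprK addrC.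
  by rewrite mulf_eq0 negb_or addrC => h; exists c; rewrite [1 + c]addrC.
move/andP: hc => [c0 c1].
set n := (d - k)%N.
pose p0 : {poly K} := 'X + c *: 'X^(d.-1).
pose e : {poly K} := ('X - 1%:P) ^+ k.
pose w1 : {poly K} := 'X^n + (if odd n then 0 else 'X).
pose p : 'rV[{poly K}]_s.+1 := \row_i (if i == 0 then p0 else 0).
pose w : 'rV[{poly K}]_M := \row_j (if j == j0 then 1 else if j == j1 then w1 else 0).
have sp0 : (size p0 <= d.+1)%N.
  apply: (leq_trans (size_polyD _ _)); rewrite geq_max size_polyX ltnS d0 /=.
  by apply: (leq_trans (size_scale_leq _ _)); rewrite size_polyXn; lia.
have se : size e = k.+1 by rewrite /e size_exp_XsubC.
have sw1 : (size w1 <= n.+1)%N.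
  apply: (leq_trans (size_polyD _ _)); rewrite geq_max size_polyXn leqnn /=.
  by case: (odd n); rewrite ?size_poly0 // size_polyX ltnS.
have topw1 : w1`_n = 1.
  rewrite coefD coefXn eqxx; case: ifP => on; rewrite ?coef0 ?addr0 //.
  rewrite coefX; case: eqP => [n1|_]; last by rewrite addr0.
  by rewrite n1 in on.
have tope : e`_k = 1.
  have : e \is monic.
    by rewrite monic_exp // monicXsubC.
  by rewrite monicE /lead_coef se => /eqP.
have sp i : (size (p 0%R i) <= d.+1)%N.
  by rewrite mxE; case: ifP => _; rewrite ?size_poly0.
have j10 : (j1 == j0) = false by rewrite -val_eqE.
have w0E : w 0 j0 = 1 by rewrite mxE eqxx.
have w1E : w 0 j1 = w1 by rewrite mxE j10 eqxx.
have sw i : (size (w 0%R i) <= (d - k).+1)%N.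
  by rewrite mxE; case: ifP => _; [rewrite size_poly1|case: ifP => _; rewrite ?size_poly0].
have [ep ee ew] := @par_ofE K r s d k p e w sp (eq_leq se) sw.
exists (par_of d k p e w); set x := par_of d k p e w in ep ee ew *.
have pz0 : pz x 0 (lshift M 0) = p0 by rewrite /pz row_mxEl ep mxE eqxx.
have pzr j : pz x 0 (rshift _ j) = e * w 0 j by rewrite /pz row_mxEr mxE ee ew.
have p0top : (1 < d)%N -> p0`_d = 0 /\ p0`_d.-1 != 0.
  move=> d1; split.
    rewrite coefD coefZ coefX coefXn (gtn_eqF d1) (_ : (d == d.-1)%N = false).
      by rewrite mulr0 addr0.
    by apply/eqP; lia.
  rewrite coefD coefZ coefX coefXn eqxx mulr1.
  by case: (d.-1 =P 1)%N => _; rewrite ?add0r.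
have p01 : p0.[1] = 1 + c by rewrite hornerD hornerX hornerZ hornerXn expr1n mulr1.
have etop j : (e * w 0 j)`_d = (w 0 j)`_n.
  by rewrite -{1}(subnKC hkd') coef_lead ?se // tope mul1r.
have w1n : odd n -> w1 = 'X^n by rewrite /w1 => ->; rewrite addr0.
have fw : form_w x = if odd n then 'X^(n.-1) else 1.
  rewrite /form_w ew w0E w1E /wronskian (derivC 1) mul0r subr0 mul1r /w1 derivD derivXn.
  have n2 : n%:R = (odd n)%:R :> {poly K}.
    by rewrite -{1}[n]odd_double_half natrD -muln2 natrM c2 mulr0 addr0.
  rewrite -mulr_natr n2; case: (odd n); rewrite ?mulr1 ?mulr0 ?deriv0 ?addr0 //.
  by rewrite derivX add0r.
split.
- split; split=> [b|]; apply/rV0Pn.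
  + have [->|b1] := eqVneq b 1.
      by exists (lshift M 0); rewrite mxE pz0 /horner_eval p01.
    exists (rshift _ j0); rewrite mxE pzr w0E mulr1 /horner_eval /e horner_exp.
    by rewrite expf_neq0 // hornerXsubC subr_eq0.
  + by exists (rshift _ j1); rewrite mxE pzr etop w1E topw1 oner_eq0.
  + by exists j0; rewrite mxE ew w0E /horner_eval hornerC oner_eq0.
  + by exists j1; rewrite mxE ew w1E topw1 oner_eq0.
- by rewrite fw; case: (odd n); rewrite ?polyXn_eq0 ?oner_eq0 // -size_poly_eq0
    size_polyXn.
rewrite fw; split=> [b|].
- case: ifP => on; last by rewrite hornerC => /eqP; rewrite oner_eq0.
  rewrite hornerXn => /eqP; rewrite expf_eq0 => /andP[n1 /eqP ->].
  have dn : (n <= d)%N by apply: leq_subr.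
  have n3 : (2 < n)%N by move: on n1; case: (n) => [|[|[|]]].
  rewrite /form_z ep ee ew w0E w1E mxE eqxx /wronskian hornerD hornerN !hornerM.
  have -> : p0.[0] = 0.
    by rewrite hornerD hornerX hornerZ hornerXn expr0n; case: (d) n3 dn => [|[|?]];
      rewrite //= ?mulr0 ?addr0 //; lia.
  have -> : p0^`().[0] = 1.
    rewrite derivD derivX derivZ derivXn hornerD hornerZ hornerC hornerMn hornerXn.
    rewrite expr0n; have -> : (d.-1.-1 == 0)%N = false by lia.
    by rewrite mul0rn mulr0 addr0.
  have -> : (1 + w1).[0] = 1.
    by rewrite w1n // hornerD hornerC hornerXn expr0n; case: (n) n3 => // l _;
      rewrite addr0.
  rewrite /e horner_exp hornerXsubC sub0r mul0r sub0r mulr1 mul1r.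
  by move=> /eqP; rewrite oppr_eq0 expf_eq0 oppr_eq0 oner_eq0 andbF.
have [n1|n1] := leqP n 1.
  have -> : n = 1%N by apply/eqP; rewrite eqn_leq n1.
  by rewrite /= coefXn /= => /eqP; rewrite oner_eq0.
move=> _.
have d1 : (1 < d)%N by apply: leq_trans n1 (leq_subr _ _).
have [pd pd1] := p0top d1.
rewrite /form_z ep ee ew w0E w1E mxE eqxx -addnn.
have s1 : (size (1 + w1)%R <= n.+1)%N.
  by apply: (leq_trans (size_polyD _ _)); rewrite geq_max size_poly1.
have sg : (size (e * (1 + w1))%R <= d.-1.+2)%N.
  rewrite prednK // -{1}(subnKC hkd'); apply: size_mul_bound => //.
  by rewrite se.
rewrite wronskian_top; [|by rewrite prednK|exact: sg].
rewrite prednK // pd mul0r subr0 => /eqP; rewrite mulf_eq0 (negbTE pd1) /=.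
rewrite -{1}(subnKC hkd') coef_lead ?se // tope mul1r coefD topw1 coef1.
by rewrite gtn_eqF ?(ltnW n1) // add0r oner_eq0.
Qed.

Lemma unramified_general : general (fun f : map_X => unramified f).
Proof.
have [x [hx fx0 hco]] := unramified_example.
have [H [oH H0 hH]] := coprime_forms_open (@openfun_alg K r s d k) form_w_open
  form_z_open size_form_w size_form_z fx0 hco.
apply: (general_of_open (hkd := hkd') oH H0); first by exists x.
by move=> f /hH; apply: unramified_of_forms.
Qed.

Lemma valid_exists : exists x : par, valid x.
Proof. by have [x [hx _ _]] := unramified_example; exists x. Qed.
End Unramified.

(** * Splitting types are open *)

Lemma iso_split_perm (K : fieldType) (N : qsheaf K) (a b : seq int) :
  perm_eq a b -> iso_split N a -> iso_split N b.
Proof.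
rewrite perm_sym => hab [phi hphi].
have hsz := perm_size hab.
have [Is hIs bE] := perm_iotaP 0 hab.
have sIs : size Is = size b by rewrite bE size_map.
have Ia (j : 'I_(size b)) : (nth 0%N Is j < size a)%N.
  have : nth 0%N Is j \in Is by rewrite mem_nth // sIs.
  by rewrite (perm_mem hIs) mem_iota.
pose sg (j : 'I_(size b)) : 'I_(size a) := Ordinal (Ia j).
have bsg (j : 'I_(size b)) : b`_j = a`_(sg j).
  by rewrite {1}bE (nth_map 0%N) ?sIs.
have inj : injective sg.
  move=> i j /(congr1 val) /= /eqP; rewrite nth_uniq ?sIs // => [/eqP /val_inj //|].
  by rewrite (perm_uniq hIs) iota_uniq.
have bij : bijective sg.
  apply: inj_card_bij => //; by rewrite !card_ord hsz.
have [gs gsK sgK] := bij.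
exists (\matrix_(i, j) phi i (sg j)) => c; have [h1 h2 h3] := hphi c.
have vE v j : (v *m \matrix_(i, j) phi i (sg j)) 0 j = (v *m phi) 0 (sg j).
  by rewrite !mxE; apply: eq_bigr => i _; rewrite mxE.
split.
- by move=> v hv j; rewrite vE bsg; apply: h1.
- move=> x hx; have [|v hv vx] := h2 (\row_j x 0 (gs j)).
    by move=> j; rewrite mxE -{1}[j]sgK -bsg; apply: hx.
  by exists v => //; apply/rowP => j; rewrite vE vx mxE gsK.
- move=> v hv; rewrite -h3 //; split=> [h|h]; apply/rowP => j.
    by move/rowP: h => /(_ (gs j)); rewrite vE sgK !mxE.
  by rewrite vE h !mxE.
Qed.

Section ConormalSystem.
Variables (K : closedFieldType) (s M d k : nat).
Hypothesis charK : 2%N \in [pchar K].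
Hypothesis hkd : (k <= d)%N.
Notation N := (s.+1 + (1 + M))%N.
Notation wt := (@wt s.+1 M d k).

Lemma sum_wt : (\sum_i wt i = d * s.+1 + (k + (d - k) * M))%N.
Proof.
rewrite big_split_ord big_split_ord big_ord1 /=; congr (_ + (_ + _))%N.
- by rewrite (eq_bigr (fun=> d)) => [|i _]; rewrite ?wt_l // sum_nat_const card_ord mulnC.
- exact: wt_rl.
- by rewrite (eq_bigr (fun=> (d - k)%N)) => [|i _]; rewrite ?wt_rr // sum_nat_const
    card_ord mulnC.
Qed.

(** Numbers of coefficients of the unknowns and of the equations for sections of the
    conormal bundle twisted by n. The third equation has degree n - 1, but its top
    coefficient is not counted. *)
Definition secsz n (i : 'I_N) := (n - wt i).+1.
Definition eqsz n (i : 'I_(1 + (1 + 1))) : nat :=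
  match split i with
  | inl _ => n.+1
  | inr j => match split j with inl _ => n.+1 | inr _ => n.-1 end
  end.

Lemma eqsz0 n i : eqsz n (lshift _ i) = n.+1.
Proof. by rewrite /eqsz (unsplitK (inl i)). Qed.
Lemma eqsz1 n i : eqsz n (rshift _ (lshift _ i)) = n.+1.
Proof. by rewrite /eqsz (unsplitK (inr _)) (unsplitK (inl i)). Qed.
Lemma eqsz2 n i : eqsz n (rshift _ (rshift _ i)) = n.-1.
Proof. by rewrite /eqsz (unsplitK (inr _)) (unsplitK (inr i)). Qed.

Lemma sum_eqsz n : (0 < n)%N -> (\sum_i eqsz n i = 3 * n + 1)%N.
Proof.
clear charK hkd => n0.
rewrite big_split_ord big_split_ord !big_ord1 /= eqsz0 eqsz1 eqsz2; lia.
Qed.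

Lemma sum_secsz n : (d <= n)%N ->
  (\sum_i secsz n i + \sum_i wt i = n.+1 * N)%N.
Proof.
move=> dn; rewrite -big_split /= (eq_bigr (fun=> n.+1)) => [|i _].
  by rewrite sum_nat_const card_ord mulnC.
by rewrite /secsz addSn subnK // (leq_trans (wt_le i hkd)).
Qed.

Variables (p : 'rV[{poly K}]_s.+1) (e : {poly K}) (w : 'rV[{poly K}]_M).
Hypothesis hp : forall i, (size (p 0%R i) <= d.+1)%N.
Hypothesis he : (size e <= k.+1)%N.
Hypothesis hw : forall i, (size (w 0%R i) <= (d - k).+1)%N.

(** By the Euler relation, the top coefficient of the third equation is a combination of
    those of the other two. *)
Lemma coef_system_Tmx n (v : 'cV[{poly K}]_N) : (d <= n)%N -> (0 < n)%N ->
  sized (secsz n) v -> coef_system 1 (eqsz n) (Tmx p e w) v <-> Tmx p e w *m v = 0.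
Proof.
move=> dn n0 hv.
have hid : map_mx (comp_poly 'X^1) v = v.
  by apply/matrixP => i j; rewrite mxE expr1 comp_polyXr.
rewrite /coef_system hid; split=> [h|-> i b _]; last by rewrite mxE coef0.
have kn : (k <= n)%N by apply: leq_trans dn.
have dkn : (d - k <= n)%N by apply: leq_trans (leq_subr _ _) dn.
have sx i : (size (xpart v i 0%R) <= (n - d).+1)%N.
  by have := hv (lshift _ i); rewrite /secsz wt_l mxE.
have sy i : (size (ypart v i 0%R) <= (n - k).+1)%N.
  by have := hv (rshift _ (lshift _ i)); rewrite /secsz wt_rl !mxE.
have su i : (size (upart v i 0%R) <= (n - (d - k)).+1)%N.
  by have := hv (rshift _ (rshift _ i)); rewrite /secsz wt_rr !mxE.
have szm m (f g : {poly K}) : (m <= n)%N -> (size f <= m.+1)%N ->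
    (size g <= (n - m).+1)%N -> (size (f * g)%R <= n.+1)%N.
  by move=> mn hf hg; rewrite -(subnKC mn); apply: size_mul_bound.
have szsum m l (f : 'rV[{poly K}]_l) (g : 'cV[{poly K}]_l) : (m <= n)%N ->
    (forall i, (size (f 0%R i) <= m.+1)%N) ->
    (forall i, (size (g i 0%R) <= (n - m).+1)%N) ->
    (size ((f *m g) 0%R 0%R) <= n.+1)%N.
  move=> mn hf hg; rewrite mxE; apply: (leq_trans (size_sum _ _ _)).
  by apply/bigmax_leqP => i _; apply: (szm m).
rewrite Tmx_mul in h.
pose X := (p *m xpart v) 0 0; pose Y := e * ypart v 0 0.
pose U := (w *m upart v) 0 0.
have sX : (size X <= n.+1)%N by apply: (szsum d).
have sY : (size Y <= n.+1)%N by apply: (szm k).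
have sU : (size U <= n.+1)%N by apply: (szsum (d - k)%N).
have e1 : X + Y = 0.
  apply/polyP => b; rewrite coef0; case: (ltnP b n.+1) => hb.
    have := h (lshift _ 0) b; rewrite eqsz0 => /(_ hb).
    by rewrite col_mxEu mxaddE mxscaleE.
  by rewrite coefD !nth_default ?addr0 ?(leq_trans _ hb).
have e2 : Y + U = 0.
  apply/polyP => b; rewrite coef0; case: (ltnP b n.+1) => hb.
    have := h (rshift _ (lshift _ 0)) b; rewrite eqsz1 => /(_ hb).
    by rewrite col_mxEd col_mxEu mxaddE mxscaleE.
  by rewrite coefD !nth_default ?addr0 ?(leq_trans _ hb).
pose W3 := (map_mx deriv p *m xpart v) 0 0 + e^`() * ypart v 0 0
   + (map_mx deriv w *m upart v) 0 0.
have c2 : 2%:R = 0 :> K by rewrite (pcharf0 charK).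
have topm m (f g : {poly K}) : (m <= n)%N -> (size f <= m.+1)%N ->
    (size g <= (n - m).+1)%N -> ('X * (f^`() * g))`_n = (f * g)`_n *+ m.
  move=> mn hf hg; rewrite mulrA -(subnKC mn).
  rewrite !coef_lead // ?coefXderiv ?mulrnAl //.
  exact: size_Xderiv.
have topsum m l (f : 'rV[{poly K}]_l) (g : 'cV[{poly K}]_l) : (m <= n)%N ->
    (forall i, (size (f 0%R i) <= m.+1)%N) ->
    (forall i, (size (g i 0%R) <= (n - m).+1)%N) ->
    ('X * (map_mx deriv f *m g) 0 0)`_n = ((f *m g) 0 0)`_n *+ m.
  move=> mn hf hg; rewrite !mxE mulr_sumr !coef_sum -sumrMnl.
  by apply: eq_bigr => i _; rewrite mxE (topm m).
have e3top : W3`_n.-1 = 0.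
  have -> : W3`_n.-1 = ('X * W3)`_n by rewrite coefXM gtn_eqF.
  rewrite /W3 !mulrDr !coefD (topsum d) // (topm k) // (topsum (d - k)%N) //.
  rewrite -/X -/Y -/U.
  have -> : X = - Y by apply/eqP; rewrite -addr_eq0 e1.
  have -> : U = - Y by apply/eqP; rewrite -addr_eq0 addrC e2.
  rewrite coefN mulrnBr // -[RHS](mul0r (Y`_n *+ k - Y`_n *+ d)) -c2; ring.
have e3 : W3 = 0.
  apply/polyP => b; rewrite coef0; case: (ltnP b n.-1) => hb.
    have := h (rshift _ (rshift _ 0)) b; rewrite eqsz2 => /(_ hb).
    by rewrite !col_mxEd !mxaddE mxscaleE.
  move: hb; rewrite leq_eqVlt => /orP[/eqP <- //|hb].
  rewrite nth_default //; apply: (leq_trans _ hb); rewrite prednK //.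
  have ar a b' m : (m <= n -> a <= m -> b' <= (n - m).+1 -> (a + b').-1 <= n)%N.
    by lia.
  have szd m l (f : 'rV[{poly K}]_l) (g : 'cV[{poly K}]_l) : (m <= n)%N ->
      (forall i, (size (f 0%R i) <= m.+1)%N) ->
      (forall i, (size (g i 0%R) <= (n - m).+1)%N) ->
      (size ((map_mx deriv f *m g) 0%R 0%R) <= n)%N.
    move=> mn hf hg; rewrite mxE; apply: (leq_trans (size_sum _ _ _)).
    apply/bigmax_leqP => i _; rewrite mxE.
    apply: (leq_trans (size_polyMleq _ _)).
    by apply: (ar _ _ m) => //; apply: size_deriv_le.
  rewrite /W3; apply: (leq_trans (size_polyD _ _)); rewrite geq_max.
  rewrite (szd (d - k)%N) // andbT; apply: (leq_trans (size_polyD _ _)).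
  rewrite geq_max (szd d) //=; apply: (leq_trans (size_polyMleq _ _)).
  by apply: (ar _ _ k) => //; apply: size_deriv_le.
rewrite Tmx_mul; apply/colP => i; rewrite [RHS]mxE.
rewrite -(splitK i); case: (split i) => a /=; first by rewrite col_mxEu (ord1 a) mxaddE mxscaleE.
rewrite col_mxEd -(splitK a); case: (split a) => b /=.
  by rewrite col_mxEu (ord1 b) mxaddE mxscaleE.
by rewrite col_mxEd (ord1 b) !mxaddE mxscaleE.
Qed.
End ConormalSystem.

Section FullRank.
Variables (K : closedFieldType) (s M d k R : nat).
Hypothesis hkd : (k <= d)%N.
Notation N := (s.+1 + (1 + M))%N.
Notation wt := (@wt s.+1 M d k).
Notation "M .@ b" := (map_mx (horner_eval b) M) (at level 2, format "M .@ b").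

Variables (p : 'rV[{poly K}]_s.+1) (e : {poly K}) (w : 'rV[{poly K}]_M).
Variables (a : 'I_R -> nat) (n : nat).
Hypothesis ha : forall j, (d <= a j)%N.
Hypothesis han : forall j, (a j <= n)%N.
Variable S : 'M[{poly K}]_(N, R).
Hypothesis hS : forall i j, (size (S i j) <= (a j - wt i).+1)%N.
Hypothesis TS : Tmx p e w *m S = 0.
Hypothesis span : forall v, sized (secsz d k n) v -> Tmx p e w *m v = 0 ->
  exists2 q, sized (fun j => (n.+1 - a j)%N) q & v = S *m q.
Hypothesis indep : forall q, sized (fun j => (n.+2 - a j)%N) q -> S *m q = 0 -> q = 0.

Let hwa i j : (wt i <= a j)%N. Proof. exact: leq_trans (wt_le i hkd) (ha j). Qed.

Lemma sizedW q : sized (fun j => (n.+1 - a j)%N) q ->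
  sized (K := K) (fun j => (n.+2 - a j)%N) q.
Proof. by move=> hq j; apply: (leq_trans (hq j)); apply: leq_sub2r. Qed.

Lemma sizedB q1 q2 : sized (fun j => (n.+2 - a j)%N) q1 ->
  sized (fun j => (n.+2 - a j)%N) q2 ->
  sized (K := K) (fun j => (n.+2 - a j)%N) (q1 - q2).
Proof.
move=> h1 h2 j; rewrite mxaddE mxoppE; apply: (leq_trans (size_polyD _ _)).
by rewrite size_polyN geq_max h1 h2.
Qed.

(** If a combination of the columns vanishes at a point, dividing it by the equation
    of the point gives a section that is not in their span. *)
Lemma full_rank_affine b : row_free (S.@b)^T.
Proof.
rewrite -kermx_eq0; apply/rowV0P => c /sub_kermxP hc.
pose q0 : 'cV[{poly K}]_R := map_mx polyC c^T.
pose v := S *m q0.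
have hv i : v i 0 = (v i 0 %/ ('X - b%:P)) * ('X - b%:P).
  apply/esym/divpK; rewrite dvdp_XsubCl; apply/rootP.
  move/rowP: hc => /(_ i); rewrite [LHS]mxE [RHS]mxE => hc.
  rewrite mxE horner_sum -[RHS]hc; apply: eq_bigr => j _.
  by rewrite !mxE hornerM hornerC mulrC.
pose v1 := map_mx (fun f => f %/ ('X - b%:P)) v.
have vE : v = ('X - b%:P) *: v1.
  by apply/colP => i; rewrite [LHS]hv mxscaleE map_mxE' mulrC.
have Tv1 : Tmx p e w *m v1 = 0.
  have : ('X - b%:P) *: (Tmx p e w *m v1) == 0.
    by rewrite scalemxAr -vE /v mulmxA TS mul0mx.
  by rewrite scalemx_eq0 polyXsubC_eq0 => /eqP.
have sv i : (size (v i 0%R) <= secsz d k n i)%N.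
  rewrite mxE; apply: (leq_trans (size_sum _ _ _)); apply/bigmax_leqP => j _.
  rewrite !mxE mulrC mul_polyC; apply: (leq_trans (size_scale_leq _ _)).
  by apply: (leq_trans (hS i j)); rewrite ltnS leq_sub2r.
have [|q hq vq] := span _ Tv1.
  by move=> i; rewrite mxE; apply: (leq_trans (leq_divp _ _)); apply: sv.
have hq' : sized (fun j => (n.+2 - a j)%N) (('X - b%:P) *: q).
  move=> j; rewrite mxscaleE; apply: (leq_trans (size_polyMleq _ _)).
  rewrite size_XsubC /= subSn ?(leqW (han j)) // ltnS.
  by have := hq j; rewrite subSn // => h; apply: (leq_trans h); rewrite subSn.
have hq0 : sized (fun j => (n.+2 - a j)%N) q0.
  move=> j; rewrite mxE; apply: (leq_trans (size_polyC_leq1 _)).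
  by rewrite subn_gt0 ltnS (leq_trans (han j)).
have := indep (sizedB hq0 hq').
rewrite mulmxBr -scalemxAr -vq -vE subrr => /(_ erefl) /colP h.
apply/rowP => j; have := h j; rewrite mxaddE mxoppE mxscaleE !mxE.
move/(congr1 (fun f : {poly K} => f.[b])).
by rewrite !hornerE subrr mul0r subr0.
Qed.

(** A dependence between the leading coefficients gives a combination of multiples of the
    columns in degree n + 1 whose top coefficients vanish, so that it is also a
    combination of smaller multiples. *)
Lemma full_rank_infinity : row_free (\matrix_(i, j) (S i j)`_(a j - wt i))^T.
Proof.
rewrite -kermx_eq0; apply/rowV0P => c /sub_kermxP hc.
pose q0 : 'cV[{poly K}]_R := \col_j (c 0 j *: 'X^(n.+1 - a j)).
pose v := S *m q0.
have sv : sized (secsz d k n) v.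
  move=> i; apply/leq_sizeP => l; rewrite /secsz leq_eqVlt => /orP[/eqP <-|hl].
    rewrite mxE coef_sum; move/rowP: hc => /(_ i); rewrite [LHS]mxE [RHS]mxE.
    move=> hc; rewrite -[RHS]hc; apply: eq_bigr => j _.
    rewrite !mxE -scalerAr coefZ; congr (_ * _).
    have -> : (n - wt i).+1 = ((a j - wt i) + (n.+1 - a j))%N.
      by have := hwa i j; have := han j; lia.
    by rewrite coef_lead ?size_polyXn // coefXn eqxx mulr1.
  rewrite mxE coef_sum big1 // => j _; rewrite nth_default //.
  apply: leq_trans hl; rewrite mxE -scalerAr.
  apply: (leq_trans (size_scale_leq _ _)).
  have hX : (size ('X^(n.+1 - a j) : {poly K}) <= (n.+1 - a j).+1)%N.
    by rewrite size_polyXn.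
  apply: (leq_trans (size_mul_bound (hS i j) hX)).
  by have := hwa i j; have := han j; move: (a j) (wt i) => x y; lia.
have [|q hq vq] := span sv; first by rewrite /v mulmxA TS mul0mx.
have hq0 : sized (fun j => (n.+2 - a j)%N) q0.
  move=> j; rewrite mxE; apply: (leq_trans (size_scale_leq _ _)).
  by rewrite size_polyXn; have := han j; move: (a j) => x; lia.
have := indep (sizedB hq0 (sizedW hq)); rewrite mulmxBr -vq subrr => /(_ erefl).
move=> /colP h; apply/rowP => j; have := h j; rewrite mxaddE mxoppE !mxE.
move/(congr1 (fun f : {poly K} => f`_(n.+1 - a j))).
by rewrite coefB coefZ coefXn eqxx mulr1 coef0 nth_default ?subr0.
Qed.
End FullRank.

Section SectionsGeneral.
Variables (K : closedFieldType) (r s d k : nat).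
Hypothesis charK : 2%N \in [pchar K].
Hypothesis hkd : (k < d)%N.
Hypothesis hsr : (s + 2 <= r)%N.
Notation M := (r - s)%N.
Notation N := (s.+1 + (1 + M))%N.
Notation map_X := (map_X K r s d k).
Notation par := (par K r s d k).
Notation openfun := (@openfun K r s d k).

Definition Tpar (x : par) := Tmx (pp x) (pe x) (pw x).

Lemma Tpar_open : fa_pmx openfun Tpar.
Proof.
have hA := @openfun_alg K r s d k.
have hd n m (A : par -> 'M_(n, m)) :
    fa_pmx openfun A -> fa_pmx openfun (fun x => map_mx deriv (A x)).
  by move=> h; apply: (fa_pmx_map hA) => // q hq; apply: (fa_poly_deriv hA).
have hp := @pp_open K r s d k; have he := @pe_open K r s d k.
have hw := @pw_open K r s d k.
apply: (fa_pmx_col hA).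
  apply: (fa_pmx_row hA) => //; apply: (fa_pmx_row hA).
    exact: (fa_pmx_scalar hA).
  exact: fa_pmx_cst.
apply: (fa_pmx_col hA).
  apply: (fa_pmx_row hA); first exact: fa_pmx_cst.
  by apply: (fa_pmx_row hA) => //; apply: (fa_pmx_scalar hA).
apply: (fa_pmx_row hA); first exact: hd.
apply: (fa_pmx_row hA); last exact: hd.
by apply: (fa_pmx_scalar hA); apply: (fa_poly_deriv hA).
Qed.

Variable a : seq nat.
Notation R := (size (map Posz a)).
Notation aj := (nth 0%N a).
Hypothesis ha : forall j : 'I_R, (d <= aj j)%N.
Hypothesis hR : (3 + R = N)%N.
Hypothesis hsum : (\sum_(j < R) aj j + 2 = d * s.+1 + (k + (d - k) * M))%N.
Variable S : par -> 'M[{poly K}]_(N, R).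
Hypothesis oS : fa_pmx openfun S.
Hypothesis hS : forall x i j, (size (S x i j) <= (aj j - wt d k i).+1)%N.
Hypothesis TS : forall x, Tpar x *m S x = 0.
Variable x0 : par.
Hypothesis span0 : forall n v, (d <= n)%N -> sized (secsz d k n) v ->
  Tpar x0 *m v = 0 ->
  exists2 q, sized (fun j : 'I_R => (n.+1 - aj j)%N) q & v = S x0 *m q.
Hypothesis indep0 : forall q : 'cV_R, S x0 *m q = 0 -> q = 0.

(** The columns of S(x) split the normal bundle of the map x for x near x0: the
    conormal sections of a large degree n are solutions of a linear system that is
    surjective at x0, hence near x0, and they have the same basis as at x0. *)
Theorem sections_general : general (fun f : map_X => unramified f ->
  iso_split (normal_bundle f) (map Posz a)).
Proof.
have hkd' := ltnW hkd.
have hA := @openfun_alg K r s d k.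
pose n := (\max_(j < R) aj j + d)%N.
have d0 : (0 < d)%N by apply: leq_ltn_trans hkd.
have dn : (d <= n)%N by apply: leq_addl.
have n0 : (0 < n)%N by apply: leq_trans dn.
have han (j : 'I_R) : (aj j <= n)%N.
  by apply: leq_trans (leq_addr _ _); apply: (leq_bigmax j).
pose ll m (j : 'I_R) := (m - aj j)%N.
have sll m : (n < m)%N -> (\sum_j ll m j + \sum_(j < R) aj j = R * m)%N.
  move=> nm; rewrite -big_split /= (eq_bigr (fun=> m)) => [|j _].
    by rewrite sum_nat_const card_ord.
  by rewrite subnK // (leq_trans (han j) (ltnW nm)).
have count : (\sum_j ll n.+1 j + \sum_i eqsz n i = \sum_i @secsz s M d k n i)%N.
  have h1 := sll n.+1 (ltnSn n); have h2 := @sum_secsz s M d k hkd' n dn.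
  have h3 := sum_eqsz n0; have h4 := sum_wt s M d k.
  have h5 : (n.+1 * N = 3 * n.+1 + R * n.+1)%N by rewrite -hR; ring.
  have ar A B C W W0 S0 R0 m X : (A + S0 = R0 -> B + W = X -> C = 3 * m + 1 ->
    W = W0 -> X = 3 * m.+1 + R0 -> S0 + 2 = W0 -> A + C = B)%N by lia.
  exact: ar h1 h2 h3 h4 h5 hsum.
have sz m x q : (n < m)%N -> sized (ll m) q -> sized (secsz d k m.-1) (S x *m q).
  move=> nm hq i; rewrite mxE; apply: (leq_trans (size_sum _ _ _)).
  apply/bigmax_leqP => j _; apply: (leq_trans (size_polyMleq _ _)).
  have ar u v A W m0 : (u <= (A - W).+1 -> v <= m0 - A -> A <= n -> n < m0 ->
    W <= A -> (u + v).-1 <= (m0.-1 - W).+1)%N by lia.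
  exact: ar (hS x i j) (hq j) (han j) nm (leq_trans (wt_le i hkd') (ha j)).
have full : row_full (sysmx 1 (secsz d k n) (eqsz n) (Tpar x0)).
  apply: (@sysmx_full _ _ _ _ _ _ _ (ll n.+1) _ (S x0)); last by rewrite count.
  move=> v hv hsys; apply: span0 => //.
  by move/(coef_system_Tmx charK hkd' (@size_pp _ _ _ _ _ x0) (size_pe x0)
    (@size_pw _ _ _ _ _ x0) dn n0 hv): hsys.
have [H1 [oH1 H1n hH1]] := row_full_persists hA
  (@sysmx_fa _ _ _ _ _ 1 (secsz d k n) (eqsz n) _ hA Tpar_open) full.
have free : row_free (multiples (secsz d k n.+1) (ll n.+2) (S x0)).
  apply/(multiples_free (fun q => @sz n.+2 x0 q (leqnSn _))) => q _.
  exact: indep0.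
have [H2 [oH2 H2n hH2]] := row_free_persists hA
  (@multiples_fa _ _ _ _ _ (secsz d k n.+1) (ll n.+2) _ hA oS) free.
apply: (@general_of_open K r s d k hkd' _ (fun x => H1 x * H2 x) x0).
- exact: (fa_mul hA).
- exact: mulf_neq0.
- exact: valid_exists.
move=> f; rewrite mulf_eq0 negb_or => /andP[/hH1 full1 /hH2 free1] hur.
set x := par_of_map hkd' f in full1 free1.
have [hz hw _] := par_of_mapP hkd' f.
have ind : forall q, sized (ll n.+2) q -> S x *m q = 0 -> q = 0.
  by apply/(multiples_free (fun q => @sz n.+2 x q (leqnSn _))).
have vT v (hv : sized (secsz d k n) v) := coef_system_Tmx charK hkd'
  (@size_pp _ _ _ _ _ x) (size_pe x) (@size_pw _ _ _ _ _ x) dn n0 hv.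
have sp : forall v, sized (secsz d k n) v -> Tpar x *m v = 0 ->
    exists2 q, sized (ll n.+1) q & v = S x *m q.
  move=> v hv Tv; apply: (sysmx_full_span full1) => //.
  - by rewrite count.
  - by move=> q; apply: sz.
  - move=> q hq; apply/vT; first exact: (@sz n.+1).
    by rewrite -/(Tpar x) mulmxA TS mul0mx.
  - move=> q hq; apply: ind => j; apply: (leq_trans (hq j)).
    by rewrite /ll leq_sub2r.
  - by apply/vT.
apply: (@iso_split_of_sections K charK r s d k f hkd' (pp x) (pe x) (pw x)
  (@size_pp _ _ _ _ _ x) (size_pe x) (@size_pw _ _ _ _ _ x) hz hw hur a hR ha
  (S x) (hS x) (TS x)).
- by move=> b; apply: (full_rank_affine han (hS x) (TS x) sp ind b).
- exact: (full_rank_infinity hkd' ha han (hS x) (TS x) sp ind).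
Qed.
End SectionsGeneral.

(** * Deforming sections *)

Notation sq := (comp_poly 'X^2).

Lemma deriv_sq (R : comNzRingType) (q : {poly R}) : 2%N \in [pchar R] ->
  (sq q)^`() = 0.
Proof. by move=> h2; rewrite deriv_comp derivXn -mulr_natr -polyC1 -polyCMn
  (pcharf0 h2) polyC0 !mulr0. Qed.

Lemma size_sq (R : idomainType) (q : {poly R}) n :
  (size q <= n.+1)%N -> (size (sq q) <= (2 * n).+1)%N.
Proof.
move=> hq; apply: (leq_trans (size_comp_poly_leq _ _)).
by rewrite size_polyXn /= ltnS mulnC leq_mul2l /=; case: (size q) hq.
Qed.

Lemma map_derivD (R : comNzRingType) n m (A B : 'M[{poly R}]_(n, m)) :
  map_mx deriv (A + B) = map_mx deriv A + map_mx deriv B.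
Proof. by apply/matrixP => i j; rewrite mxaddE !map_mxE' mxaddE derivD. Qed.

Lemma deriv_mul_sq (R : comNzRingType) n m (A : 'M[{poly R}]_(n, m)) l
    (B : 'M[{poly R}]_(m, l)) : 2%N \in [pchar R] ->
  map_mx deriv (A *m map_mx sq B) = map_mx deriv A *m map_mx sq B.
Proof.
move=> h2; apply/matrixP => i j; rewrite !mxE linear_sum; apply: eq_bigr => f _.
by rewrite !mxE /= derivM deriv_sq // mulr0 addr0.
Qed.

Lemma mxoppr2 (R : comNzRingType) n m (A : 'M[{poly R}]_(n, m)) :
  2%N \in [pchar R] -> A + A = 0.
Proof.
move=> h2; apply/matrixP => i j; rewrite mxaddE -mulr2n -mulr_natr -polyC1 -polyCMn.
by rewrite (pcharf0 h2) polyC0 mulr0 mxE.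
Qed.

Section Families.
Variables (K : closedFieldType) (r s d k : nat).
Hypothesis charK : 2%N \in [pchar K].
Hypothesis hkd : (k <= d)%N.
Notation M := (r - s)%N.
Notation N := (s.+1 + (1 + M))%N.
Notation par := (par K r s d k).
Notation openfun := (@openfun K r s d k).
Let hA := @openfun_alg K r s d k.

(** The coefficients of the family are in openfun, hence regular near the map x0 when x0
    is a map. *)
Definition extendable (x0 : par) n v0 := exists v : par -> 'cV[{poly K}]_N,
  [/\ fa_pmx openfun v, forall x, sized (secsz d k n) (v x),
      forall x, Tpar x *m v x = 0 & v x0 = v0].

Lemma secsz_intro n (x : 'cV[{poly K}]_s.+1) (y : 'M[{poly K}]_1)
    (u : 'cV[{poly K}]_M) :
  (forall i, (size (x i 0%R) <= (n - d).+1)%N) ->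
  (size (y 0%R 0%R) <= (n - k).+1)%N ->
  (forall i, (size (u i 0%R) <= (n - (d - k)).+1)%N) ->
  sized (secsz d k n) (col_mx x (col_mx y u)).
Proof.
move=> hx hy hu i; rewrite /secsz -(splitK i); case: (split i) => j /=.
  by rewrite wt_l col_mxEu.
rewrite col_mxEd -(splitK j); case: (split j) => l /=.
  by rewrite wt_rl col_mxEu (ord1 l).
by rewrite wt_rr col_mxEd.
Qed.

Variables (R : nat) (hR : (3 + R = N)%N) (nu de : 'I_R -> nat).
Notation al j := (d + nu j + 2 * de j)%N.
Hypothesis sum_nu : (\sum_j nu j = k * (M - 1))%N.
Hypothesis sum_de : (\sum_j de j + k * (M - 1) + 1 = d)%N.
Hypothesis hM : (0 < M)%N.

Lemma sum_al : (\sum_j al j + 2 = d * s.+1 + (k + (d - k) * M))%N.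
Proof.
have -> : (\sum_j al j = R * d + \sum_j nu j + 2 * \sum_j de j)%N.
  by rewrite big_distrr /= !big_split /= sum_nat_const card_ord.
rewrite sum_nu.
move: sum_de hkd hR hM; set D := (\sum_j de j)%N; clear.
move: (r - s)%N => m hD hkd; case: m hD => // m; rewrite subSS subn0 => hD hR _.
have -> : R = (s + m)%N by lia.
have [c dE] : exists c, d = (k + c)%N by exists (d - k)%N; rewrite subnKC.
by rewrite dE addKn; rewrite dE in hD; nia.
Qed.

Lemma sum_trunc (c : 'I_R -> nat) n : (forall j, c j <= n)%N ->
  (\sum_j (n - c j) + \sum_j c j = R * n)%N.
Proof.
move=> h; rewrite -big_split /= (eq_bigr (fun=> n)) => [|j _].
  by rewrite sum_nat_const card_ord.
by rewrite subnK.
Qed.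

Variable x0 : par.
Variable S0 : 'M[{poly K}]_(N, R).

(** By a dimension count, the system that defines the sections of degree n is surjective
    at x0 when the basis S0 has no section of degree above n + 1. *)
Lemma extendable_conormal n v0 : (d <= n)%N -> (0 < n)%N ->
  (forall j, al j <= n.+1)%N ->
  (forall v, sized (secsz d k n) v -> Tpar x0 *m v = 0 ->
     exists2 q, sized (fun j => (n.+1 - al j)%N) q & v = S0 *m q) ->
  sized (secsz d k n) v0 -> Tpar x0 *m v0 = 0 -> extendable x0 n v0.
Proof.
move=> dn n0 han span hv0 Tv0.
have vT (x : par) v (hv : sized (secsz d k n) v) := coef_system_Tmx charK hkd
  (@size_pp _ _ _ _ _ x) (size_pe x) (@size_pw _ _ _ _ _ x) dn n0 hv.
have full : row_full (sysmx 1 (secsz d k n) (eqsz n) (Tpar x0)).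
  apply: (@sysmx_full _ _ _ _ _ _ _ (fun j => n.+1 - al j)%N _ S0) => [v hv|].
    by move/(vT _ _ hv); apply: span.
  have h1 := sum_trunc han; have h2 := @sum_secsz s M d k hkd n dn.
  have h3 := sum_eqsz n0; have h4 := sum_wt s M d k; have h6 := sum_al.
  have h5 : (n.+1 * N = 3 * n.+1 + R * n.+1)%N by rewrite -hR; ring.
  have ar A B C W W0 S1 R0 m X : (A + S1 = R0 -> B + W = X -> C = 3 * m + 1 ->
    W = W0 -> X = 3 * m.+1 + R0 -> S1 + 2 = W0 -> A + C <= B)%N by lia.
  exact: ar h1 h2 h3 h4 h5 h6.
have [] := poly_solution_persists hA (@Tpar_open K r s d k) full hv0.
  exact/vT.
move=> v [ov hv sv vx0]; exists v; split=> // x.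
exact (proj1 (vT x _ (hv x)) (sv x)).
Qed.

Lemma fa_sq n m (A : par -> 'M[{poly K}]_(n, m)) :
  fa_pmx openfun A -> fa_pmx openfun (fun x => map_mx sq (A x)).
Proof. by move=> h; apply: (fa_pmx_map hA) => // q; apply: (fa_poly_comp hA). Qed.

Lemma coef_system1P st J m (A : 'M[{poly K}]_(1, m)) (v : 'cV_m) :
  (size ((A *m map_mx (comp_poly 'X^st) v) 0%R 0%R) <= J)%N ->
  coef_system st (fun=> J) A v -> A *m map_mx (comp_poly 'X^st) v = 0.
Proof.
move=> hs hv; apply/matrixP => i j; rewrite !ord1 [RHS]mxE; apply/polyP => b.
rewrite coef0; case: (ltnP b J) => hb; first exact: hv.
by rewrite nth_default // (leq_trans hs).
Qed.

(** The section given by a relation X(t^2) between the coordinates of z = (p, e w). *)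
Definition relation_sec (x : par) (X : 'cV[{poly K}]_(s.+1 + M)) : 'cV[{poly K}]_N :=
  col_mx (map_mx sq (usubmx X))
    (col_mx (pw x *m map_mx sq (dsubmx X)) (pe x *: map_mx sq (dsubmx X))).

(** The third equation is the derivative of the relation, as X(t^2) is constant for it. *)
Lemma relation_secP x X : pz x *m map_mx sq X = 0 -> Tpar x *m relation_sec x X = 0.
Proof.
have z2 := @mxoppr2 K _ _ _ charK.
rewrite -{1}[X]vsubmxK map_col_mx mul_row_col -scalemxAl => h.
apply/Tmx0P; rewrite /xpart /ypart /upart /relation_sec col_mxKu col_mxKd col_mxKu col_mxKd.
split=> //; first by rewrite -scalemxAr z2.
have /(congr1 (map_mx deriv)) := h.
rewrite map_mx0 => {}h; rewrite -[RHS]h. rewrite map_derivD deriv_mul_sq // -addrA; congr (_ + _).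
rewrite [in RHS]scalemxAl deriv_mul_sq // scalemxAl -scalemxAr scalemxAl -mulmxDl.
congr (_ *m _); apply/matrixP => i j.
by rewrite mxaddE !mxscaleE !map_mxE' mxscaleE derivM mulrC.
Qed.

Lemma size_row_sq m l e (f : 'rV[{poly K}]_l) (g : 'cV[{poly K}]_l) :
  (forall i, (size (f 0%R i) <= m.+1)%N) ->
  (forall i, (size (g i 0%R) <= e.+1)%N) ->
  (size ((f *m map_mx sq g) 0%R 0%R) <= (m + 2 * e).+1)%N.
Proof.
move=> hf hg; rewrite mxE; apply: (leq_trans (size_sum _ _ _)).
apply/bigmax_leqP => i _; rewrite map_mxE'; apply: size_mul_bound => //.
exact: size_sq.
Qed.

(** The relations in t^2 between the coordinates of z solve a single equation and have, at
    x0, generators of degrees nu + de in t^2; so the dimension count only asks for a bound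
    on these degrees. *)
Lemma extendable_relation_sec (Y : 'M[{poly K}]_(s.+1 + M, R)) e X0 :
  (forall j, nu j + de j <= e.+1)%N ->
  (forall X, sized (fun=> e.+1) X -> pz x0 *m map_mx sq X = 0 ->
     exists2 q, sized (fun j => e.+1 - (nu j + de j))%N q & X = Y *m q) ->
  sized (fun=> e.+1) X0 -> pz x0 *m map_mx sq X0 = 0 ->
  extendable x0 (d + 2 * e) (relation_sec x0 X0).
Proof.
move=> he span hX0 zX0.
have szz (x : par) X : sized (fun=> e.+1) X ->
    (size ((pz x *m map_mx sq X) 0%R 0%R) <= (d + 2 * e).+1)%N.
  by move=> hX; apply: size_row_sq => //; apply: size_pz.
have full : row_full (sysmx 2 (fun=> e.+1) (fun=> (d + 2 * e).+1) (pz x0)).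
  apply: (@sysmx_full _ _ _ _ _ _ _ (fun j => e.+1 - (nu j + de j))%N _ Y) => [v hv|].
    by move/(coef_system1P (szz x0 v hv)); apply: span.
  have := sum_trunc he; rewrite big_split /= sum_nu big_ord1 sum_nat_const card_ord.
  move: hR sum_de hM; move: (r - s)%N => m.
  move: (\sum_j (_ - _))%N (\sum_j de j)%N (k * _)%N => A B C h1 h2 _ h3.
  have -> : (s.+1 + m = R.+2)%N by lia.
  by rewrite (mulSn _ e.+1) (mulSn _ e.+1) -h3; lia.
have [] := poly_solution_persists hA (@pz_open K r s d k) full hX0.
  by move=> i b _; rewrite zX0 mxE coef0.
move=> X [oX hX sX Xx0]; exists (fun x => relation_sec x (X x)); split; last by rewrite Xx0.
- apply: (fa_pmx_col hA); first by apply: fa_sq; apply: (fa_pmx_usub).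
  apply: (fa_pmx_col hA).
    apply: (fa_pmx_mul hA); first exact: pw_open.
    by apply: fa_sq; apply: fa_pmx_dsub.
  apply: (fa_pmx_scale hA); first exact: pe_open.
  by apply: fa_sq; apply: fa_pmx_dsub.
- have hd x i : (size (dsubmx (X x) i 0%R) <= e.+1)%N by rewrite mxE; apply: hX.
  move=> x; apply: secsz_intro => [i||i].
  + rewrite map_mxE' addKn; apply: size_sq; rewrite mxE; exact: hX.
  + have -> : (d + 2 * e - k = (d - k) + 2 * e)%N by rewrite addnBAC.
    by apply: size_row_sq => //; apply: size_pw.
  + have -> : (d + 2 * e - (d - k) = k + 2 * e)%N.
      by move: hkd; clear; lia.
    rewrite mxscaleE map_mxE'; apply: size_mul_bound; first exact: size_pe.
    exact: size_sq.
- by move=> x; apply: relation_secP; apply: coef_system1P (szz x _ (hX x)) (sX x).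
Qed.

(** The section given by a relation X(t^2) between e p and w. *)
Definition corelation_sec (x : par) (X : 'cV[{poly K}]_(s.+1 + M)) : 'cV[{poly K}]_N :=
  col_mx (pe x *: map_mx sq (usubmx X))
    (col_mx (pp x *m map_mx sq (usubmx X)) (map_mx sq (dsubmx X))).
Definition prow (x : par) : 'rV[{poly K}]_(s.+1 + M) := row_mx (pe x *: pp x) (pw x).

Lemma corelation_secP x X : prow x *m map_mx sq X = 0 -> Tpar x *m corelation_sec x X = 0.
Proof.
have z2 := @mxoppr2 K _ _ _ charK.
rewrite -{1}[X]vsubmxK map_col_mx mul_row_col -scalemxAl => h.
apply/Tmx0P; rewrite /xpart /ypart /upart /corelation_sec col_mxKu col_mxKd col_mxKu col_mxKd.
split=> //; first by rewrite -scalemxAr z2.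
have /(congr1 (map_mx deriv)) := h.
rewrite map_mx0 => {}h; rewrite -[RHS]h map_derivD deriv_mul_sq //; congr (_ + _).
rewrite [in RHS]scalemxAl deriv_mul_sq // scalemxAl -scalemxAr scalemxAl -mulmxDl.
congr (_ *m _); apply/matrixP => i j.
by rewrite mxaddE !mxscaleE !map_mxE' mxscaleE derivM addrC mulrC.
Qed.

Definition dsz e (i : 'I_(s.+1 + M)) : nat :=
  match split i with inl _ => e.+1 | inr _ => (e + k).+1 end.

Lemma dszl e i : dsz e (lshift _ i) = e.+1.
Proof. by rewrite /dsz (unsplitK (inl i)). Qed.
Lemma dszr e i : dsz e (rshift _ i) = (e + k).+1.
Proof. by rewrite /dsz (unsplitK (inr i)). Qed.

Lemma sum_dsz e : (\sum_i dsz e i = s.+1 * e.+1 + M * (e + k).+1)%N.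
Proof.
rewrite big_split_ord /= (eq_bigr (fun=> e.+1)) => [|i _]; last exact: dszl.
rewrite [X in (_ + X)%N](eq_bigr (fun=> (e + k).+1)) => [|i _]; last exact: dszr.
by rewrite !sum_nat_const !card_ord.
Qed.

(** The same count for the relations between e p and w, with generators of degrees de. *)
Lemma extendable_corelation_sec (Y : 'M[{poly K}]_(s.+1 + M, R)) e X0 :
  (forall j, de j <= e.+1)%N ->
  (forall X, sized (dsz e) X -> prow x0 *m map_mx sq X = 0 ->
     exists2 q, sized (fun j => e.+1 - de j)%N q & X = Y *m q) ->
  sized (dsz e) X0 -> prow x0 *m map_mx sq X0 = 0 ->
  extendable x0 (d + k + 2 * e) (corelation_sec x0 X0).
Proof.
move=> he span hX0 zX0.
have hu X i : sized (dsz e) X -> (size (usubmx X i 0%R) <= e.+1)%N.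
  by move=> hX; have := hX (lshift _ i); rewrite dszl mxE.
have hd X i : sized (dsz e) X -> (size (dsubmx X i 0%R) <= (e + k).+1)%N.
  by move=> hX; have := hX (rshift _ i); rewrite dszr mxE.
have szz (x : par) X : sized (dsz e) X ->
    (size ((prow x *m map_mx sq X) 0%R 0%R) <= (d + k + 2 * e).+1)%N.
  move=> hX; rewrite -[X]vsubmxK map_col_mx mul_row_col mxaddE.
  apply: (leq_trans (size_polyD _ _)); rewrite geq_max; apply/andP; split.
    rewrite -scalemxAl mxscaleE [(d + k)%N]addnC -addnA.
    apply: size_mul_bound; first exact: size_pe.
    by apply: size_row_sq => [i|i]; [apply: size_pp | apply: hu].
  have -> : (d + k + 2 * e = (d - k) + 2 * (e + k))%N by lia.
  by apply: size_row_sq => [i|i]; [apply: size_pw | apply: hd].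
have op : fa_pmx openfun prow.
  apply: (fa_pmx_row hA); last exact: pw_open.
  by apply: (fa_pmx_scale hA); [apply: pe_open | apply: pp_open].
have full : row_full (sysmx 2 (dsz e) (fun=> (d + k + 2 * e).+1) (prow x0)).
  apply: (@sysmx_full _ _ _ _ _ _ _ (fun j => e.+1 - de j)%N _ Y) => [v hv|].
    by move/(coef_system1P (szz x0 v hv)); apply: span.
  have := sum_trunc he; rewrite big_ord1 sum_dsz.
  move: hR sum_de hM; move: (r - s)%N => m.
  move: (\sum_j (_ - _))%N (\sum_j de j)%N => A B; clear; case: m => // m.
  rewrite subSS subn0 => h1 h2 _ h3.
  have {}h1 : R = (s + m)%N by lia.
  by rewrite h1 in h3; nia.
have [] := poly_solution_persists hA op full hX0.
  by move=> i b _; rewrite zX0 mxE coef0.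
move=> X [oX hX sX Xx0]; exists (fun x => corelation_sec x (X x)); split; last by rewrite Xx0.
- have oU : fa_pmx openfun (fun x => map_mx sq (usubmx (X x))).
    by apply: fa_sq; apply: fa_pmx_usub.
  apply: (fa_pmx_col hA); first by apply: (fa_pmx_scale hA) => //; apply: pe_open.
  apply: (fa_pmx_col hA); last by apply: fa_sq; apply: fa_pmx_dsub.
  by apply: (fa_pmx_mul hA) => //; apply: pp_open.
- move=> x; apply: secsz_intro => [i||i].
  + have -> : (d + k + 2 * e - d = k + 2 * e)%N by rewrite -addnA addKn.
    rewrite mxscaleE map_mxE'; apply: size_mul_bound; first exact: size_pe.
    by apply: size_sq; apply: hu.
  + have -> : (d + k + 2 * e - k = d + 2 * e)%N by lia.
    by apply: size_row_sq => [i|i]; [apply: size_pp | apply: hu].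
  + have -> : (d + k + 2 * e - (d - k) = 2 * (e + k))%N by lia.
    by rewrite map_mxE'; apply: size_sq; apply: hd.
- by move=> x; apply: corelation_secP; apply: coef_system1P (szz x _ (hX x)) (sX x).
Qed.
End Families.

Section Deform.
Variables (K : closedFieldType) (r s d k : nat).
Hypothesis charK : 2%N \in [pchar K].
Hypothesis hkd : (k < d)%N.
Hypothesis hsr : (s + 2 <= r)%N.
Notation M := (r - s)%N.
Notation N := (s.+1 + (1 + M))%N.
Notation par := (par K r s d k).
Variables (R : nat) (hR : (3 + R = N)%N) (nu de : 'I_R -> nat).
Notation al j := (d + nu j + 2 * de j)%N.
Hypothesis sum_nu : (\sum_j nu j = k * (M - 1))%N.
Hypothesis sum_de : (\sum_j de j + k * (M - 1) + 1 = d)%N.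
Variable x0 : par.
Variable S0 : 'M[{poly K}]_(N, R).
Hypothesis hS0 : forall i j, (size (S0 i j) <= (al j - wt d k i).+1)%N.
Hypothesis TS0 : Tpar x0 *m S0 = 0.
Hypothesis span0 : forall n v, (d <= n)%N -> sized (secsz d k n) v ->
  Tpar x0 *m v = 0 ->
  exists2 q, sized (fun j : 'I_R => (n.+1 - al j)%N) q & v = S0 *m q.
Hypothesis indep0 : forall q : 'cV_R, S0 *m q = 0 -> q = 0.

(** The basis at x0 deforms to the columns of a matrix of sections at all parameters. *)
Lemma extendable_general : (forall f, extendable x0 (al f) (col f S0)) ->
  general (fun f : map_X K r s d k => unramified f ->
    iso_split (normal_bundle f) [seq Posz (al j) | j <- enum 'I_R]).
Proof.
move=> ext; have hkd' := ltnW hkd.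
have hM : (0 < M)%N by rewrite subn_gt0; move: hsr; clear; lia.
have hal : (\sum_j al j + 2 = d * s.+1 + (k + (d - k) * M))%N.
  exact: (sum_al hkd' hR sum_nu sum_de hM).
have /fin_all_exists[S hS] f : exists v : par -> 'cV[{poly K}]_N,
    [/\ fa_pmx (@openfun K r s d k) v, forall x, sized (secsz d k (al f)) (v x),
        forall x, Tpar x *m v x = 0 & v x0 = col f S0].
  exact: ext.
pose a := [seq al j | j <- enum 'I_R].
have -> : [seq Posz (al j) | j <- enum 'I_R] = map Posz a by rewrite /a -map_comp.
have sa : R = size (map Posz a) by rewrite size_map /a size_map size_enum_ord.
have aE (j : 'I_(size (map Posz a))) : nth 0%N a j = al (cast_ord (esym sa) j).
  have hj : (j < R)%N by rewrite sa.
  rewrite /a (nth_map (Ordinal hj)) ?size_enum_ord //.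
  have -> : nth (Ordinal hj) (enum 'I_R) j = cast_ord (esym sa) j.
    by apply: val_inj => /=; rewrite (nth_enum_ord (Ordinal hj) hj).
  by [].
have cb : {on xpredT, bijective (cast_ord (esym sa))}.
  by exists (cast_ord sa) => j _; rewrite ?cast_ordK ?cast_ordKV.
pose S' x : 'M[{poly K}]_(N, size (map Posz a)) :=
  \matrix_(i, j) S (cast_ord (esym sa) j) x i 0.
have S'0 i j : S' x0 i j = S0 i (cast_ord (esym sa) j).
  by rewrite mxE; have [_ _ _ ->] := hS (cast_ord (esym sa) j); rewrite mxE.
have qE (q : 'cV[{poly K}]_(size (map Posz a))) :
    S' x0 *m q = S0 *m (\col_j q (cast_ord sa j) 0).
  apply/colP => i; rewrite mulmxE' [RHS]mulmxE' (reindex _ cb) /=.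
  by apply: eq_bigr => j _; rewrite S'0 [in RHS]mxE cast_ordKV.
apply: (@sections_general _ _ _ _ _ charK hkd hsr a _ _ _ S' _ _ _ x0).
- by move=> j; rewrite aE -addnA leq_addr.
- by rewrite -sa.
- rewrite -hal [in RHS](reindex _ cb) /=; congr (_ + _)%N.
  by apply: eq_bigr => j _; rewrite aE.
- move=> i j b; have [h _ _ _] := hS (cast_ord (esym sa) j).
  by apply: (fa_ext (@openfun_alg K r s d k) _ (h i 0 b)) => x; rewrite mxE.
- by move=> x i j; rewrite mxE aE; have [_ h _ _] := hS (cast_ord (esym sa) j); apply: h.
- move=> x; apply/matrixP => i j; have [_ _ h _] := hS (cast_ord (esym sa) j).
  have /colP/(_ i) := h x; rewrite mulmxE' [in RHS]mxE => h'.
  rewrite mulmxE' [RHS]mxE -[RHS]h'.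
  by apply: eq_bigr => l _; congr (_ * _); rewrite mxE.
- move=> n v dn hv Tv; have [q hq vq] := span0 dn hv Tv.
  exists (\col_j q (cast_ord (esym sa) j) 0).
    by move=> j; rewrite mxE aE; apply: hq.
  rewrite vq qE; congr (_ *m _); apply/colP => j.
  by rewrite !mxE cast_ordK.
- move=> q; rewrite qE => /indep0/colP h; apply/colP => j.
  by have := h (cast_ord (esym sa) j); rewrite !mxE cast_ordKV.
Qed.

(** Each section of a basis at x0 is deformed through one of the three systems; the
    condition is that no basis section has much larger degree. *)
Theorem deform_splitting :
  (forall f, [\/ forall j, (al j <= (al f).+1)%N,
    exists (Y : 'M[{poly K}]_(s.+1 + M, R)) X0,
      [/\ nu f = 0%N, forall j, (nu j + de j <= (de f).+1)%N,
          forall X, sized (fun=> (de f).+1) X -> pz x0 *m map_mx sq X = 0 ->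
            exists2 q, sized (fun j => (de f).+1 - (nu j + de j))%N q & X = Y *m q,
          sized (fun=> (de f).+1) X0 /\ pz x0 *m map_mx sq X0 = 0 &
          col f S0 = relation_sec x0 X0] |
    exists (Y : 'M[{poly K}]_(s.+1 + M, R)) X0,
      [/\ nu f = k, forall j, (de j <= (de f).+1)%N,
          forall X, sized (dsz k (de f)) X -> prow x0 *m map_mx sq X = 0 ->
            exists2 q, sized (fun j => (de f).+1 - de j)%N q & X = Y *m q,
          sized (dsz k (de f)) X0 /\ prow x0 *m map_mx sq X0 = 0 &
          col f S0 = corelation_sec x0 X0]]) ->
  general (fun f : map_X K r s d k => unramified f ->
    iso_split (normal_bundle f) [seq Posz (al j) | j <- enum 'I_R]).
Proof.
move=> H; apply: extendable_general => f; have hkd' := ltnW hkd.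
have hM : (0 < M)%N by rewrite subn_gt0; move: hsr; clear; lia.
case: (H f) => [h|[Y [X0 [nuf hde span [hX zX] ->]]]|[Y [X0 [nuf hde span [hX zX] ->]]]].
- have dal : (d <= al f)%N by rewrite -addnA leq_addr.
  apply: (extendable_conormal charK hkd' hR sum_nu sum_de hM dal _ h).
  + by apply: leq_trans dal; apply: leq_ltn_trans hkd.
  + by move=> v; apply: span0.
  + by move=> i; rewrite mxE; apply: hS0.
  + by rewrite colE mulmxA TS0 mul0mx.
- rewrite nuf addn0; exact: (extendable_relation_sec charK hkd' hR sum_nu sum_de hM hde span hX zX).
- rewrite nuf; exact: (extendable_corelation_sec charK hkd' hR sum_nu sum_de hM hde span hX zX).
Qed.
End Deform.

(** * Squares in characteristic 2 *)

Section Char2.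
Variables (K : closedFieldType).
Hypothesis charK : 2%N \in [pchar K].

Lemma char2p : 2%N \in [pchar {poly K}].
Proof. by rewrite pchar_poly. Qed.

Lemma addr_eq2 (x y : {poly K}) : x + y = 0 -> x = y.
Proof. by move/addr0_eq; rewrite (oppr_pchar2 char2p). Qed.

Lemma sq_eq0 (p : {poly K}) : (sq p == 0) = (p == 0).
Proof. by apply: comp_poly_eq0; rewrite size_polyXn. Qed.

Lemma sq_inj : injective (sq : {poly K} -> {poly K}).
Proof.
by move=> p q /eqP; rewrite -subr_eq0 -comp_polyB sq_eq0 subr_eq0 => /eqP.
Qed.

Lemma size_sq_ge n (p : {poly K}) : (size (sq p) <= n)%N -> (2 * size p <= n.+1)%N.
Proof.
have [->|p0] := eqVneq p 0; first by rewrite size_poly0.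
have s0 : (0 < size p)%N by rewrite size_poly_gt0.
have := size_comp_poly p 'X^2; rewrite size_polyXn /=.
have : (0 < size (sq p))%N by rewrite size_poly_gt0 sq_eq0.
by move: (size (sq p)) (size p) s0 => u v; lia.
Qed.

Lemma deriv0_sq (p : {poly K}) : p^`() = 0 -> exists q, p = sq q.
Proof.
move=> h; exists (even_poly p); rewrite -[LHS]poly_even_odd.
suff -> : odd_poly p = 0 by rewrite comp_poly0 mul0r addr0.
have c2 (q : {poly K}) : (sq q)^`() = 0 by apply: deriv_sq.
move: h; rewrite -[p in p^`()]poly_even_odd derivD derivM !c2 derivX mul0r !add0r mulr1.
by move/eqP; rewrite sq_eq0 => /eqP.
Qed.

Lemma horner_sq (p : {poly K}) b : (sq p).[b] = p.[b ^+ 2].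
Proof. by rewrite horner_comp hornerXn. Qed.

Lemma sqr_inj2 : injective (fun x : K => x ^+ 2).
Proof.
move=> x y /= h; apply/eqP; rewrite -subr_eq0 -sqrf_eq0.
by rewrite -(pFrobenius_autE charK) rmorphB /= !pFrobenius_autE h subrr.
Qed.

Definition vprod (s : seq K) : {poly K} := \prod_(z <- s) ('X - z%:P).
Definition sqs (s : seq K) := [seq z ^+ 2 | z <- s].

Lemma vprod_neq0 s : vprod s != 0.
Proof. by rewrite -size_poly_gt0 size_prod_XsubC. Qed.
Lemma size_vprod s : size (vprod s) = (size s).+1.
Proof. exact: size_prod_XsubC. Qed.

Lemma vprod_dvd s q : uniq s -> (forall z, z \in s -> q.[z] = 0) -> vprod s %| q.
Proof.
move=> us hq; have [||q' ->] := @uniq_roots_prod_XsubC _ q s.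
- by apply/allP => x /hq /rootP.
- by rewrite uniq_rootsE.
by rewrite dvdp_mull.
Qed.

Lemma sqs_uniq s : uniq (sqs s) = uniq s.
Proof. exact: (map_inj_uniq sqr_inj2). Qed.

Lemma sq_vprod s : sq (vprod (sqs s)) = vprod s ^+ 2.
Proof.
rewrite /vprod big_map -prodrXl rmorph_prod; apply: eq_bigr => z _ /=.
rewrite comp_polyB comp_polyX comp_polyC -!(pFrobenius_autE char2p) rmorphB /=.
by rewrite !pFrobenius_autE polyC_exp.
Qed.

Lemma vprod_coprime s q : (forall z, z \in s -> q.[z] != 0) -> coprimep (vprod s) q.
Proof.
by move=> h; apply/Pdiv.ClosedField.coprimepP => x; rewrite root_prod_XsubC => /h.
Qed.

Lemma vprod_deriv_coprime s : uniq s -> coprimep (vprod s) (vprod s)^`().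
Proof.
elim: s => [|z s IH] /=; first by rewrite /vprod big_nil coprime1p.
case/andP=> zs us; rewrite /vprod big_cons -/(vprod s) derivM derivXsubC mul1r.
rewrite coprimepMl; apply/andP; split.
  rewrite coprimep_sym coprimep_XsubC rootE !hornerE subrr mul0r addr0.
  by rewrite -rootE root_prod_XsubC.
rewrite -[X in X + _]mul1r coprimep_addl_mul coprimepMr IH // andbT.
by rewrite coprimep_XsubC root_prod_XsubC.
Qed.
End Char2.

Section Sections.
Variables (K : closedFieldType) (S M : nat).
Hypothesis charK : 2%N \in [pchar K].
Variables (p : 'rV[{poly K}]_S) (e : {poly K}) (w : 'rV[{poly K}]_M).
Hypothesis e0 : e != 0.
Hypothesis eC : coprimep e e^`().
Notation N := (S + (1 + M))%N.

Definition wrow : 'rV[{poly K}]_(S + M) := row_mx (e *: p) w.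

(** A section of the conormal bundle is determined by its first components and by e
    times its last components, and these form a vector orthogonal to wrow and to
    its derivative; conversely such vectors give sections if their last
    components are divisible by e. *)
Definition vec_of R (v : 'M[{poly K}]_(N, R)) : 'M[{poly K}]_(S + M, R) :=
  col_mx (xpart v) (e *: upart v).
Definition sec_of R (Z : 'M[{poly K}]_(S + M, R)) : 'M[{poly K}]_(N, R) :=
  col_mx (usubmx Z) (col_mx (map_mx (fun q => q %/ e) (p *m usubmx Z))
    (map_mx (fun q => q %/ e) (dsubmx Z))).

Lemma scalep_inj n m (A B : 'M[{poly K}]_(n, m)) : e *: A = e *: B -> A = B.
Proof.
move=> h; apply/matrixP => i j; move/matrixP: h => /(_ i j).
by rewrite !mxscaleE => /(mulfI e0).
Qed.

Lemma char2_mx n m (A B : 'M[{poly K}]_(n, m)) : A + B = 0 -> A = B.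
Proof.
move=> h; apply/matrixP => i j; move/matrixP: h => /(_ i j).
by rewrite mxaddE [(0 : 'M_(_, _)) i j]mxE => /(addr_eq2 charK).
Qed.

Lemma deriv_scale n m (A : 'M[{poly K}]_(n, m)) :
  map_mx deriv (e *: A) = e^`() *: A + e *: map_mx deriv A.
Proof.
by apply/matrixP => i j; rewrite mxaddE !mxscaleE !map_mxE' mxscaleE derivM.
Qed.

Lemma wrow_mul R (Z : 'M_(_, R)) :
  wrow *m Z = e *: (p *m usubmx Z) + w *m dsubmx Z.
Proof. by rewrite -{1}[Z]vsubmxK mul_row_col -scalemxAl. Qed.

Lemma dwrow_mul R (Z : 'M_(_, R)) : map_mx deriv wrow *m Z =
  e^`() *: (p *m usubmx Z) + e *: (map_mx deriv p *m usubmx Z)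
    + map_mx deriv w *m dsubmx Z.
Proof.
by rewrite -{1}[Z]vsubmxK map_row_mx mul_row_col deriv_scale mulmxDl !scalemxAl.
Qed.

Lemma vec_ofP R (v : 'M_(_, R)) : Tmx p e w *m v = 0 ->
  wrow *m vec_of v = 0 /\ map_mx deriv wrow *m vec_of v = 0.
Proof.
case/Tmx0P => /char2_mx h1 /char2_mx h2 h3.
rewrite wrow_mul dwrow_mul col_mxKu col_mxKd -!scalemxAr; split.
  by rewrite -scalerDr h1 h2 mxoppr2 ?scaler0.
rewrite -[RHS](scaler0 _ e) -h3 h1 !scalerDr; congr (_ + _).
by rewrite addrC !scalerA mulrC.
Qed.

Lemma vec_of_inj R (v1 v2 : 'M_(_, R)) : Tmx p e w *m v1 = 0 ->
  Tmx p e w *m v2 = 0 -> vec_of v1 = vec_of v2 -> v1 = v2.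
Proof.
case/Tmx0P => /char2_mx h1 _ _ /Tmx0P[/char2_mx h2 _ _] /eq_col_mx[hx hu].
rewrite -[v1]vsubmxK -[v2]vsubmxK -[dsubmx v1]vsubmxK -[dsubmx v2]vsubmxK.
congr (col_mx _ (col_mx _ _)); first exact: hx; last exact: scalep_inj hu.
by apply: scalep_inj; rewrite -[LHS]h1 -[RHS]h2 hx.
Qed.

Lemma divK n m (A : 'M[{poly K}]_(n, m)) : (forall i j, e %| A i j) ->
  e *: map_mx (fun q => q %/ e) A = A.
Proof.
by move=> h; apply/matrixP => i j; rewrite mxscaleE map_mxE' mulrC divpK.
Qed.

(** The third equation makes e divide e' p x, hence p x because e has simple roots. *)
Lemma sec_ofP R (Z : 'M_(_, R)) : wrow *m Z = 0 -> map_mx deriv wrow *m Z = 0 ->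
  (forall i j, e %| dsubmx Z i j) ->
  Tmx p e w *m sec_of Z = 0 /\ vec_of (sec_of Z) = Z.
Proof.
rewrite wrow_mul dwrow_mul => h1 h2 hd.
have hu := divK hd; set u := map_mx _ (dsubmx Z) in hu.
have h3 : map_mx deriv w *m dsubmx Z = e *: (map_mx deriv w *m u).
  by rewrite -[in LHS]hu scalemxAr.
have hy : e *: map_mx (fun q => q %/ e) (p *m usubmx Z) = p *m usubmx Z.
  apply: divK => i j; rewrite -(Gauss_dvdpr _ eC).
  move/matrixP: h2 => /(_ i j); rewrite h3 2!mxaddE !mxscaleE [(0 : 'M_(_, _)) i j]mxE.
  rewrite -addrA -mulrDr => /(addr_eq2 charK) ->; exact: dvdp_mulr.
have hs : vec_of (sec_of Z) = Z.
  by rewrite /vec_of /xpart /upart col_mxKu !col_mxKd hu vsubmxK.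
split=> //; apply/Tmx0P; rewrite /xpart /ypart /upart col_mxKu !col_mxKd col_mxKu.
split; first by rewrite hy mxoppr2.
  apply: scalep_inj; rewrite hy scaler0 -[RHS]h1 scalerDr [e *: (w *m _)]scalemxAr.
  by rewrite hu.
apply: scalep_inj; rewrite scaler0 -[RHS]h2 h3 !scalerDr; congr (_ + _).
by rewrite scalerA mulrC -scalerA hy addrC.
Qed.
End Sections.

(** * Sections of maps with enough relations *)

Section Vanishing.
Variables (K : closedFieldType) (M R k : nat) (T : 'I_k -> {set 'I_R}).
Implicit Types z : 'I_k -> K.

Definition pts z f := [seq z j | j <- enum [set j | f \in T j]].
Definition allpts z := [seq z j | j <- enum 'I_k].

Lemma size_pts z f : size (pts z f) = #|[set j | f \in T j]|.
Proof. by rewrite size_map -cardE. Qed.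

Lemma mulmx_horner n m l (A : 'M[{poly K}]_(n, m)) (B : 'M_(m, l)) x :
  map_mx (horner_eval x) (A *m B) = map_mx (horner_eval x) A *m map_mx (horner_eval x) B.
Proof. exact: map_mxM. Qed.

(** The condition at each point only involves the coordinates in a set T j, so the
    conditions on the coordinates are independent of each other. *)
Lemma vanishing (B : 'M[{poly K}]_(M, R)) z (c : 'cV[{poly K}]_R) :
  injective z ->
  (forall j (b : 'cV[K]_R), map_mx (horner_eval (z j)) B *m b = 0 <->
     (forall f, f \in T j -> b f 0 = 0)) ->
  (forall i, vprod (allpts z) %| (B *m c) i 0) <->
  (forall f, vprod (pts z f) %| c f 0).
Proof.
move=> iz hB; split=> [h f|h i].
  apply: vprod_dvd => [|x]; first by rewrite map_inj_uniq ?enum_uniq.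
  case/mapP=> j; rewrite mem_enum inE => hf ->.
  have [/(_ _ f hf) + _] := hB j (map_mx (horner_eval (z j)) c).
  rewrite mxE; apply; rewrite -mulmx_horner; apply/colP => i.
  rewrite map_mxE' [RHS]mxE; apply/rootP.
  apply: (root_dvdp (h i)); rewrite root_prod_XsubC.
  by apply: map_f; rewrite mem_enum.
apply: vprod_dvd => [|x]; first by rewrite map_inj_uniq ?enum_uniq.
case/mapP=> j _ ->; have [_] := hB j (map_mx (horner_eval (z j)) c).
rewrite -mulmx_horner => H; have {}H := H _.
suff /H/colP/(_ i) : forall f, f \in T j -> map_mx (horner_eval (z j)) c f 0 = 0.
  by rewrite map_mxE' [RHS]mxE.
move=> f hf; rewrite mxE; apply/rootP; apply: (root_dvdp (h f)).
by rewrite root_prod_XsubC; apply: map_f; rewrite mem_enum inE.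
Qed.
End Vanishing.

Section Model.
Variables (K : closedFieldType) (r s d k : nat).
Hypothesis charK : 2%N \in [pchar K].
Hypothesis hkd : (k < d)%N.
Hypothesis hsr : (s + 2 <= r)%N.
Notation M := (r - s)%N.
Notation N := (s.+1 + (1 + M))%N.
Variables (R : nat) (hR : (3 + R = N)%N) (nu de : 'I_R -> nat).
Notation al j := (d + nu j + 2 * de j)%N.
Hypothesis sum_nu : (\sum_j nu j = k * (M - 1))%N.
Hypothesis sum_de : (\sum_j de j + k * (M - 1) + 1 = d)%N.

Variables (p : 'rV[{poly K}]_s.+1) (w : 'rV[{poly K}]_M).
Variables (a : 'I_k -> K) (T : 'I_k -> {set 'I_R}).
Variable D2 : 'M[{poly K}]_(s.+1 + M, R).
Hypothesis ia : injective a.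
Hypothesis T_nu : forall f, #|[set j | f \in T j]| = nu f.
Let e := vprod (allpts a).
Let D := map_mx sq D2.
Hypothesis size_p : forall i, (size (p 0%R i) <= d.+1)%N.
Hypothesis size_w : forall i, (size (w 0%R i) <= (d - k).+1)%N.
Hypothesis wD : wrow p e w *m D = 0.
Hypothesis D_inj : forall c : 'cV_R, D *m c = 0 -> c = 0.
Hypothesis D_span : forall A (Z : 'cV[{poly K}]_(s.+1 + M)), wrow p e w *m Z = 0 ->
  map_mx deriv (wrow p e w) *m Z = 0 ->
  (forall i, (size (usubmx Z i 0%R) <= A)%N) ->
  (forall i, (size (dsubmx Z i 0%R) <= A + 2 * k)%N) ->
  exists2 c, Z = D *m c & forall f, (size (c f 0%R) <= A - 2 * de f)%N.
Hypothesis D_pts : forall j (b : 'cV[K]_R),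
  map_mx (horner_eval (a j ^+ 2)) (dsubmx D2) *m b = 0 <->
    (forall f, f \in T j -> b f 0 = 0).
Hypothesis size_Du : forall i f, (size (usubmx D2 i f) <= (de f).+1)%N.
Hypothesis size_Dd : forall i f, (size (dsubmx D2 i f) <= (de f + k).+1)%N.

Let a2 j := a j ^+ 2.
Let E f := vprod (pts T a f).
Let E2 f := vprod (pts T a2 f).
Let e2 := vprod (allpts a2).

Let ia2 : injective a2. Proof. by move=> i j /(sqr_inj2 charK)/ia. Qed.
Let e0 : e != 0. Proof. exact: vprod_neq0. Qed.
Let eC : coprimep e e^`().
Proof. by apply: vprod_deriv_coprime; rewrite map_inj_uniq ?enum_uniq. Qed.
Let size_e : size e = k.+1.
Proof. by rewrite size_vprod size_map size_enum_ord. Qed.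
Let size_E f : size (E f) = (nu f).+1.
Proof. by rewrite size_vprod size_pts T_nu. Qed.
Let size_E2 f : size (E2 f) = (nu f).+1.
Proof. by rewrite size_vprod size_pts T_nu. Qed.
Let sq_e : sq e2 = e ^+ 2.
Proof. by rewrite -sq_vprod // /sqs -map_comp. Qed.

Let D_vanish (c : 'cV[{poly K}]_R) :
  (forall i, e %| (dsubmx D *m c) i 0) <-> (forall f, E f %| c f 0).
Proof.
apply: vanishing => // j b; rewrite -D_pts.
have -> : map_mx (horner_eval (a j)) (dsubmx D) =
    map_mx (horner_eval (a j ^+ 2)) (dsubmx D2) => //.
by apply/matrixP => i f; rewrite !map_mxE' !mxE; apply: horner_sq.
Qed.

Let D2_vanish (c : 'cV[{poly K}]_R) :
  (forall i, e2 %| (dsubmx D2 *m c) i 0) <-> (forall f, E2 f %| c f 0).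
Proof. by apply: vanishing. Qed.

Let dwD : map_mx deriv (wrow p e w) *m D = 0.
Proof.
rewrite -deriv_mul_sq //; have -> : wrow p e w *m map_mx sq D2 = 0 by [].
by apply/matrixP => i j; rewrite map_mxE' !mxE deriv0.
Qed.

Definition Emx : 'M[{poly K}]_R := diag_mx (\row_f E f).

Lemma Emx_mul m (A : 'M[{poly K}]_(m, R)) i f : (A *m Emx) i f = A i f * E f.
Proof.
rewrite mul_mx_diag 2!mxE; congr (_ * _).
Qed.

Let S0 := sec_of p e (D *m Emx).

Let S0P : Tmx p e w *m S0 = 0 /\ vec_of e S0 = D *m Emx.
Proof.
apply: sec_ofP => //; first by rewrite mulmxA wD mul0mx.
  by rewrite mulmxA dwD mul0mx.
move=> i f; rewrite -mul_dsub_mx.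
have -> : (dsubmx D *m Emx) i f = (dsubmx D *m col f Emx) i 0.
  by rewrite !mulmxE'; apply: eq_bigr => j _; rewrite [col f _ _ _]mxE.
move: i; apply/D_vanish => f'; rewrite !mxE.
by case: eqP => [->|]; rewrite ?mulr1n ?dvdpp ?mulr0n ?dvdp0.
Qed.

Let vec_S0 (q : 'cV_R) : vec_of e (S0 *m q) = D *m (Emx *m q).
Proof.
rewrite mulmxA -S0P.2 /vec_of /xpart /upart [RHS]mul_col_mx -scalemxAl.
by rewrite -[usubmx (_ *m _)]mul_usub_mx -![dsubmx (_ *m _)]mul_dsub_mx.
Qed.

Let Emxq (q : 'cV[{poly K}]_R) f : (Emx *m q) f 0 = E f * q f 0.
Proof. by rewrite mul_diag_mx !mxE. Qed.

Lemma indep_S0 (q : 'cV_R) : S0 *m q = 0 -> q = 0.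
Proof.
move=> h; have : D *m (Emx *m q) = 0.
  by rewrite -vec_S0 h /vec_of /xpart /upart; apply/colP => i;
    rewrite -(splitK i); case: (split i) => j /=; rewrite ?col_mxEu ?col_mxEd !mxE ?mulr0.
move/D_inj/colP => H; apply/colP => f; move: (H f); rewrite Emxq [RHS]mxE => /eqP.
by rewrite mulf_eq0 (negbTE (vprod_neq0 _)) /= [RHS]mxE => /eqP.
Qed.

(** A section is a combination D c divisible by e in its last components, that is, with
    c_f divisible by E f. *)
Lemma span_S0 n v : (d <= n)%N -> sized (secsz d k n) v -> Tmx p e w *m v = 0 ->
  exists2 q, sized (fun j => (n.+1 - al j)%N) q & v = S0 *m q.
Proof.
move=> dn hv Tv; have [h1 h2] := vec_ofP charK Tv.
have sx i : (size (usubmx (vec_of e v) i 0%R) <= n.+1 - d)%N.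
  rewrite col_mxKu mxE; have := hv (lshift _ i); rewrite /secsz wt_l.
  by rewrite subSn.
have su i : (size (dsubmx (vec_of e v) i 0%R) <= n.+1 - d + 2 * k)%N.
  rewrite col_mxKd mxscaleE !mxE; have := hv (rshift _ (rshift _ i)).
  rewrite /secsz wt_rr => h; apply: (leq_trans (size_polyMleq _ _)).
  rewrite size_e; move: hkd dn h; move: (size _) => x; clear; lia.
have [c vc hc] := D_span h1 h2 sx su.
have hE : forall f, E f %| c f 0.
  apply/D_vanish => i; rewrite mul_dsub_mx -vc col_mxKd mxscaleE.
  exact: dvdp_mulr.
pose q : 'cV_R := \col_f (c f 0 %/ E f).
have cq : c = Emx *m q.
  by apply/colP => f; rewrite Emxq mxE mulrC divpK.
exists q.
  move=> f; rewrite mxE size_divp ?vprod_neq0 // size_E /=.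
  by have := hc f; move: (size _) (nu f) (de f) => x y z; clear; lia.
apply: (vec_of_inj charK e0 Tv); first by rewrite mulmxA S0P.1 mul0mx.
by rewrite vec_S0 -cq.
Qed.

Lemma size_S0 i j : (size (S0 i j) <= (al j - wt d k i).+1)%N.
Proof.
have szx l : (size (usubmx (D *m Emx) l j) <= (nu j + 2 * de j).+1)%N.
  rewrite mxE Emx_mul [(nu j + _)%N]addnC; apply: size_mul_bound; last by rewrite size_E.
  by rewrite mxE; apply: size_sq; have := size_Du l j; rewrite mxE.
rewrite -(splitK i); case: (split i) => l /=.
  by rewrite wt_l col_mxEu -addnA addKn.
rewrite col_mxEd -(splitK l); case: (split l) => l' /=.
  rewrite wt_rl col_mxEu map_mxE' size_divp // size_e.
  suff : (size ((p *m usubmx (D *m Emx)) l' j) <= (al j).+1)%N.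
    by move: (size _) => x; move: hkd; move: (al j) => y; clear; lia.
  rewrite (ord1 l') mulmxE'; apply: (leq_trans (size_sum _ _ _)).
  apply/bigmax_leqP => b _; rewrite -addnA; exact: size_mul_bound.
rewrite wt_rr col_mxEd map_mxE' size_divp // size_e.
suff : (size (dsubmx (D *m Emx) l' j) <= (nu j + 2 * (de j + k)).+1)%N.
  by move: (size _) => x; move: hkd; move: (nu j) (de j) => y z; clear; lia.
rewrite mxE Emx_mul [(nu j + _)%N]addnC; apply: size_mul_bound; last by rewrite size_E.
by rewrite mxE; apply: size_sq; have := size_Dd l' j; rewrite mxE.
Qed.

(** The coefficients c of a solution in the square of the variable have derivative zero,
    since they are unique and D has derivative zero. *)
Lemma span_sq n (X : 'cV[{poly K}]_(s.+1 + M)) : wrow p e w *m map_mx sq X = 0 ->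
  (forall i, (size (usubmx X i 0%R) <= n.+1)%N) ->
  (forall i, (size (dsubmx X i 0%R) <= (n + k).+1)%N) ->
  exists2 c, X = D2 *m c & sized (fun f => (n.+1 - de f)%N) c.
Proof.
move=> h hu hd.
have h' : map_mx deriv (wrow p e w) *m map_mx sq X = 0.
  rewrite -deriv_mul_sq // h.
  by apply/matrixP => i j; rewrite map_mxE' !mxE deriv0.
have [||c Xc hc] := @D_span (2 * n).+1 _ h h'.
- move=> i; have := size_sq (hu i); by rewrite !mxE.
- move=> i; have := size_sq (hd i); rewrite !mxE => H; apply: (leq_trans H).
  by clear; lia.
have dc : map_mx deriv c = 0.
  apply: D_inj; have := congr1 (map_mx deriv) Xc => /esym.
  have -> : map_mx deriv (map_mx sq X) = 0.
    by apply/colP => i; rewrite !map_mxE' [RHS]mxE; apply: deriv_sq.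
  move=> H; rewrite -[RHS]H; apply/colP => i; rewrite mulmxE' map_mxE' mulmxE'.
  rewrite linear_sum; apply: eq_bigr => f _ /=.
  by rewrite map_mxE' derivM map_mxE' deriv_sq // mul0r add0r.
have /fin_all_exists[C hC] f : exists q, c f 0 = sq q.
  by apply: deriv0_sq => //; move/colP: dc => /(_ f); rewrite map_mxE' [RHS]mxE.
exists (\col_f C f).
  apply/colP => i; apply: (@sq_inj K); move/colP: Xc => /(_ i).
  rewrite map_mxE' => ->; rewrite !mulmxE' linear_sum; apply: eq_bigr => f _ /=.
  by rewrite comp_polyM map_mxE' hC [in RHS]mxE.
move=> f; rewrite mxE; have := hc f; rewrite hC => /(size_sq_ge charK).
by move: (size _) (de f) => x y; clear; lia.
Qed.

Lemma sq_mx_mul n m l (A : 'M[{poly K}]_(n, m)) (B : 'M_(m, l)) :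
  map_mx sq (A *m B) = map_mx sq A *m map_mx sq B.
Proof. exact: map_mxM. Qed.

Lemma vec_S0_col f : vec_of e (col f S0) = E f *: col f D.
Proof.
rewrite colE vec_S0; apply/colP => i; rewrite mulmxE' (bigD1 f) //= big1 => [|j jf].
  by rewrite Emxq mxscaleE !mxE eqxx mulr1 addr0 mulrC.
by rewrite Emxq [delta_mx _ _ _ _]mxE (negbTE jf) !mulr0.
Qed.

Lemma T_col f : Tmx p e w *m col f S0 = 0.
Proof. by rewrite colE mulmxA S0P.1 mul0mx. Qed.

Let E2mx : 'M[{poly K}]_R := diag_mx (\row_f E2 f).
Let Y : 'M[{poly K}]_(s.+1 + M, R) :=
  col_mx (usubmx (D2 *m E2mx)) (map_mx (fun q => q %/ e2) (dsubmx (D2 *m E2mx))).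

Let E2mx_mul m (A : 'M[{poly K}]_(m, R)) i f : (A *m E2mx) i f = A i f * E2 f.
Proof. by rewrite mul_mx_diag 2!mxE. Qed.

Let E2mxq (q : 'cV[{poly K}]_R) f : (E2mx *m q) f 0 = E2 f * q f 0.
Proof. by rewrite mul_diag_mx !mxE. Qed.

Let Y_e2 : e2 *: dsubmx Y = dsubmx (D2 *m E2mx).
Proof.
rewrite col_mxKd; apply/matrixP => i f; rewrite mxscaleE map_mxE' mulrC divpK //.
rewrite -mul_dsub_mx.
have -> : (dsubmx D2 *m E2mx) i f = (dsubmx D2 *m col f E2mx) i 0.
  by rewrite !mulmxE'; apply: eq_bigr => j _; rewrite [col f _ _ _]mxE.
move: i; apply/D2_vanish => f'; rewrite !mxE.
by case: eqP => [->|]; rewrite ?mulr1n ?dvdpp ?mulr0n ?dvdp0.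
Qed.

Let e20 : e2 != 0. Proof. exact: vprod_neq0. Qed.
Let size_e2 : size e2 = k.+1.
Proof. by rewrite size_vprod size_map size_enum_ord. Qed.

(** Multiplying the last components by e2 turns the relations between p and e w into
    relations between e p and w. *)
Let up2 m (X : 'M[{poly K}]_(s.+1 + M, m)) := col_mx (usubmx X) (e2 *: dsubmx X).

Let wrow_up2 m (X : 'M[{poly K}]_(s.+1 + M, m)) :
  wrow p e w *m map_mx sq (up2 X) = e *: (row_mx p (e *: w) *m map_mx sq X).
Proof.
rewrite -{2}[X]vsubmxK /up2 !map_col_mx !mul_row_col scalerDr -!scalemxAl.
congr (_ + _); rewrite scalerA -expr2 -sq_e scalemxAr; congr (_ *m _).
by apply/matrixP => i j; rewrite map_mxE' !mxscaleE map_mxE' comp_polyM.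
Qed.

Let up2Y : up2 Y = D2 *m E2mx.
Proof. by rewrite /up2 Y_e2 col_mxKu vsubmxK. Qed.

Let up2_mul m l (A : 'M_(_, m)) (B : 'M_(m, l)) : up2 (A *m B) = up2 A *m B.
Proof.
by rewrite /up2 mul_col_mx -[usubmx (_ *m _)]mul_usub_mx -[dsubmx (_ *m _)]mul_dsub_mx
  -scalemxAl.
Qed.

Let up2_inj m (A B : 'M_(_, m)) : up2 A = up2 B -> A = B.
Proof.
move=> /eq_col_mx[h1 h2]; rewrite -[A]vsubmxK -[B]vsubmxK h1; congr (col_mx _ _).
apply/matrixP => i j; move/matrixP: h2 => /(_ i j).
by rewrite !mxscaleE => /(mulfI e20).
Qed.

(** As for span_S0, but in the square of the variable, where c_f must be divisible by the
    polynomial E2 f with roots the squares of those of E f. *)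
Lemma span_Y n (X : 'cV[{poly K}]_(s.+1 + M)) : sized (fun=> n.+1) X ->
  row_mx p (e *: w) *m map_mx sq X = 0 ->
  exists2 q, sized (fun j => n.+1 - (nu j + de j))%N q & X = Y *m q.
Proof.
move=> hX h; have [|||c Xc hc] := @span_sq n (up2 X).
- by rewrite wrow_up2 h scaler0.
- by move=> i; rewrite col_mxKu mxE.
- move=> i; rewrite col_mxKd mxscaleE mxE [(n + k)%N]addnC.
  by apply: size_mul_bound; rewrite ?size_e2.
have hE : forall f, E2 f %| c f 0.
  apply/D2_vanish => i; rewrite mul_dsub_mx -Xc col_mxKd mxscaleE.
  exact: dvdp_mulr.
pose q : 'cV_R := \col_f (c f 0 %/ E2 f).
have cq : c = E2mx *m q by apply/colP => f; rewrite E2mxq mxE mulrC divpK.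
exists q; last by apply: up2_inj; rewrite up2_mul up2Y -mulmxA -cq.
move=> f; rewrite mxE size_divp ?vprod_neq0 // size_E2 /=.
by have := hc f; move: (size _) (nu f) (de f) => x y z; clear; lia.
Qed.

Lemma size_Y f : nu f = 0%N -> sized (fun=> (de f).+1) (col f Y).
Proof.
move=> nuf i; have E1 : (size (E2 f) <= 1)%N by rewrite size_E2 nuf.
rewrite [col f Y _ _]mxE -(splitK i); case: (split i) => l /=.
  rewrite col_mxEu mxE E2mx_mul -(addn0 (de f)).
  by apply: size_mul_bound => //; have := size_Du l f; rewrite mxE.
rewrite col_mxEd map_mxE' size_divp // size_e2.
suff : (size (dsubmx (D2 *m E2mx) l f) <= (de f + k).+1)%N.
  by move: (size _) => x; clear; lia.
rewrite mxE E2mx_mul -[(de f + k)%N]addn0.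
by apply: size_mul_bound => //; have := size_Dd l f; rewrite mxE.
Qed.

(** The columns of D with nu f = 0 give relations between p and e w, those with
    nu f = k relations between e p and w, and all these relations are known by span_Y and
    span_sq. *)
Theorem model_splitting :
  (forall f, [\/ forall j, (al j <= (al f).+1)%N,
     nu f = 0%N /\ forall j, (nu j + de j <= (de f).+1)%N |
     nu f = k /\ forall j, (de j <= (de f).+1)%N]) ->
  general (fun f : map_X K r s d k => unramified f ->
    iso_split (normal_bundle f) [seq Posz (al j) | j <- enum 'I_R]).
Proof.
have he : (size e <= k.+1)%N by rewrite size_e.
pose x0 := par_of d k p e w.
have [hp' he' hw'] := par_ofE size_p he size_w.
have TE : Tpar x0 = Tmx p e w by rewrite /Tpar hp' he' hw'.
have zE : pz x0 = row_mx p (e *: w) by rewrite /pz hp' he' hw'.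
have wE : prow x0 = wrow p e w by rewrite /prow hp' he' hw'.
move=> H; apply: (@deform_splitting K r s d k charK hkd hsr R hR nu de sum_nu sum_de
  x0 S0 size_S0).
- by rewrite TE S0P.1.
- by move=> n v dn hv; rewrite TE; apply: span_S0.
- exact: indep_S0.
move=> f; case: (H f) => [h|[nuf hde]|[nuf hde]]; first by apply: Or31.
  apply: Or32; exists Y, (col f Y); rewrite zE.
  have zY : row_mx p (e *: w) *m map_mx sq (col f Y) = 0.
    apply: (@scalep_inj K e e0); rewrite scaler0 -wrow_up2 colE up2_mul up2Y.
    by rewrite -mulmxA sq_mx_mul mulmxA wD mul0mx.
  split=> //; [by move=> X; apply: span_Y | by split; first exact: size_Y |].
  apply: (@vec_of_inj _ _ _ charK p e w e0); first exact: T_col.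
    by rewrite -TE; apply: relation_secP => //; rewrite zE.
  have s0 : pts T a f = [::] by apply: size0nil; rewrite size_pts T_nu.
  have s0' : pts T a2 f = [::] by apply: size0nil; rewrite size_pts T_nu.
  have E1 : E f = 1 by rewrite /E /vprod s0 big_nil.
  have E21 : E2 f = 1 by rewrite /E2 /vprod s0' big_nil.
  rewrite vec_S0_col E1 scale1r.
  have -> : col f D = map_mx sq (up2 (col f Y)).
    rewrite [col f Y]colE up2_mul up2Y -colE; apply/colP => i.
    by rewrite [RHS]map_mxE' [LHS]mxE [col f (_ *m _) _ _]mxE E2mx_mul E21 mulr1 map_mxE'.
  rewrite /vec_of /xpart /upart col_mxKu !col_mxKd /up2 map_col_mx he'.
  congr (col_mx _ _); rewrite scalerA -expr2 -sq_e.
  by apply/matrixP => i j; rewrite mxscaleE !map_mxE' mxscaleE comp_polyM.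
apply: Or33; exists D2, (col f D2); rewrite wE.
have wf : wrow p e w *m map_mx sq (col f D2) = 0.
  by rewrite colE sq_mx_mul mulmxA wD mul0mx.
split=> //.
- move=> X hX h; have [|||c Xc hc] := @span_sq (de f) X => //; last by exists c.
  + by move=> i; rewrite mxE; have := hX (lshift _ i); rewrite dszl.
  + by move=> i; rewrite mxE; have := hX (rshift _ i); rewrite dszr.
- split=> // i; rewrite -(splitK i) [col f D2 _ _]mxE; case: (split i) => l /=.
    by rewrite dszl; have := size_Du l f; rewrite mxE.
  by rewrite dszr; have := size_Dd l f; rewrite mxE.
apply: (@vec_of_inj _ _ _ charK p e w e0); first exact: T_col.
  by rewrite -TE; apply: corelation_secP => //; rewrite wE.
have Ee : E f = e.
  have -> : E f = vprod [seq a j | j <- enum [set: 'I_k]].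
    rewrite /E /pts (_ : [set j | f \in T j] = setT) //; apply/eqP.
    by rewrite eqEcard subsetT cardsT card_ord T_nu nuf leqnn.
  by rewrite /e /allpts enum_setT enumT.
rewrite vec_S0_col Ee /vec_of /xpart /upart col_mxKu !col_mxKd he'.
by rewrite -scale_col_mx -map_col_mx vsubmxK; apply/colP => i;
  rewrite !mxscaleE !map_mxE' !mxE.
Qed.
End Model.

(** * Interpolation and general position *)

Section Points.
Variable K : closedFieldType.

Lemma uniq_seq_ex n : exists2 s : seq K, uniq s & size s = n.
Proof.
elim: n => [|n [s us ss]]; first by exists [::].
have [z hz] := exists_nonroot (vprod_neq0 s).
exists (z :: s); rewrite /= ?ss // us andbT.
by rewrite -root_prod_XsubC.
Qed.

Lemma injection_ex (I : finType) : exists f : I -> K, injective f.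
Proof.
have [s us ss] := uniq_seq_ex #|I|.
exists (fun i => nth 0 s (enum_rank i)) => i j /eqP.
by rewrite nth_uniq ?ss // => /eqP/val_inj/enum_rank_inj.
Qed.

Lemma interpolation (I : finType) (f v : I -> K) : injective f ->
  exists2 q : {poly K}, (size q <= #|I|)%N & forall i, q.[f i] = v i.
Proof.
move=> fi; pose L i := vprod [seq f j | j <- enum (predC1 i)].
have Lx i j : ((L i).[f j] == 0) = (j != i).
  by rewrite -rootE root_prod_XsubC mem_map // mem_enum inE.
exists (\sum_i (v i / (L i).[f i]) *: L i).
  apply: (leq_trans (size_sum _ _ _)); apply/bigmax_leqP => i _.
  apply: (leq_trans (size_scale_leq _ _)).
  rewrite size_vprod size_map -cardE cardC1 prednK //.
  by apply/card_gt0P; exists i.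
move=> i; rewrite horner_sum (bigD1 i) //= big1 => [|j ji].
  by rewrite hornerZ addr0 divfK // Lx eqxx.
by apply/eqP; rewrite hornerZ mulf_eq0 Lx [i == j]eq_sym ji orbT.
Qed.
End Points.

Section GeneralPosition.
Variable K : closedFieldType.

(** The rows of U are a left inverse of A and a generator of its left kernel. *)
Lemma complete_left_inverse n (A : 'M[K]_(n + 1, n)) : row_full A ->
  exists2 U : 'M_(n + 1), row_free U & U *m A = col_mx 1%:M 0.
Proof.
move=> fA; have /row_fullP[B BA] := fA.
have : kermx A != 0.
  rewrite -mxrank_eq0 mxrank_ker (eqP fA) addKn //.
case/rowV0Pn => b0 /sub_kermxP bA b0n.
exists (col_mx B b0); last by rewrite mul_col_mx BA bA.
rewrite -kermx_eq0; apply/rowV0P => x /sub_kermxP.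
rewrite -[x]hsubmxK mul_row_col => h.
have h1 : lsubmx x = 0.
  rewrite -[LHS]mulmx1 -BA mulmxA -[RHS](mul0mx _ A) -h mulmxDl.
  by rewrite -[_ *m A in X in _ = _ + X]mulmxA bA mulmx0 addr0.
move: h; rewrite h1 mul0mx add0r [rsubmx x]mx11_scalar mul_scalar_mx => /eqP.
rewrite scaler_eq0 (negbTE b0n) orbF => /eqP ->.
by rewrite raddf0 row_mx0.
Qed.

(** The maximal minors of a Vandermonde matrix do not vanish, so for C = - V1 V2^-1, with
    V1 and V2 its two blocks, any n rows of (- C; 1) are independent. Hence any n + 1
    coordinates of b are, up to an invertible matrix, equations L b1 + b2 = 0, be b1 = 0
    in the new coordinates (b1, b2) given by C. *)
Lemma general_position m n : exists C : 'M[K]_(m, n),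
  forall T : {set 'I_(m + n)}, #|T| = n.+1 ->
  exists (L : 'M[K]_(n, m)) (be : 'rV[K]_m), forall b : 'cV[K]_(m + n),
    (col_mx (row_mx L 1%:M) (row_mx be 0) : 'M_(n + 1, _)) *m
      (block_mx 1%:M C 0 1%:M *m b) = 0 <-> forall f, f \in T -> b f 0 = 0.
Proof.
have [z iz] := @injection_ex K 'I_(m + n).
have vdm (g : 'I_n -> 'I_(m + n)) : injective g ->
    \matrix_(i < n, j < n) z (g i) ^+ j \in unitmx.
  move=> ig; have -> : \matrix_(i < n, j < n) z (g i) ^+ j =
      (Vandermonde n (\row_i z (g i)))^T by apply/matrixP => i j; rewrite !mxE.
  rewrite unitmx_tr unitmxE det_Vandermonde unitfE.
  apply/prodf_neq0 => i _; apply/prodf_neq0 => j ij.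
  rewrite !mxE subr_eq0; apply/eqP => /iz/ig h; by rewrite h ltnn in ij.
pose V : 'M[K]_(m + n, n) := \matrix_(i, j) z i ^+ j.
have uV : dsubmx V \in unitmx.
  have -> : dsubmx V = \matrix_(i, j) z (rshift m i) ^+ j.
    by apply/matrixP => i j; rewrite !mxE.
  by apply: vdm; apply: rshift_inj.
pose C := - (usubmx V *m invmx (dsubmx V)); exists C => T cT.
have cT' : (n + 1)%N = #|T| by rewrite addn1 cT.
pose tau (l : 'I_(n + 1)) : 'I_(m + n) := enum_val (cast_ord cT' l).
have itau : injective tau by move=> x y /enum_val_inj/cast_ord_inj.
pose G : 'M[K]_(m + n) := block_mx 1%:M C 0 1%:M.
pose G' : 'M[K]_(m + n) := block_mx 1%:M (- C) 0 1%:M.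
have GG : G' *m G = 1%:M.
  rewrite mulmx_block !mul1mx !mul0mx !mulmx0 !mulmx1 !addr0 add0r subrr.
  by rewrite -scalar_mx_block.
pose P := rowsub tau G'.
have Pr : rsubmx P = rowsub tau V *m invmx (dsubmx V).
  have -> : rsubmx P = rowsub tau (rsubmx G') by apply/matrixP => i j; rewrite !mxE.
  rewrite /G' block_mxEh row_mxKr mul_rowsub_mx; congr (rowsub _ _).
  by rewrite -{1}[V]vsubmxK mul_col_mx mulmxV // /C opprK.
have fP : row_full (rsubmx P).
  have uW : usubmx (rsubmx P) \in unitmx.
    rewrite Pr -mul_usub_mx unitmx_mul unitmx_inv uV andbT.
    have -> : usubmx (rowsub tau V) = \matrix_(i, j) z (tau (lshift 1 i)) ^+ j.
      by apply/matrixP => i j; rewrite !mxE.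
    by apply: vdm => x y /itau/lshift_inj.
  apply/row_fullP; exists (row_mx (invmx (usubmx (rsubmx P))) 0).
  by rewrite -{2}[rsubmx P]vsubmxK mul_row_col mul0mx addr0 mulVmx.
have [U fU UP] := complete_left_inverse fP.
exists (usubmx (U *m lsubmx P)), (dsubmx (U *m lsubmx P)) => b.
have -> : col_mx (row_mx (usubmx (U *m lsubmx P)) 1%:M)
    (row_mx (dsubmx (U *m lsubmx P)) 0) = U *m P.
  by rewrite -block_mxEv block_mxEh vsubmxK -UP -mul_mx_row hsubmxK.
have PG : P *m (G *m b) = rowsub tau b.
  by rewrite /P mul_rowsub_mx mulmxA GG mul1mx.
rewrite -mulmxA PG; split=> [h f fT|h].
  have h0 : rowsub tau b = 0.
    by apply: (row_full_inj (_ : row_full U)); rewrite ?mulmx0 // row_full_unit -row_free_unit.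
  have /codomP[l fl] : f \in codom tau.
    have -> : f = tau (cast_ord (esym cT') (enum_rank_in fT f)).
      by rewrite /tau cast_ordKV enum_rankK_in.
    exact: codom_f.
  by move/colP: h0 => /(_ l); rewrite !mxE -fl.
rewrite (_ : rowsub tau b = 0) ?mulmx0 //; apply/colP => l.
by rewrite !mxE h // enum_valP.
Qed.
End GeneralPosition.

(** * An explicit map *)

Section EvenOdd.
Variable K : closedFieldType.
Hypothesis charK : 2%N \in [pchar K].
Implicit Type q : {poly K}.

Lemma sq_odd q : sq (odd_poly q) = q^`().
Proof.
rewrite -[in RHS](poly_even_odd q) derivD derivM !deriv_sq // derivX.
by rewrite mul0r !add0r mulr1.
Qed.

Lemma sq_even q : sq (even_poly q) = q + 'X * q^`().
Proof.
by rewrite -sq_odd -{2}(poly_even_odd q) [_ * 'X]mulrC -addrA (addrr_pchar2 (char2p charK)) addr0.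
Qed.

Lemma coprime_prod_dvd (I : eqType) (r : seq I) (A : I -> {poly K}) q : uniq r ->
  (forall i j, i != j -> coprimep (A i) (A j)) -> (forall i, A i %| q) ->
  \prod_(i <- r) A i %| q.
Proof.
move=> ur hc hq; elim: r ur => [|i r IH] /=; first by rewrite big_nil dvd1p.
case/andP=> ir ur; rewrite big_cons Gauss_dvdp ?hq ?IH //.
rewrite big_seq; elim/big_rec: _ => [|j x jr hx]; first exact: coprimep1.
by rewrite coprimepMr hx andbT; apply: hc; apply: contraNneq ir => ->.
Qed.

Lemma dvdp_sq (q1 q2 : {poly K}) : q1 %| q2 -> sq q1 %| sq q2.
Proof. by case/dvdpP => c ->; rewrite comp_polyM dvdp_mull. Qed.
End EvenOdd.

Section Syzygies.
Variable K : closedFieldType.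
Hypothesis charK : 2%N \in [pchar K].
Variables (n : nat) (G : {poly K}) (c : 'I_n -> seq K).
Hypothesis G0 : G != 0.
Hypothesis uc : forall x, uniq (c x).
Hypothesis dc : forall x y z, z \in c x -> z \in c y -> x = y.

Definition Bk x := vprod (c x).
Definition Hk x : {poly K} := \prod_(y | y != x) Bk y.
Definition HH : {poly K} := \prod_x Bk x.

(** If Bk = b0(t^2) + t b1(t^2), then (b0, b1) at t^2 and Bk^2, which is also a polynomial
    in t^2, are the coefficients of a relation between g, g t and g / Bk, for
    any g that Bk divides. *)
Definition wgen : 'rV[{poly K}]_(1 + (1 + n)) :=
  row_mx (G * HH)%:M (row_mx (G * HH * 'X)%:M (\row_x (G * Hk x))).
Definition Y2 : 'M[{poly K}]_(1 + (1 + n), n) :=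
  col_mx (\row_x even_poly (Bk x))
    (col_mx (\row_x odd_poly (Bk x)) (diag_mx (\row_x vprod (sqs (c x))))).

Definition c0 R (V : 'M[{poly K}]_(1 + (1 + n), R)) j := usubmx V 0 j.
Definition c1 R (V : 'M[{poly K}]_(1 + (1 + n), R)) j := usubmx (dsubmx V) 0 j.
Definition cK R (V : 'M[{poly K}]_(1 + (1 + n), R)) x j := dsubmx (dsubmx V) x j.

Lemma HHE x : HH = Bk x * Hk x. Proof. by rewrite /HH (bigD1 x). Qed.

Lemma col3_ext R (V W : 'M[{poly K}]_(1 + (1 + n), R)) :
  (forall j, c0 V j = c0 W j) -> (forall j, c1 V j = c1 W j) ->
  (forall x j, cK V x j = cK W x j) -> V = W.
Proof.
move=> h0 h1 hK; rewrite -[V]vsubmxK -[W]vsubmxK -[dsubmx V]vsubmxK -[dsubmx W]vsubmxK.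
congr (col_mx _ (col_mx _ _)); apply/matrixP => i j; rewrite ?(ord1 i).
- exact: h0. - exact: h1. - exact: hK.
Qed.

Lemma wgen_mul R (V : 'M_(_, R)) j : (wgen *m V) 0 j =
  G * (HH * (c0 V j + 'X * c1 V j) + \sum_x Hk x * cK V x j).
Proof.
rewrite -{1}[V]vsubmxK -[dsubmx V]vsubmxK !mul_row_col !mul_scalar_mx.
rewrite !mxaddE !mxscaleE mulmxE' !mulrDr !mulrA -addrA; congr (_ + (_ + _)).
by rewrite mulr_sumr; apply: eq_bigr => x _; rewrite mxE mulrA.
Qed.

Lemma dwgen_mul R (V : 'M_(_, R)) j : (map_mx deriv wgen *m V) 0 j =
  G^`() * (HH * (c0 V j + 'X * c1 V j) + \sum_x Hk x * cK V x j)
  + G * (HH^`() * (c0 V j + 'X * c1 V j) + HH * c1 V j + \sum_x (Hk x)^`() * cK V x j).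
Proof.
have -> : map_mx deriv wgen = row_mx (G * HH)^`()%:M (row_mx (G * HH * 'X)^`()%:M
   (\row_x (G * Hk x)^`())).
  rewrite !map_row_mx; congr (row_mx _ (row_mx _ _)); apply/matrixP => a b.
  - by rewrite map_mxE' !ord1 !mxE !mulr1n.
  - by rewrite map_mxE' !ord1 !mxE !mulr1n.
  - by rewrite map_mxE' !mxE.
rewrite -{1}[V]vsubmxK -[dsubmx V]vsubmxK !mul_row_col !mul_scalar_mx.
rewrite !mxaddE !mxscaleE mulmxE' !derivM derivX.
rewrite -/(c0 V j) -/(c1 V j).
have -> : \sum_x (\row_x (G * Hk x)^`()) 0 x * dsubmx (dsubmx V) x j =
   G^`() * (\sum_x Hk x * cK V x j) + G * \sum_x (Hk x)^`() * cK V x j.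
  rewrite !mulr_sumr -big_split; apply: eq_bigr => x _ /=.
  by rewrite mxE derivM mulrDl !mulrA.
by ring.
Qed.

Lemma c0_Y2 j : c0 (map_mx sq Y2) j = Bk j + 'X * (Bk j)^`().
Proof. by rewrite /c0 /Y2 map_col_mx col_mxKu !mxE sq_even. Qed.
Lemma c1_Y2 j : c1 (map_mx sq Y2) j = (Bk j)^`().
Proof. by rewrite /c1 /Y2 !map_col_mx col_mxKd col_mxKu !mxE sq_odd. Qed.
Lemma cK_Y2 x j : cK (map_mx sq Y2) x j = (Bk x ^+ 2) *+ (x == j).
Proof.
rewrite /cK /Y2 !map_col_mx !col_mxKd !mxE.
by case: eqP => _; rewrite ?mulr1n ?mulr0n ?sq_vprod ?comp_poly0.
Qed.

Let cp := char2p charK.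

Lemma wgen_Y2 : wgen *m map_mx sq Y2 = 0.
Proof.
apply/matrixP => i j; rewrite (ord1 i) wgen_mul [RHS]mxE c0_Y2 c1_Y2.
rewrite (bigD1 j) //= big1 => [|x xj]; last by rewrite cK_Y2 (negbTE xj) mulr0n mulr0.
rewrite cK_Y2 eqxx mulr1n -addrA (addrr_pchar2 cp) !addr0 (HHE j).
have -> : Bk j * Hk j * Bk j + Hk j * Bk j ^+ 2 =
  Hk j * Bk j ^+ 2 + Hk j * Bk j ^+ 2 by ring.
by rewrite (addrr_pchar2 cp) mulr0.
Qed.

Lemma coprime_Bk x y : x != y -> coprimep (Bk x) (Bk y).
Proof.
move=> xy; apply: vprod_coprime => z zx; rewrite -rootE root_prod_XsubC.
by apply: contra xy => zy; apply/eqP; apply: dc zx zy.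
Qed.

Lemma coprime_Hk x : coprimep (Bk x) (Hk x).
Proof.
rewrite /Hk; elim/big_rec: _ => [|y q yx hq]; first exact: coprimep1.
by rewrite coprimepMr hq andbT; apply: coprime_Bk; rewrite eq_sym.
Qed.

(** Uniqueness of partial fractions. *)
Lemma partial_fractions F (X : 'I_n -> {poly K}) :
  HH * F + \sum_x Hk x * X x = 0 -> forall x, Bk x %| X x.
Proof.
move=> h x; rewrite -(Gauss_dvdpr _ (coprime_Hk x)).
move: h; rewrite (bigD1 x) //= addrCA => /(addr_eq2 charK) ->.
apply: dvdp_add; first by rewrite (HHE x) -mulrA dvdp_mulr.
elim/big_rec: _ => [|y q yx hq]; first exact: dvdp0.
apply: dvdp_add => //; apply: dvdp_mulr; by rewrite /Hk (bigD1 x) ?dvdp_mulr // eq_sym.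
Qed.

(** The first equation is one between partial fractions, so that Bk divides the last
    components; with the second equation it divides them twice. What remains
    determines the first two components. *)
Lemma wgen_span (V : 'cV_(1 + (1 + n))) : wgen *m V = 0 ->
  map_mx deriv wgen *m V = 0 -> exists q : 'cV_n, V = map_mx sq Y2 *m q.
Proof.
move=> /matrixP/(_ 0 0); rewrite wgen_mul [RHS]mxE => /eqP.
rewrite mulf_eq0 (negbTE G0) /= => /eqP h1.
move=> /matrixP/(_ 0 0); rewrite dwgen_mul h1 mulr0 add0r [RHS]mxE => /eqP.
rewrite mulf_eq0 (negbTE G0) /= => /eqP h2.
pose F := c0 V 0 + 'X * c1 V 0.
have /fin_all_exists[U hU] x : exists u, cK V x 0 = Bk x * u.
  by have /dvdpP[u ->] := partial_fractions h1 x; exists u; rewrite mulrC.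
have HH0 : HH != 0 by apply/prodf_neq0 => x _; apply: vprod_neq0.
have FE : F = \sum_x U x.
  apply: (mulfI HH0); apply: (addr_eq2 charK); rewrite -[RHS]h1 -/F; congr (_ + _).
  by rewrite mulr_sumr; apply: eq_bigr => x _; rewrite hU mulrA (HHE x) [Bk x * _]mulrC.
have h3 : HH * c1 V 0 + \sum_x Hk x * ((Bk x)^`() * U x) = 0.
  rewrite -[RHS]h2 -/F FE [_ + HH * _]addrC -addrA; congr (_ + _).
  rewrite mulr_sumr -big_split; apply: eq_bigr => x _ /=.
  rewrite hU (HHE x) derivM.
  rewrite -[LHS]addr0 -(addrr_pchar2 cp (Bk x * (Hk x)^`() * U x)); ring.
have /fin_all_exists[q hq] x : exists u, U x = Bk x * u.
  have : Bk x %| (Bk x)^`() * U x by have := partial_fractions h3 x.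
  rewrite Gauss_dvdpr; last exact: vprod_deriv_coprime.
  by case/dvdpP => u ->; exists u; rewrite mulrC.
have c1E : c1 V 0 = \sum_x (Bk x)^`() * q x.
  apply: (mulfI HH0); apply: (addr_eq2 charK); rewrite -[RHS]h3; congr (_ + _).
  by rewrite mulr_sumr; apply: eq_bigr => x _; rewrite hq (HHE x); ring.
exists (\col_x q x); apply: col3_ext => [j|j|x j]; rewrite (ord1 j).
- have -> : c0 V 0 = F + 'X * c1 V 0.
    by rewrite -addrA (addrr_pchar2 cp) addr0.
  rewrite FE c1E mulr_sumr -big_split /c0 -mul_usub_mx mulmxE'; apply: eq_bigr => x _ /=.
  by rewrite -/(c0 _ _) c0_Y2 mxE hq mulrDl mulrA.
- rewrite c1E /c1 -mul_dsub_mx -mul_usub_mx mulmxE'; apply: eq_bigr => x _ /=.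
  by rewrite -/(c1 _ _) c1_Y2 mxE.
- rewrite hU hq /cK -!mul_dsub_mx mulmxE' (bigD1 x) //= big1 => [|y yx].
    by rewrite -/(cK _ _ _) cK_Y2 eqxx mulr1n mxE addr0 mulrA.
  by rewrite -/(cK _ _ _) cK_Y2 eq_sym (negbTE yx) mulr0n mul0r.
Qed.
End Syzygies.

Lemma size_prod_vprod (K : closedFieldType) (I : finType) (t : I -> seq K) :
  size (\prod_i vprod (t i)) = (\sum_i size (t i)).+1.
Proof.
rewrite size_prod => [|i _]; last exact: vprod_neq0.
rewrite (eq_bigr (fun i => size (t i) + 1)%N) => [|i _]; last by rewrite size_vprod addn1.
by rewrite big_split /= sum1_card -addSn addnK.
Qed.

Section Construction.
Variable K : closedFieldType.
Hypothesis charK : 2%N \in [pchar K].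
Variables (m n d k : nat) (di : 'I_m -> nat) (dk : 'I_n -> nat).
Hypothesis hle : forall i x, (di i <= dk x)%N.
Hypothesis sum_d : (\sum_i di i + \sum_x dk x + k * n.+1 + 1 = d)%N.
Variables (T : 'I_k -> {set 'I_(m + n)}).
Hypothesis cT : forall j, #|T j| = n.+1.
Variables (a : 'I_k -> K) (b : 'I_m -> seq K) (c : 'I_n -> seq K).
Hypothesis ia : injective a.
Hypothesis ub : forall i, uniq (b i).
Hypothesis uc : forall x, uniq (c x).
Hypothesis sb : forall i, size (b i) = di i.
Hypothesis sc : forall x, size (c x) = (dk x + k)%N.
Hypothesis ab : forall j i, a j \notin b i.
Hypothesis ac : forall j x, a j \notin c x.
Hypothesis bc : forall i x z, z \in b i -> z \notin c x.
Hypothesis db : forall i j z, z \in b i -> z \in b j -> i = j.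
Hypothesis dc : forall x y z, z \in c x -> z \in c y -> x = y.

Let cp := char2p charK.
Notation M := (1 + (1 + n))%N.
Let e := vprod (allpts a).
Let B i := vprod (b i).
Let G : {poly K} := \prod_i B i.
Let Gi i : {poly K} := \prod_(j | j != i) B j.
Let w := wgen G c.
Let Y := Y2 c.
Let sY := map_mx sq Y.

Let B0 i : B i != 0. Proof. exact: vprod_neq0. Qed.
Let e0 : e != 0. Proof. exact: vprod_neq0. Qed.
Let G0 : G != 0. Proof. by apply/prodf_neq0 => i _. Qed.
Let GE i : G = B i * Gi i. Proof. by rewrite /G (bigD1 i). Qed.
Let wY : w *m sY = 0. Proof. exact: wgen_Y2. Qed.

(** The obvious relation between 1 and t at t = x, in characteristic 2. *)
Definition uvec (x : K) : 'cV[K]_M := col_mx x%:M (col_mx 1%:M 0).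

Lemma w_uvec x : map_mx (horner_eval x) w *m uvec x = 0.
Proof.
rewrite /w /wgen /uvec !map_row_mx !mul_row_col mulmx0 addr0 mulmx1.
rewrite mul_mx_scalar; apply/matrixP => i j; rewrite !ord1 mxaddE mxscaleE !map_mxE' !mxE.
rewrite eqxx !mulr1n /horner_eval !hornerM hornerX mulrC; exact: (addrr_pchar2 charK).
Qed.

(** The values at the zeros of B_i make w V_i(t^2) vanish doubly there. Those at the zeros
    a_j of e are relations between the values of w, chosen so that D c vanishes at a_j
    in its last components when c vanishes there on T j. *)
Lemma interpolate_vec :
  exists C : 'M[K]_(m, n), exists V : 'M[{poly K}]_(M, m),
  [/\ forall i l, (size (V l i) <= di i + k)%N,
      forall j, map_mx (horner_eval (a j)) w *m map_mx (horner_eval (a j ^+ 2)) V = 0,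
      forall i z, z \in b i -> map_mx (horner_eval (z ^+ 2)) (col i V) = uvec z &
      forall j (v : 'cV[K]_(m + n)),
        row_mx (map_mx (horner_eval (a j ^+ 2)) V) (map_mx (horner_eval (a j ^+ 2)) Y)
          *m (block_mx 1%:M C 0 1%:M *m v) = 0 <-> (forall f, f \in T j -> v f 0 = 0)].
Proof.
have [C hC] := general_position K m n; exists C.
have /fin_all_exists[L /fin_all_exists[be hL]] j := hC (T j) (cT j).
pose Ya j := map_mx (horner_eval (a j ^+ 2)) Y.
pose val i (s : 'I_(di i) + 'I_k) : 'cV[K]_M := match s with
  | inl l => uvec (nth 0 (b i) l)
  | inr j => Ya j *m col i (L j) + be j 0 i *: uvec (a j) end.
pose f i (s : 'I_(di i) + 'I_k) : K := match s with
  | inl l => nth 0 (b i) l ^+ 2 | inr j => a j ^+ 2 end.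
have fi i : injective (@f i).
  have nb (l : 'I_(di i)) : nth 0 (b i) l \in b i by rewrite mem_nth // sb.
  case=> [l|j] [l'|j'] /(sqr_inj2 charK) => [/eqP|h|h|/ia -> //].
  - by rewrite nth_uniq ?sb // => /eqP/val_inj ->.
  - by have := ab j' i; rewrite -h nb.
  - by have := ab j i; rewrite h nb.
have /fin_all_exists[V hV] (li : 'I_M * 'I_m) : exists q : {poly K},
    (size q <= di li.2 + k)%N /\ forall s, q.[@f li.2 s] = val li.2 s li.1 0.
  have [q h1 h2] := interpolation (fun s => val li.2 s li.1 0) (@fi li.2).
  by exists q; split=> //; rewrite card_sum !card_ord in h1.
pose W : 'M[{poly K}]_(M, m) := \matrix_(l, i) V (l, i).
have WE j : map_mx (horner_eval (a j ^+ 2)) W = Ya j *m L j + uvec (a j) *m be j.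
  apply/matrixP => l i; rewrite map_mxE' [W _ _]mxE /horner_eval.
  have [_ /(_ (inr j)) /= ->] := hV (l, i).
  rewrite [LHS]mxE [RHS]mxE mxscaleE; congr (_ + _).
    by rewrite [LHS]mxE [RHS]mxE; apply: eq_bigr => x _; rewrite [col i _ _ _]mxE.
  by rewrite [RHS]mxE big_ord1 mulrC.
exists W; split.
- by move=> i l; rewrite mxE; have [] := hV (l, i).
- move=> j; rewrite WE mulmxDr !mulmxA w_uvec mul0mx addr0.
  have -> : Ya j = map_mx (horner_eval (a j)) sY.
    by apply/matrixP => l x; rewrite !map_mxE'; apply/esym/horner_sq.
  by rewrite -mulmx_horner wY map_mx0 mul0mx.
- move=> i z zb; apply/colP => l; rewrite map_mxE' [col i _ _ _]mxE [W _ _]mxE.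
  have hz : (index z (b i) < di i)%N by rewrite -sb index_mem.
  have [_ /(_ (inl (Ordinal hz)))] := hV (l, i).
  by rewrite /= nth_index.
move=> j v.
have -> : row_mx (map_mx (horner_eval (a j ^+ 2)) W) (Ya j) =
    row_mx (Ya j) (uvec (a j)) *m col_mx (row_mx (L j) 1%:M) (row_mx (be j) 0).
  by rewrite mul_row_col !mul_mx_row mulmx1 mulmx0 add_row_mx addr0 WE.
rewrite -mulmxA -hL; split=> [|->]; last by rewrite mulmx0.
set y := col_mx _ _ *m _; rewrite -[y]vsubmxK mul_row_col => h.
have yE l := congr1 (fun X : 'cV[K]_M => X l 0) h.
have aY x : (Bk c x).[a j] != 0 by rewrite -rootE root_prod_XsubC.
have y0 : usubmx y = 0.
  apply/colP => x; have := yE (rshift 1 (rshift 1 x)).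
  rewrite mxaddE mulmxE' [X in _ + X]mulmxE' big_ord1 /uvec !col_mxEd.
  rewrite [(0 : 'M_(_, _)) _ _]mxE mul0r addr0 [RHS]mxE (bigD1 x) //= big1.
    rewrite map_mxE' /Y /Y2 !col_mxEd !mxE eqxx mulr1n addr0 /horner_eval -horner_sq.
    by rewrite sq_vprod // horner_exp => /eqP; rewrite mulf_eq0 expf_eq0 (negbTE (aY x)) => /eqP.
  move=> y' /negbTE y'x; rewrite map_mxE' /Y /Y2 !col_mxEd !mxE eq_sym y'x mulr0n.
  by rewrite /horner_eval horner0 mul0r.
have := yE (rshift 1 (lshift n 0)); rewrite y0 mulmx0 add0r mulmxE' big_ord1.
rewrite /uvec col_mxEd col_mxEu [1%:M _ _]mxE eqxx mulr1n mul1r [RHS]mxE => h0.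
have y1 : dsubmx y = 0 by apply/colP => l; rewrite (ord1 l) h0 mxE.
by rewrite y1 col_mx0.
Qed.

Variables (C : 'M[K]_(m, n)) (V : 'M[{poly K}]_(M, m)).
Hypothesis sV : forall i l, (size (V l i) <= di i + k)%N.
Hypothesis bV : forall i z, z \in b i ->
  map_mx (horner_eval (z ^+ 2)) (col i V) = uvec z.
Hypothesis wV : forall j,
  map_mx (horner_eval (a j)) w *m map_mx (horner_eval (a j ^+ 2)) V = 0.
Hypothesis aV : forall j (v : 'cV[K]_(m + n)),
  row_mx (map_mx (horner_eval (a j ^+ 2)) V) (map_mx (horner_eval (a j ^+ 2)) Y)
    *m (block_mx 1%:M C 0 1%:M *m v) = 0 <-> (forall f, f \in T j -> v f 0 = 0).

Let sqV := map_mx sq V.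
Let h : 'rV[{poly K}]_m := w *m sqV.
Let p : 'rV[{poly K}]_m := \row_i (h 0 i %/ (e * B i ^+ 2)).

Lemma c0_bV i z : z \in b i -> (c0 sqV i).[z] = z.
Proof.
move=> /bV/colP/(_ (lshift _ 0)); rewrite map_mxE' mxE /c0 => hz.
by rewrite !mxE horner_sq [_.[_]]hz col_mxEu mxE mulr1n.
Qed.

Lemma c1_bV i z : z \in b i -> (c1 sqV i).[z] = 1.
Proof.
move=> /bV/colP/(_ (rshift _ (lshift _ 0))); rewrite map_mxE' mxE /c1 => hz.
by rewrite !mxE horner_sq [_.[_]]hz col_mxEd col_mxEu mxE mulr1n.
Qed.

Lemma cK_bV i x : B i ^+ 2 %| cK sqV x i.
Proof.
rewrite -sq_vprod // /cK !mxE; apply: dvdp_sq; apply: vprod_dvd => [|z].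
  by rewrite sqs_uniq.
case/mapP=> y /bV/colP/(_ (rshift _ (rshift _ x))) + ->.
by rewrite map_mxE' mxE !col_mxEd [RHS]mxE.
Qed.

(** In the first term both factors vanish at the zeros of B_i, and the others contain the
    square of B_i. *)
Lemma B_dvd_h i : B i ^+ 2 %| h 0 i.
Proof.
rewrite wgen_mul mulrDr mulr_sumr; apply: dvdp_add.
  rewrite [G * _]mulrA [G * _]mulrC -mulrA dvdp_mull // expr2.
  apply: dvdp_mul; first by rewrite (GE i) dvdp_mulr.
  apply: vprod_dvd => // z zb; rewrite hornerD hornerM hornerX c0_bV // c1_bV //.
  by rewrite mulr1 (addrr_pchar2 charK).
elim/big_rec: _ => [|x q _ hq]; first exact: dvdp0.
by apply: dvdp_add => //; rewrite mulrA dvdp_mull // cK_bV.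
Qed.

Lemma e_dvd_h i : e %| h 0 i.
Proof.
apply: vprod_dvd => [|z]; first by rewrite map_inj_uniq ?enum_uniq.
case/mapP=> j _ ->; have -> : (h 0 i).[a j] = (map_mx (horner_eval (a j)) h) 0 i.
  by rewrite map_mxE'.
rewrite /h mulmx_horner.
have -> : map_mx (horner_eval (a j)) sqV = map_mx (horner_eval (a j ^+ 2)) V.
  by apply/matrixP => l x; rewrite !map_mxE'; apply: horner_sq.
by rewrite wV mxE.
Qed.

Let eB i : coprimep e (B i).
Proof.
apply: vprod_coprime => z /mapP[j _ ->]; rewrite -rootE root_prod_XsubC.
exact: ab.
Qed.

Lemma pE i : p 0 i * e * B i ^+ 2 = h 0 i.
Proof.
rewrite mxE -mulrA divpK // Gauss_dvdp ?e_dvd_h ?B_dvd_h //.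
by rewrite expr2 coprimepMr eB.
Qed.

Let size_GH : (size (G * HH c)%R <= d - k)%N.
Proof.
apply: (leq_trans (size_polyMleq _ _)); rewrite !size_prod_vprod.
rewrite (eq_bigr di) => [|i _ //]; rewrite (eq_bigr (fun x => dk x + k)%N) => [|x _ //].
rewrite big_split /= sum_nat_const card_ord.
by move: sum_d; move: (\sum_i _)%N (\sum_x _)%N => A1 A2; clear; nia.
Qed.

Lemma size_w i : (size (w 0%R i) <= (d - k).+1)%N.
Proof.
rewrite -(splitK i); case: (split i) => x /=.
  by rewrite row_mxEl !ord1 mxE mulr1n; apply: leqW.
rewrite row_mxEr -(splitK x); case: (split x) => y /=.
  rewrite row_mxEl !ord1 mxE mulr1n; apply: (leq_trans (size_polyMleq _ _)).
  by rewrite size_polyX addn2 /= ltnS.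
rewrite row_mxEr mxE; apply: leqW; apply: leq_trans size_GH.
apply: dvdp_leq; last by rewrite (HHE c y) mulrCA dvdp_mull.
by rewrite mulf_neq0 //; apply/prodf_neq0 => y' _; apply: vprod_neq0.
Qed.

Lemma size_mul_vprod2 (q : {poly K}) t : q != 0 ->
  size (q * vprod t ^+ 2) = (size q + 2 * size t)%N.
Proof.
move=> q0; rewrite expr2 mulrA !size_mul ?mulf_neq0 ?vprod_neq0 // size_vprod.
by move: q0; rewrite -size_poly_gt0; move: (size q) (size t) => x y; clear; lia.
Qed.

Lemma size_p i : (size (p 0%R i) <= d.+1)%N.
Proof.
have [->|p0] := eqVneq (p 0 i) 0; first by rewrite size_poly0.
have dk_d : (k <= d)%N by rewrite -sum_d; clear; nia.
have hh : (size (h 0%R i) <= (d - k + 2 * (di i + k)).+1)%N.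
  have -> : h 0 i = (w *m map_mx sq (col i V)) 0 0.
    rewrite [LHS]mulmxE' [RHS]mulmxE'; apply: eq_bigr => x _; congr (_ * _).
    by rewrite !map_mxE' [col _ _ _ _]mxE.
  apply: size_row_sq => [|l]; first exact: size_w.
  by rewrite mxE; apply: leqW; apply: sV.
move: hh; rewrite -pE size_mul_vprod2 ?mulf_neq0 // size_mul // size_vprod sb.
rewrite size_map size_enum_ord; move: p0 dk_d; rewrite -size_poly_gt0.
by move: (size _) (di i) => x y; clear; lia.
Qed.

(** In the coordinates of Dold the solutions are easy to find; Gmx changes them so that
    the conditions at the a_j are on the coordinates in T j. *)
Definition Dold : 'M[{poly K}]_(m + M, m + n) :=
  block_mx (diag_mx (\row_i vprod (sqs (b i)))) 0 V Y.
Definition Gmx : 'M[{poly K}]_(m + n) := block_mx 1%:M (map_mx polyC C) 0 1%:M.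
Definition D2 := Dold *m Gmx.

Let sqD := block_mx (diag_mx (\row_i B i ^+ 2)) 0 sqV sY.

Lemma sq_Dold : map_mx sq Dold = sqD.
Proof.
rewrite map_block_mx; congr (block_mx _ _ _ _).
  apply/matrixP => i j; rewrite map_mxE' !mxE.
  by case: eqP => _; rewrite ?mulr1n ?mulr0n ?sq_vprod ?comp_poly0.
by apply/matrixP => i j; rewrite map_mxE' !mxE comp_poly0.
Qed.

Lemma sq_Gmx : map_mx sq Gmx = Gmx.
Proof.
rewrite map_block_mx; congr (block_mx _ _ _ _); apply/matrixP => i j;
  rewrite map_mxE' ?map_mxE' ?mxE ?comp_polyC //.
- by case: eqP => _; rewrite ?mulr1n ?mulr0n ?comp_polyC ?comp_poly0.
- by case: eqP => _; rewrite ?mulr1n ?mulr0n ?comp_polyC ?comp_poly0.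
Qed.

Lemma sq_D2 : map_mx sq D2 = sqD *m Gmx.
Proof. by rewrite /D2 sq_mx_mul sq_Dold sq_Gmx. Qed.

Lemma Gmx_mul (v1 : 'cV[{poly K}]_m) (v2 : 'cV_n) :
  Gmx *m col_mx v1 v2 = col_mx (v1 + map_mx polyC C *m v2) v2.
Proof. by rewrite mul_block_col !mul1mx mul0mx add0r. Qed.

Lemma wD : wrow p e w *m map_mx sq D2 = 0.
Proof.
rewrite sq_D2 mulmxA mul_row_block mulmx0 add0r wY.
rewrite (_ : (e *: p) *m _ + _ = 0) ?row_mx0 ?mul0mx //.
apply/matrixP => i j; rewrite (ord1 i) mxaddE [(w *m _) _ _](_ : _ = h 0 j) // -pE.
have -> : ((e *: p) *m diag_mx (\row_i B i ^+ 2)) 0 j = p 0 j * e * B j ^+ 2.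
  by rewrite mul_mx_diag [LHS]mxE mxscaleE [(\row_(i < m) B i ^+ 2) _ _]mxE [e * p 0 j]mulrC.
by rewrite (addrr_pchar2 cp) mxE.
Qed.

Lemma sqD_inj (v1 : 'cV_m) (v2 : 'cV_n) :
  sqD *m col_mx v1 v2 = 0 -> v1 = 0 /\ v2 = 0.
Proof.
rewrite mul_block_col mul0mx addr0 => /eqP; rewrite col_mx_eq0 => /andP[/eqP h1 /eqP h2].
have v10 : v1 = 0.
  apply/colP => i; move/colP: h1 => /(_ i); rewrite mul_diag_mx !mxE => /eqP.
  by rewrite mulf_eq0 expf_eq0 (negbTE (B0 i)) => /eqP.
split=> //; move: h2; rewrite v10 mulmx0 add0r => h2.
apply/colP => x; move/colP: h2 => /(_ (rshift _ (rshift _ x))).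
rewrite mulmxE' (bigD1 x) //= big1 => [|y yx].
  rewrite -[sY _ _]/(sY (rshift _ (rshift _ x)) x).
  have -> : sY (rshift 1 (rshift 1 x)) x = Bk c x ^+ 2.
    by have := cK_Y2 charK c x x; rewrite eqxx mulr1n /cK !mxE.
  rewrite addr0 [RHS]mxE => /eqP; rewrite mulf_eq0 expf_eq0 (negbTE (vprod_neq0 _)).
  by rewrite [RHS]mxE => /eqP.
have -> : sY (rshift 1 (rshift 1 x)) y = 0.
  by have := cK_Y2 charK c x y; rewrite eq_sym (negbTE yx) mulr0n /cK !mxE.
by rewrite mul0r.
Qed.

Lemma D_inj (v : 'cV_(m + n)) : map_mx sq D2 *m v = 0 -> v = 0.
Proof.
rewrite sq_D2 -mulmxA -[v]vsubmxK Gmx_mul => /sqD_inj[h1 h2].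
by move: h1; rewrite h2 mulmx0 addr0 => ->; rewrite col_mx0.
Qed.

Lemma D_pts j (v : 'cV[K]_(m + n)) :
  map_mx (horner_eval (a j ^+ 2)) (dsubmx D2) *m v = 0 <->
    (forall f, f \in T j -> v f 0 = 0).
Proof.
rewrite -aV; have -> : dsubmx D2 = row_mx V Y *m Gmx.
  by rewrite /D2 /Dold block_mxEv mul_col_mx col_mxKd.
have -> : map_mx (horner_eval (a j ^+ 2)) (row_mx V Y *m Gmx) =
    row_mx (map_mx (horner_eval (a j ^+ 2)) V) (map_mx (horner_eval (a j ^+ 2)) Y)
      *m block_mx 1%:M C 0 1%:M.
  rewrite mulmx_horner map_row_mx; congr (_ *m _); rewrite map_block_mx.
  congr (block_mx _ _ _ _); apply/matrixP => i x; rewrite !map_mxE' ?mxE /horner_eval.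
  - by case: eqP => _; rewrite ?mulr1n ?mulr0n hornerE.
  - by rewrite hornerE.
  - by rewrite hornerE.
  - by case: eqP => _; rewrite ?mulr1n ?mulr0n hornerE.
by rewrite mulmxA.
Qed.

Lemma size_Du i f : (size (usubmx D2 i f) <=
  (match split f with inl j => di j | inr x => dk x end).+1)%N.
Proof.
have -> : usubmx D2 = row_mx (diag_mx (\row_i vprod (sqs (b i)))) 
    (diag_mx (\row_i vprod (sqs (b i))) *m map_mx polyC C).
  rewrite /D2 /Dold block_mxEv mul_col_mx col_mxKu mul_row_block.
  by rewrite !mul0mx !addr0 mulmx1.
have sB x : (size (vprod (sqs (b x))) <= (di x).+1)%N by rewrite size_vprod size_map sb.
rewrite -(splitK f); case: (split f) => y /=; rewrite ?(unsplitK (inl y)) ?(unsplitK (inr y)).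
  rewrite row_mxEl !mxE; case: eqP => [->|_]; rewrite ?mulr1n ?mulr0n ?size_poly0 //.
rewrite row_mxEr mul_diag_mx !mxE mulrC mul_polyC; apply: (leq_trans (size_scale_leq _ _)).
by apply: (leq_trans (sB i)); rewrite ltnS.
Qed.

Lemma size_Y2 l x : (size (Y l x) <= (dk x + k).+1)%N.
Proof.
have sBk y : size (Bk c y) = (dk y + k).+1 by rewrite size_vprod sc.
rewrite -(splitK l); case: (split l) => y /=.
  rewrite /Y /Y2 col_mxEu mxE; apply: (leq_trans (size_even_poly _)); rewrite sBk.
  by rewrite leq_uphalf_double -addnn addSn ltnS -addnS leq_addr.
rewrite /Y /Y2 col_mxEd -(splitK y); case: (split y) => z /=.
  rewrite col_mxEu mxE; apply: (leq_trans (size_odd_poly _)); rewrite sBk.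
  by move: (dk x + k)%N => q; clear; lia.
rewrite col_mxEd !mxE; case: eqP => [->|_]; rewrite ?mulr1n ?mulr0n ?size_poly0 //.
by rewrite size_vprod size_map sc.
Qed.

Lemma size_Dd l f : (size (dsubmx D2 l f) <=
  (match split f with inl j => di j | inr x => dk x end + k).+1)%N.
Proof.
have -> : dsubmx D2 = row_mx V (V *m map_mx polyC C + Y).
  by rewrite /D2 /Dold block_mxEv mul_col_mx col_mxKd mul_row_block mulmx1 !mulmx0 addr0 mulmx1.
rewrite -(splitK f); case: (split f) => y /=; rewrite ?(unsplitK (inl y)) ?(unsplitK (inr y)).
  by rewrite row_mxEl; apply: leqW; apply: sV.
rewrite row_mxEr mxaddE; apply: (leq_trans (size_polyD _ _)); rewrite geq_max size_Y2 andbT.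
rewrite mulmxE'; apply: (leq_trans (size_sum _ _ _)); apply/bigmax_leqP => i _.
rewrite map_mxE' mulrC mul_polyC; apply: (leq_trans (size_scale_leq _ _)).
by apply: (leq_trans (sV _ _)); apply: leqW; rewrite leq_add2r.
Qed.

Let B_Bk i x : coprimep (B i ^+ 2) (Bk c x ^+ 2).
Proof.
rewrite coprimep_expl // coprimep_expr //; apply: vprod_coprime => z zb.
by rewrite -rootE root_prod_XsubC; apply: bc zb.
Qed.

Let B_Gi i : coprimep (B i ^+ 2) (Gi i ^+ 2).
Proof.
rewrite coprimep_expl // coprimep_expr // /Gi.
elim/big_rec: _ => [|j q ji hq]; first exact: coprimep1.
rewrite coprimepMr hq andbT; apply: vprod_coprime => z zb.
by rewrite -rootE root_prod_XsubC; apply: contra ji => zj; apply/eqP/(db zj zb).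
Qed.

Let B_Gj i j : j != i -> B i ^+ 2 %| Gi j ^+ 2.
Proof.
by move=> ji; rewrite /Gi (bigD1 i) 1?eq_sym //= exprMn dvdp_mulr.
Qed.

Let G_dvd q : (forall i, B i ^+ 2 %| q) -> G ^+ 2 %| q.
Proof.
move=> hq; rewrite /G -prodrXl; apply: (coprime_prod_dvd (index_enum_uniq _)) => // i j ij.
rewrite coprimep_expl // coprimep_expr //; apply: vprod_coprime => z zb.
by rewrite -rootE root_prod_XsubC; apply: contra ij => zj; apply/eqP/(db zb zj).
Qed.

Lemma B_sqV i : coprimep (B i ^+ 2) (c1 sqV i).
Proof.
rewrite coprimep_expl //; apply: vprod_coprime => z zb.
by rewrite c1_bV // oner_eq0.
Qed.

(** Clearing the denominators B_i of the p_i turns Z into a syzygy of w; reducing modulo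
    the squares of the B_i then shows that it was a combination of the columns of D. *)
Lemma span_Dold (x : 'cV_m) (v : 'cV_M) : wrow p e w *m col_mx x v = 0 ->
  map_mx deriv (wrow p e w) *m col_mx x v = 0 ->
  exists v1 v2, x = diag_mx (\row_i B i ^+ 2) *m v1 /\ v = sqV *m v1 + sY *m v2.
Proof.
move=> h1 h2.
pose y : 'cV_m := \col_i (Gi i ^+ 2 * x i 0).
have dB i : (B i ^+ 2)^`() = 0.
  by rewrite -sq_vprod //; apply: deriv_sq.
have hy : h *m y = G ^+ 2 *: ((e *: p) *m x).
  apply/matrixP => i j; rewrite !ord1 mxscaleE !mulmxE' mulr_sumr.
  apply: eq_bigr => l _; rewrite -pE mxscaleE [y _ _]mxE (GE l); ring.
have hy' : map_mx deriv h *m y = G ^+ 2 *: (map_mx deriv (e *: p) *m x).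
  apply/matrixP => i j; rewrite !ord1 mxscaleE !mulmxE' mulr_sumr.
  apply: eq_bigr => l _; rewrite !map_mxE' mxscaleE -pE.
  rewrite [(_ * B l ^+ 2)^`()]derivM dB mulr0 addr0 [e * _]mulrC [y _ _]mxE (GE l); ring.
have [q hq] : exists q : 'cV_n, G ^+ 2 *: v + sqV *m y = sY *m q.
  apply: (wgen_span charK G0 uc dc).
    rewrite mulmxDr mulmxA -/h hy -scalemxAr -scalerDr.
    by move: h1; rewrite mul_row_col addrC => ->; rewrite scaler0.
  have -> : map_mx deriv (wgen G c) *m (G ^+ 2 *: v + sqV *m y) =
      G ^+ 2 *: (map_mx deriv w *m v) + map_mx deriv h *m y.
    by rewrite /h deriv_mul_sq // mulmxDr mulmxA -scalemxAr.
  rewrite hy' -scalerDr.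
  by move: h2; rewrite map_row_mx mul_row_col addrC => ->; rewrite scaler0.
have E0 l : G ^+ 2 * v l 0 + \sum_i sqV l i * (Gi i ^+ 2 * x i 0) = \sum_t sY l t * q t 0.
  have /colP/(_ l) := hq; rewrite mxaddE mxscaleE !mulmxE' => <-; congr (_ + _).
  by apply: eq_bigr => i _; rewrite [y _ _]mxE.
have dG i : B i ^+ 2 %| G ^+ 2 by rewrite (GE i) exprMn dvdp_mulr.
have dsum i l : B i ^+ 2 %| (\sum_(j | j != i) sqV l j * (Gi j ^+ 2 * x j 0)).
  elim/big_rec: _ => [|j t ji ht]; first exact: dvdp0.
  by apply: dvdp_add => //; rewrite dvdp_mull // dvdp_mulr // B_Gj.
have dq i t : B i ^+ 2 %| q t 0.
  rewrite -(Gauss_dvdpr _ (B_Bk i t)).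
  have -> : Bk c t ^+ 2 * q t 0 = \sum_t' sY (rshift 1 (rshift 1 t)) t' * q t' 0.
    have cE t' := cK_Y2 charK c t t'.
    rewrite (bigD1 t) //= big1 => [|t' tt'].
      by rewrite addr0; congr (_ * _); have := cE t; rewrite eqxx mulr1n /cK !mxE.
    by have := cE t'; rewrite eq_sym (negbTE tt') mulr0n /cK !mxE => ->; rewrite mul0r.
  rewrite -E0 (bigD1 i) //=; apply: dvdp_add; first by rewrite dvdp_mulr.
  apply: dvdp_add => //; apply: dvdp_mulr.
  by have := cK_bV i t; rewrite /cK !mxE.
have /fin_all_exists[v1 hv1] i : exists u, x i 0 = B i ^+ 2 * u.
  suff /dvdpP[u ->] : B i ^+ 2 %| x i 0 by exists u; rewrite mulrC.
  rewrite -(Gauss_dvdpr _ (B_Gi i)) -(Gauss_dvdpr _ (B_sqV i)).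
  have -> : c1 sqV i = sqV (rshift 1 (lshift n 0)) i by rewrite /c1 !mxE.
  have := E0 (rshift 1 (lshift n 0)); rewrite (bigD1 i) //=.
  rewrite addrCA => /(congr1 (fun t => t + (G ^+ 2 * v (rshift 1 (lshift n 0)) 0 +
    \sum_(j | j != i) sqV (rshift 1 (lshift n 0)) j * (Gi j ^+ 2 * x j 0)))).
  rewrite -addrA (addrr_pchar2 cp) addr0 => ->.
  apply: dvdp_add; last by apply: dvdp_add => //; rewrite dvdp_mulr.
  elim/big_rec: _ => [|t u _ hu]; first exact: dvdp0.
  by apply: dvdp_add => //; rewrite dvdp_mull.
have /fin_all_exists[v2 hv2] t : exists u, q t 0 = G ^+ 2 * u.
  by have /dvdpP[u ->] := G_dvd (dq^~ t); exists u; rewrite mulrC.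
exists (\col_i v1 i), (\col_t v2 t); split.
  by apply/colP => i; rewrite mul_diag_mx !mxE hv1.
apply/colP => l; rewrite mxaddE !mulmxE'; apply: (mulfI (_ : G ^+ 2 != 0)).
  by rewrite expf_neq0.
have := E0 l.
have -> : \sum_i sqV l i * (Gi i ^+ 2 * x i 0) = G ^+ 2 * \sum_i sqV l i * (\col_i v1 i) i 0.
  by rewrite mulr_sumr; apply: eq_bigr => i _; rewrite hv1 mxE (GE i); ring.
have -> : \sum_t sY l t * q t 0 = G ^+ 2 * \sum_t sY l t * (\col_t v2 t) t 0.
  by rewrite mulr_sumr; apply: eq_bigr => i _; rewrite hv2 mxE; ring.
rewrite mulrDr => <-; rewrite addrC -addrA (addrr_pchar2 cp) addr0.
by [].
Qed.

(** The first components of Z bound the first coordinates of c, and then the last ones of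
    Z bound the others; the change of coordinates Gmx respects these bounds because
    di is at most dk. *)
Lemma D_span A (Z : 'cV[{poly K}]_(m + M)) : wrow p e w *m Z = 0 ->
  map_mx deriv (wrow p e w) *m Z = 0 ->
  (forall i, (size (usubmx Z i 0%R) <= A)%N) ->
  (forall i, (size (dsubmx Z i 0%R) <= A + 2 * k)%N) ->
  exists2 v, Z = map_mx sq D2 *m v &
    forall f, (size (v f 0%R) <= A - 2 * match split f with inl j => di j | inr x => dk x end)%N.
Proof.
rewrite -{1 2}[Z]vsubmxK => h1 h2 hu hd.
have [v1 [v2 [xE vE]]] := span_Dold h1 h2.
have s1 i : (size (v1 i 0%R) <= A - 2 * di i)%N.
  have [->|v0] := eqVneq (v1 i 0) 0; first by rewrite size_poly0.
  have := hu i; rewrite xE mul_diag_mx [(\matrix_(_, _) _) _ _]mxE [(\row_i _) _ _]mxE.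
  rewrite mulrC size_mul_vprod2 // sb.
  by move: (size _) (di i) => t u; clear; lia.
have s2 x : (size (v2 x 0%R) <= A - 2 * dk x)%N.
  have [->|v0] := eqVneq (v2 x 0) 0; first by rewrite size_poly0.
  have hx : v2 x 0 * Bk c x ^+ 2 = dsubmx Z (rshift 1 (rshift 1 x)) 0 +
      (sqV *m v1) (rshift 1 (rshift 1 x)) 0.
    rewrite vE mxaddE addrAC (addrr_pchar2 cp) add0r mulmxE'.
    have cE y := cK_Y2 charK c x y.
    rewrite (bigD1 x) //= big1 => [|y yx].
      rewrite addr0 mulrC; congr (_ * _); have := cE x.
      by rewrite eqxx mulr1n /cK !mxE.
    by have := cE y; rewrite eq_sym (negbTE yx) mulr0n /cK !mxE => ->; rewrite mul0r.
  have : (size (v2 x 0 * Bk c x ^+ 2)%R <= A + 2 * k)%N.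
    rewrite hx; apply: (leq_trans (size_polyD _ _)); rewrite geq_max hd /=.
    rewrite mulmxE'; apply: (leq_trans (size_sum _ _ _)); apply/bigmax_leqP => i _.
    have [->|vi0] := eqVneq (v1 i 0) 0; first by rewrite mulr0 size_poly0.
    apply: (leq_trans (size_polyMleq _ _)); rewrite map_mxE'.
    have := size_sq (leqW (sV i (rshift 1 (rshift 1 x)))).
    have := s1 i; move: vi0; rewrite -size_poly_gt0.
    by move: (size _) (size _) (di i) => t u z; clear; lia.
  rewrite size_mul_vprod2 // sc.
  by move: (size _) (dk x) => t u; clear; lia.
exists (col_mx (v1 + map_mx polyC C *m v2) v2).
  rewrite sq_D2 -mulmxA Gmx_mul -addrA.
  have -> : map_mx polyC C *m v2 + map_mx polyC C *m v2 = 0 by apply: mxoppr2.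
  by rewrite addr0 mul_block_col mul0mx addr0 -xE -vE vsubmxK.
move=> f; rewrite -{1}(splitK f); case: (split f) => y /=; last by rewrite col_mxEd.
rewrite col_mxEu mxaddE; apply: (leq_trans (size_polyD _ _)); rewrite geq_max s1 /=.
rewrite mulmxE'; apply: (leq_trans (size_sum _ _ _)); apply/bigmax_leqP => x _.
rewrite map_mxE' mul_polyC; apply: (leq_trans (size_scale_leq _ _)).
by apply: (leq_trans (s2 x)); apply: leq_sub2l; rewrite leq_mul2l /= hle.
Qed.
End Construction.

(** * Splitting types with prescribed pairs *)

Lemma set_between (I : finType) (A B : {set I}) m : A \subset B ->
  (#|A| <= m <= #|B|)%N -> exists S : {set I}, [/\ A \subset S, S \subset B & #|S| = m].
Proof.
move=> AB /andP[Am mB]; pose t := take (m - #|A|) (enum (B :\: A)).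
have tB x : x \in t -> x \in B :\: A by move/mem_take; rewrite mem_enum.
have st : #|[set x in t]| = (m - #|A|)%N.
  rewrite cardsE; have /card_uniqP -> : uniq t by rewrite take_uniq // enum_uniq.
  rewrite size_takel // -cardE cardsD (setIidPr AB).
  by rewrite leq_sub2r.
exists (A :|: [set x in t]); split; first exact: subsetUl.
  by rewrite subUset AB; apply/subsetP => x; rewrite inE => /tB; rewrite inE => /andP[].
rewrite cardsU st (_ : A :&: _ = set0) ?cards0 ?subn0 ?subnKC //.
by apply/setP => x; rewrite !inE; apply/negP => /andP[xA /tB]; rewrite inE xA.
Qed.

(** By induction on k: the next set contains the points of the largest multiplicity k and
    no point of multiplicity zero, which the two ways of bounding the sum allow. *)
Lemma sets_with_multiplicities (I : finType) k m (nu : I -> nat) :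
  (forall f, nu f <= k)%N -> (\sum_f nu f = k * m)%N ->
  exists T : 'I_k -> {set I}, (forall j, #|T j| = m) /\
    forall f, #|[set j | f \in T j]| = nu f.
Proof.
elim: k nu => [|k IH] nu hnu hs.
  exists (fun=> set0); split=> [[]//|f].
  by have := hnu f; rewrite leqn0 => /eqP ->; apply/eqP; rewrite cards_eq0; apply/eqP/setP => -[].
pose A := [set f | nu f == k.+1]; pose B := [set f | 0 < nu f]%N.
have AB : A \subset B by apply/subsetP => f; rewrite !inE => /eqP ->.
have cA : (#|A| <= m)%N.
  rewrite -(leq_pmul2l (ltn0Sn k)) -hs -sum1_card big_distrr /= big_mkcond.
  by apply: leq_sum => f _; rewrite inE; case: eqP => // ->; rewrite muln1.
have cB : (m <= #|B|)%N.
  rewrite -(leq_pmul2l (ltn0Sn k)) -hs -sum1_card big_distrr /= [leqRHS]big_mkcond.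
  apply: leq_sum => f _; rewrite inE muln1; case: (posnP (nu f)) => [->//|_].
  exact: hnu.
have [|S [AS SB cS]] := @set_between _ A B m AB; first by rewrite cA.
pose nu' f := (nu f - (f \in S))%N.
have nuE f : nu f = ((f \in S) + nu' f)%N.
  rewrite /nu' subnKC //; case: (boolP (f \in S)) => // /(subsetP SB).
  by rewrite inE.
have [f||T' [cT' mT']] := IH nu'.
- have := hnu f; rewrite leq_eqVlt => /orP[h|h].
    have -> : nu' f = k by rewrite /nu' (eqP h) (subsetP AS) ?inE // subn1.
    by [].
  by rewrite /nu'; apply: leq_trans (leq_subr _ _) _.
- move: hs; rewrite (eq_bigr (fun f => (f \in S) + nu' f)%N) // big_split /=.
  by rewrite -big_mkcond /= sum1_card cS mulSn => /addnI.
exists (fun j => if unlift ord0 j is Some j' then T' j' else S); split.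
  by move=> j; case: (unlift ord0 j).
move=> f; rewrite nuE -mT' -!sum1dep_card big_mkcond big_ord_recl /= unlift_none.
rewrite [in RHS]big_mkcond; congr (_ + _)%N.
by apply: eq_bigr => j _; rewrite liftK.
Qed.

Section Existence.
Variable K : closedFieldType.
Hypothesis charK : 2%N \in [pchar K].

(** The points a_j and the roots of the B_i and Bk are distinct values of an injection. *)
Lemma model_exists s n d k M (nu de : 'I_(s.+1 + n) -> nat) : M = n.+2 ->
  (forall f, nu f <= k)%N -> (\sum_f nu f = k * n.+1)%N ->
  (\sum_f de f + k * n.+1 + 1 = d)%N ->
  (forall i x, de (lshift n i) <= de (rshift s.+1 x))%N ->
  exists (p : 'rV[{poly K}]_s.+1) (w : 'rV[{poly K}]_M) (a : 'I_k -> K)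
    (T : 'I_k -> {set 'I_(s.+1 + n)}) (D2 : 'M[{poly K}]_(s.+1 + M, s.+1 + n)),
  [/\ injective a, forall f, #|[set j | f \in T j]| = nu f,
      forall i, (size (p 0%R i) <= d.+1)%N, forall i, (size (w 0%R i) <= (d - k).+1)%N &
  [/\ wrow p (vprod (allpts a)) w *m map_mx sq D2 = 0,
      forall v : 'cV_(s.+1 + n), map_mx sq D2 *m v = 0 -> v = 0,
      forall A (Z : 'cV[{poly K}]_(s.+1 + M)), wrow p (vprod (allpts a)) w *m Z = 0 ->
        map_mx deriv (wrow p (vprod (allpts a)) w) *m Z = 0 ->
        (forall i, (size (usubmx Z i 0%R) <= A)%N) ->
        (forall i, (size (dsubmx Z i 0%R) <= A + 2 * k)%N) ->
        exists2 v, Z = map_mx sq D2 *m v & forall f, (size (v f 0%R) <= A - 2 * de f)%N,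
      forall j (v : 'cV[K]_(s.+1 + n)),
        map_mx (horner_eval (a j ^+ 2)) (dsubmx D2) *m v = 0 <->
          (forall f, f \in T j -> v f 0 = 0) &
      (forall i f, (size (usubmx D2 i f) <= (de f).+1)%N) /\
      (forall i f, (size (dsubmx D2 i f) <= (de f + k).+1)%N)]].
Proof.
move=> -> hnu sum_nu sum_de hle.
have [T [cT mT]] := sets_with_multiplicities hnu sum_nu.
pose di i := de (lshift n i); pose dk x := de (rshift s.+1 x).
have deE f : match split f with inl j => di j | inr x => dk x end = de f.
  by rewrite -[in RHS](splitK f); case: (split f).
have sum_d : (\sum_i di i + \sum_x dk x + k * n.+1 + 1 = d)%N.
  by rewrite -sum_de big_split_ord.
pose I : finType := ('I_k + {i : 'I_s.+1 & 'I_(di i)} + {x : 'I_n & 'I_(dk x + k)})%type.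
have [pt ipt] := injection_ex K I.
pose a j := pt (inl (inl j)).
pose b i := [seq pt (inl (inr (Tagged (fun i => 'I_(di i)) l))) | l <- enum 'I_(di i)].
pose c x := [seq pt (inr (Tagged (fun x => 'I_(dk x + k)) l)) | l <- enum 'I_(dk x + k)].
have ia : injective a by move=> i j /ipt[].
have ub i : uniq (b i).
  rewrite map_inj_uniq ?enum_uniq // => l l' /ipt[] /eqP.
  by rewrite eq_Tagged => /eqP.
have uc x : uniq (c x).
  rewrite map_inj_uniq ?enum_uniq // => l l' /ipt[] /eqP.
  by rewrite eq_Tagged => /eqP.
have sb i : size (b i) = di i by rewrite size_map size_enum_ord.
have sc x : size (c x) = (dk x + k)%N by rewrite size_map size_enum_ord.
have ab j i : a j \notin b i by apply/mapP => -[l _ /ipt].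
have ac j x : a j \notin c x by apply/mapP => -[l _ /ipt].
have bc i x z : z \in b i -> z \notin c x.
  by move=> /mapP[l _ ->]; apply/mapP => -[l' _ /ipt].
have db i j z : z \in b i -> z \in b j -> i = j.
  by move=> /mapP[l _ ->] /mapP[l' _ /ipt[]].
have dc x y z : z \in c x -> z \in c y -> x = y.
  by move=> /mapP[l _ ->] /mapP[l' _ /ipt[]].
have [C [V [sV wV bV aV]]] := interpolate_vec charK cT ia ub sb ab ac.
eexists; eexists; exists a, T, (D2 b c C V); split=> //.
- exact: (size_p charK sum_d ia ub sb sc ab sV bV wV).
- exact: (size_w sum_d sb sc).
split.
- exact: (wD charK ia ub ab C bV wV).
- by move=> v; apply: D_inj.
- move=> A Z h1 h2 hu hd.
  have [v Zv hv] := D_span charK hle ia ub uc sb sc ab bc db dc C sV bV wV h1 h2 hu hd.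
  by exists v => // f; have := hv f; rewrite deE.
- exact: (D_pts b aV).
split=> i f.
- by have := size_Du hle c sb C V i f; rewrite deE.
- by have := size_Dd hle b sc C sV i f; rewrite deE.
Qed.

(** The conditions on the pairs are those under which one of the three systems is
    surjective at the explicit map. *)
Theorem splitting_general r s d k n (nu de : 'I_(s.+1 + n) -> nat) : (k < d)%N ->
  (r - s = n.+2)%N -> (forall f, nu f <= k)%N -> (\sum_f nu f = k * n.+1)%N ->
  (\sum_f de f + k * n.+1 + 1 = d)%N ->
  (forall i x, de (lshift n i) <= de (rshift s.+1 x))%N ->
  (forall f, [\/ forall j, (d + nu j + 2 * de j <= (d + nu f + 2 * de f).+1)%N,
     nu f = 0%N /\ forall j, (nu j + de j <= (de f).+1)%N |
     nu f = k /\ forall j, (de j <= (de f).+1)%N]) ->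
  general (fun f : map_X K r s d k => unramified f -> iso_split (normal_bundle f)
    [seq Posz (d + nu j + 2 * de j) | j <- enum 'I_(s.+1 + n)]).
Proof.
move=> hkd hM hnu sum_nu sum_de hle H.
have [p [w [a [T [E [ia mT sp sw [h1 h2 h3 h4 [h5 h6]]]]]]]] :=
  model_exists hM hnu sum_nu sum_de hle.
have hsr : (s + 2 <= r)%N by move: hM; clear; lia.
have hR : (3 + (s.+1 + n) = s.+1 + (1 + (r - s)))%N by rewrite hM; clear; lia.
have hM1 : (r - s - 1 = n.+1)%N by rewrite hM subSS subn0.
apply: (@model_splitting K r s d k charK hkd hsr _ hR nu de _ _ p w a T E) => //.
- by rewrite hM1.
- by rewrite hM1.
Qed.
End Existence.

Section Types.
Variable K : closedFieldType.
Hypothesis charK : 2%N \in [pchar K].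
Variables (r s d k : nat).
Hypothesis hkd : (k < d)%N.
Hypothesis hsr : (s + 2 <= r)%N.

(** Sorting the pairs by their second component provides the order that the explicit map
    requires. *)
Lemma splitting_seq (ps : seq (nat * nat)) : size ps = (r - 1)%N ->
  (forall x, x \in ps -> (x.1 <= k)%N) ->
  (\sum_(x <- ps) x.1 = k * (r - s - 1))%N ->
  (\sum_(x <- ps) x.2 + k * (r - s - 1) + 1 = d)%N ->
  (forall x, x \in ps ->
    [\/ forall y, y \in ps -> (y.1 + 2 * y.2 <= (x.1 + 2 * x.2).+1)%N,
       x.1 = 0%N /\ forall y, y \in ps -> (y.1 + y.2 <= x.2.+1)%N |
       x.1 = k /\ forall y, y \in ps -> (y.2 <= x.2.+1)%N]) ->
  general (fun f : map_X K r s d k => unramified f /\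
    iso_split (normal_bundle f) [seq Posz (d + x.1 + 2 * x.2) | x <- ps]).
Proof.
move=> sps hk hnu hde H; pose n := (r - s - 2)%N.
have hM : (r - s = n.+2)%N by rewrite /n; move: hsr; clear; lia.
have hR : (r - 1 = s.+1 + n)%N by rewrite /n; move: hsr; clear; lia.
have hM1 : (r - s - 1 = n.+1)%N by rewrite hM subSS subn0.
pose le2 (x y : nat * nat) := (x.2 <= y.2)%N.
pose qs := sort le2 ps.
have pq : perm_eq qs ps by rewrite perm_sort.
have mq x : (x \in qs) = (x \in ps) by rewrite (perm_mem pq).
have sq' : size qs = (s.+1 + n)%N by rewrite size_sort sps hR.
have srt : sorted le2 qs by apply: sort_sorted => x y; apply: leq_total.
pose nx (j : 'I_(s.+1 + n)) := nth (0, 0)%N qs j.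
have nxq j : nx j \in ps by rewrite -mq mem_nth // sq'.
have sumE (F : nat * nat -> nat) : (\sum_(j < s.+1 + n) F (nx j) = \sum_(x <- ps) F x)%N.
  by rewrite -(perm_big _ pq) /= (big_nth (0, 0)%N) sq' big_mkord.
have := splitting_general charK (nu := fun j => (nx j).1) (de := fun j => (nx j).2) hkd hM.
rewrite !sumE -hM1 => /(_ _ hnu hde) G.
have {}G := G (fun f => hk _ (nxq f)).
have hle i x : ((nx (lshift n i)).2 <= (nx (rshift s.+1 x)).2)%N.
  have := sorted_leq_nth _ _ (0, 0)%N srt.
  move=> /(_ (fun x y z => @leq_trans _ _ _) (fun x => leqnn _)).
  have hi := ltn_ord i; have hx := ltn_ord x.
  apply; rewrite ?inE ?sq' /=; move: hi hx; move: (i : nat) (x : nat) => u v; clear; lia.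
have {}G := G hle; apply: (general_imp (unramified_general hkd hsr charK) (G _)) => f.
  have [h|[h1 h2]|[h1 h2]] := H _ (nxq f).
  - by apply: Or31 => j; rewrite -!addnA -addnS leq_add2l; apply: h.
  - by apply: Or32; split=> // j; apply: h2.
  - by apply: Or33; split=> // j; apply: h2.
move=> h1 h2; split=> //; apply: iso_split_perm (h2 h1).
have -> : [seq Posz (d + (nx j).1 + 2 * (nx j).2) | j <- enum 'I_(s.+1 + n)] =
    [seq Posz (d + x.1 + 2 * x.2) | x <- qs].
  rewrite -[in RHS](mkseq_nth (0, 0)%N qs) sq' /mkseq -val_enum_ord -!map_comp.
  exact: eq_map.
exact: perm_map.
Qed.
End Types.

(** * The three cases *)

Lemma lt_ceil_nat (k l m : nat) : (0 < m)%N ->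
  (k%:Z < Num.ceil (l%:Q / m%:Q)) = (k * m < l)%N.
Proof.
move=> m0; rewrite Num.Theory.ceil_gt_int.
by rewrite Num.Theory.ltr_pdivlMr ?ltr0z // -intrM ltr_int.
Qed.

Lemma le_ceil_nat (k l m : nat) : (0 < m)%N ->
  (Num.ceil (l%:Q / m%:Q) <= k%:Z) = (l <= k * m)%N.
Proof.
move=> m0; rewrite Num.Theory.ceil_le_int.
by rewrite Num.Theory.ler_pdivrMr ?ltr0z // -intrM ler_int.
Qed.

Lemma block_sums n1 n2 n3 (x1 x2 x3 : nat * nat) (F : nat * nat -> nat) :
  (\sum_(x <- nseq n1 x1 ++ nseq n2 x2 ++ nseq n3 x3) F x =
    n1 * F x1 + (n2 * F x2 + n3 * F x3))%N.
Proof.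
rewrite !big_cat !big_nseq !iter_addn !addn0 ![(_ * n1)%N]mulnC /=.
by rewrite [(_ * n2)%N]mulnC [(_ * n3)%N]mulnC.
Qed.

Lemma mem_blocks n1 n2 n3 (x1 x2 x3 x : nat * nat) :
  x \in nseq n1 x1 ++ nseq n2 x2 ++ nseq n3 x3 ->
  [\/ (0 < n1)%N /\ x = x1, (0 < n2)%N /\ x = x2 | (0 < n3)%N /\ x = x3].
Proof.
rewrite !mem_cat !mem_nseq => /or3P[] /andP[n0 /eqP ->].
- exact: Or31.
- exact: Or32.
- exact: Or33.
Qed.

Lemma count_small q l u v : (v < l)%N -> (l < u)%N ->
  ((u - l) * q + (v * q + (l - v) * q.+1) + v + 1 = q * u + l + 1)%N.
Proof.
move=> vl lu; have [y ->] : exists y, u = (l + y)%N by exists (u - l)%N; lia.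
have [z ->] : exists z, l = (v + z)%N by exists (l - v)%N; lia.
by rewrite !addKn; nia.
Qed.

(** This is where the hypothesis d > k (r - s - 1) enters in the second case. *)
Lemma large_quotient q l u k d m s : (d = q * u + l + 1)%N -> (k * m < d)%N ->
  (k * m + k * s = k * u)%N -> (l < u)%N -> (k * s < u - l)%N \/ s = 0%N ->
  (k <= q)%N.
Proof.
move=> -> h1 h2 lu h; rewrite leqNgt; apply/negP => qk.
have [z kE] : exists z, k = (q + 1 + z)%N by exists (k - q - 1)%N; lia.
have [y uE] : exists y, u = (l + 1 + y)%N by exists (u - l - 1)%N; lia.
by subst k u; case: h => [h|s0]; [|subst s]; nia.
Qed.

Lemma count_large_nu l u k m s : (k * s <= u - l)%N -> (l < u)%N ->
  (k * m + k * s = k * u)%N ->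
  ((u - l - k * s) * k + (k * s * k.-1 + l * k) = k * m)%N.
Proof.
move=> h1 lu h2.
have [y uE] : exists y, u = (l + k * s + y)%N by exists (u - l - k * s)%N; lia.
have -> : (u - l - k * s = y)%N by rewrite uE; lia.
case: k h1 h2 uE => [|k] h1 h2 uE; first by rewrite !muln0 mul0n.
by subst u => /=; nia.
Qed.

Lemma count_large l u k m s p : (k * s <= u - l)%N -> (l < u)%N ->
  (k * m + k * s = k * u)%N ->
  ((u - l - k * s) * p + (k * s * p.+1 + l * p.+1) + k * m + 1 =
    (k + p) * u + l + 1)%N.
Proof.
move=> h1 lu h2.
have [y uE] : exists y, u = (l + k * s + y)%N by exists (u - l - k * s)%N; lia.
have -> : (u - l - k * s = y)%N by rewrite uE; lia.
by move: uE h2; move: (k * s)%N => ks uE h2; subst u; nia.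
Qed.

(** Splitting the total degree evenly: the sums nu + de of the pairs take the values
    q and q + 1, the degrees nu + 2 de the values v and v + 1, and the larger sums get
    the larger degrees. *)
Lemma balanced_pairs q l u k d m s V v t : (d = q * u + l + 1)%N -> (k * m < d)%N ->
  (k * m + k * s = k * u)%N -> (l < u)%N -> (l <= k * m)%N -> (u - l <= k * s)%N ->
  (V = v * u + t)%N -> (t < u)%N -> V = (2 * (d - 1) - k * m)%N ->
  exists ps : seq (nat * nat),
   [/\ size ps = u, forall x, x \in ps -> (x.1 <= k)%N,
       (\sum_(x <- ps) x.1 = k * m)%N &
   (\sum_(x <- ps) x.2 + k * m + 1 = d)%N /\
   perm_eq [seq x.1 + 2 * x.2 | x <- ps]%N (nseq (u - t) v ++ nseq t v.+1)].
Proof.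
move=> dE hkm hks lu h1 h2 VE tu V2.
have hv : (v * u + t + k * m = 2 * (q * u + l))%N by rewrite -VE V2 dE; lia.
have hkm' : (k * m <= q * u + l)%N by move: hkm; rewrite dE addn1 ltnS.
rewrite {V VE V2 hkm} dE {d dE}.
move: (k * m)%N (k * s)%N hks h1 h2 hv hkm' => k1 k2 hks h1 h2 hv hkm'.
have f1 : (v <= 2 * q)%N by rewrite leqNgt; apply/negP => ?; nia.
have f2 : (2 * q + 1 <= v + k)%N.
  rewrite leqNgt; apply/negP => h; have {}h : ((v + k) * u <= 2 * q * u)%N.
    by rewrite leq_mul2r; apply/orP; right; lia.
  by rewrite mulnDl in h; lia.
have f3 : (q <= v)%N by rewrite leqNgt; apply/negP => ?; nia.
have [x vE] : exists x, v = (q + x)%N by exists (v - q)%N; lia.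
have [y qE] : exists y, q = (x + y)%N by exists (q - x)%N; lia.
subst v q; have k1E : (k1 + t = y * u + 2 * l)%N by nia.
case: (leqP l t) => lt.
  have [t' tE] : exists t', t = (l + t')%N by exists (t - l)%N; lia.
  have [u' uE] : exists u', u = (t + u')%N by exists (u - t)%N; lia.
  exists (nseq l (y.+1, x) ++ nseq t' (y.-1, x.+1) ++ nseq u' (y, x)).
  have ht' : (0 < t' -> 0 < y)%N by move=> t0; rewrite lt0n; apply/negP => /eqP ?; subst; nia.
  split.
  - by rewrite !size_cat !size_nseq; lia.
  - by move=> z /mem_blocks[][_ ->] /=; lia.
  - have e : (t' * y.-1 + t' = t' * y)%N.
      case: (posnP t') => [->|/ht' y0]; first by rewrite !mul0n.
      by rewrite -[in RHS](prednK y0) mulnS addnC.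
    by rewrite block_sums /=; subst t u; nia.
  split; first by rewrite block_sums /=; subst t u; nia.
  rewrite !map_cat !map_nseq /= catA perm_catC.
  have -> : (u - t = u')%N by lia.
  have e : nseq t' (y.-1 + 2 * x.+1)%N = nseq t' (x + y + x).+1.
    by case: (posnP t') => [->//|/ht' y0]; congr nseq; lia.
  have -> : (y.+1 + 2 * x = (x + y + x).+1)%N by lia.
  have -> : (y + 2 * x = x + y + x)%N by lia.
  by rewrite e tE nseqD.
have [t' lE] : exists t', l = (t + t')%N by exists (l - t)%N; lia.
have [u' uE] : exists u', u = (l + u')%N by exists (u - l)%N; lia.
have x0 : (0 < x)%N by rewrite lt0n; apply/negP => /eqP ?; subst; nia.
exists (nseq t (y.+1, x) ++ nseq t' (y.+2, x.-1) ++ nseq u' (y, x)).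
split.
- by rewrite !size_cat !size_nseq; lia.
- have f4 : (2 * (x + y) + 2 <= x + y + x + k)%N.
    rewrite leqNgt; apply/negP => h.
    have {}h : ((x + y + x + k) * u <= (2 * (x + y) + 1) * u)%N.
      by rewrite leq_mul2r; apply/orP; right; lia.
    by rewrite mulnDl [X in (_ <= X)%N]mulnDl in h; lia.
  by move=> z /mem_blocks[][_ ->] /=; lia.
- by rewrite block_sums /=; subst l u; nia.
split; first by rewrite block_sums -(prednK x0) /= in k1E hv *; subst l u; nia.
rewrite !map_cat !map_nseq /= perm_catC -catA.
have -> : (u - t = t' + u')%N by lia.
have -> : (y.+1 + 2 * x = (x + y + x).+1)%N by lia.
have -> : (y.+2 + 2 * x.-1 = x + y + x)%N by lia.
have -> : (y + 2 * x = x + y + x)%N by lia.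
by rewrite nseqD -catA.
Qed.

Section Cases.
Variable K : closedFieldType.
Hypothesis charK : 2%N \in [pchar K].
Variables (r s d k l q : nat).
Hypothesis hkd : (k < d)%N.
Hypothesis hsr : (s + 2 <= r)%N.
Hypothesis hd : (k * (r - s - 1) < d)%N.
Hypothesis hq : (d - 1 = q * (r - 1) + l)%N.
Hypothesis hl : (l < r - 1)%N.

(** The sections with nu = 0 deform as relations between p and e w, those with nu = 1
    because their degree is the middle one. *)
Lemma splitting_small : (k * (r - s - 1) < l)%N ->
  general (fun f : map_X K r s d k => unramified f /\
    iso_split (normal_bundle f)
      (nseq (r - 1 - l) (Posz (d + 2 * q)) ++ nseq (k * (r - s - 1)) (Posz (d + 2 * q + 1))
       ++ nseq (l - k * (r - s - 1)) (Posz (d + 2 * q + 2)))).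
Proof.
move=> hk.
have hd0 : (d = q * (r - 1) + l + 1)%N by rewrite -hq; move: hkd; clear; lia.
pose ps := nseq (r - 1 - l) (0, q)%N ++ nseq (k * (r - s - 1)) (1, q)%N
  ++ nseq (l - k * (r - s - 1)) (0, q.+1)%N.
have -> : nseq (r - 1 - l) (Posz (d + 2 * q)) ++
    nseq (k * (r - s - 1)) (Posz (d + 2 * q + 1))
    ++ nseq (l - k * (r - s - 1)) (Posz (d + 2 * q + 2)) =
    [seq Posz (d + x.1 + 2 * x.2) | x <- ps].
  by rewrite !map_cat !map_nseq /=; congr (nseq _ (Posz _) ++ nseq _ (Posz _) ++ nseq _ (Posz _));
    clear; lia.
apply: splitting_seq => //.
- rewrite !size_cat !size_nseq; move: hl hk; move: (r - 1)%N (k * _)%N => u v; clear; lia.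
- by move=> x /mem_blocks[][+ ->] //=; case: k.
- by rewrite block_sums /= !muln0 muln1 addn0.
- rewrite block_sums /= [RHS]hd0; move: hk hl; move: (r - 1)%N (k * _)%N => u v.
  exact: count_small.
move=> x /mem_blocks[][_ ->] /=.
- by apply: Or32; split=> // y /mem_blocks[][_ ->] /=; clear; lia.
- by apply: Or31 => y /mem_blocks[][_ ->] /=; clear; lia.
- by apply: Or32; split=> // y /mem_blocks[][_ ->] /=; clear; lia.
Qed.

(** Dually, the sections with nu = k deform as relations between e p and w. *)
Lemma splitting_large : (k * s < r - 1 - l)%N \/ s = 0%N ->
  general (fun f : map_X K r s d k => unramified f /\
    iso_split (normal_bundle f)
      (nseq (r - 1 - l - k * s) (Posz (d + 2 * q) - Posz k)
       ++ nseq (k * s) (Posz (d + 2 * q) - Posz k + 1)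
       ++ nseq l (Posz (d + 2 * q) - Posz k + 2))).
Proof.
move=> hs; have ks : (k * s <= r - 1 - l)%N.
  by case: hs => [/ltnW //|->]; rewrite muln0.
have hd0 : (d = q * (r - 1) + l + 1)%N by rewrite -hq; move: hkd; clear; lia.
have e1 : (k * (r - s - 1) + k * s = k * (r - 1))%N.
  by rewrite -mulnDr; congr (_ * _)%N; move: hsr; clear; lia.
have kq : (k <= q)%N by apply: large_quotient hd0 hd e1 hl hs.
have [p qE] : exists p, q = (k + p)%N by exists (q - k)%N; rewrite subnKC.
pose ps := nseq (r - 1 - l - k * s) (k, p)%N ++ nseq (k * s) (k.-1, p.+1)%N
  ++ nseq l (k, p.+1)%N.
have -> : nseq (r - 1 - l - k * s) (Posz (d + 2 * q) - Posz k)
       ++ nseq (k * s) (Posz (d + 2 * q) - Posz k + 1)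
       ++ nseq l (Posz (d + 2 * q) - Posz k + 2) =
    [seq Posz (d + x.1 + 2 * x.2) | x <- ps].
  rewrite !map_cat !map_nseq /= qE; congr (nseq _ _ ++ (_ ++ nseq _ _)); first by clear; lia.
    case: (k) => [//|k0] /=; congr (nseq _ _); clear; lia.
  by clear; lia.
apply: splitting_seq => //.
- rewrite !size_cat !size_nseq; move: hl ks; move: (r - 1)%N (k * _)%N => u v; clear; lia.
- by move=> x /mem_blocks[][_ ->] //=; apply: leq_pred.
- rewrite block_sums /=; apply: (count_large_nu ks hl e1).
- rewrite block_sums /= [RHS]hd0 qE; exact: (count_large p ks hl e1).
move=> x /mem_blocks[][n0 ->] /=.
- by apply: Or33; split=> // y /mem_blocks[][_ ->] /=; clear; lia.
- by apply: Or31 => y /mem_blocks[][_ ->] /=; clear; lia.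
- by apply: Or33; split=> // y /mem_blocks[][_ ->] /=; clear; lia.
Qed.

Lemma splitting_balanced : (l <= k * (r - s - 1))%N -> (r - 1 - l <= k * s)%N ->
  general (fun f : map_X K r s d k => unramified f /\ balanced (normal_bundle f)).
Proof.
move=> h1 h2.
have hd0 : (d = q * (r - 1) + l + 1)%N by rewrite -hq; move: hkd; clear; lia.
have e1 : (k * (r - s - 1) + k * s = k * (r - 1))%N.
  by rewrite -mulnDr; congr (_ * _)%N; move: hsr; clear; lia.
pose V := (2 * (d - 1) - k * (r - s - 1))%N.
pose v := (V %/ (r - 1))%N; pose t := (V %% (r - 1))%N.
have VE : V = (v * (r - 1) + t)%N by apply: divn_eq.
have ht : (t < r - 1)%N by rewrite ltn_mod; apply: leq_ltn_trans hl.
have [ps [p1 p2 p3 [p4 p5]]] : exists ps : seq (nat * nat),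
   [/\ size ps = (r - 1)%N, forall x, x \in ps -> (x.1 <= k)%N,
       (\sum_(x <- ps) x.1 = k * (r - s - 1))%N &
   (\sum_(x <- ps) x.2 + k * (r - s - 1) + 1 = d)%N /\
   perm_eq [seq x.1 + 2 * x.2 | x <- ps]%N (nseq (r - 1 - t) v ++ nseq t v.+1)].
  exact: balanced_pairs hd0 hd e1 hl h1 h2 VE ht erefl.
have pv x : x \in ps -> (v <= x.1 + 2 * x.2 <= v.+1)%N.
  move=> hx; have := map_f (fun x => x.1 + 2 * x.2)%N hx.
  rewrite (perm_mem p5) mem_cat !mem_nseq => /orP[] /andP[_ /eqP ->].
    by rewrite leqnn leqnSn.
  by rewrite leqnn leqnSn.
have := splitting_seq charK hkd hsr p1 p2 p3 p4 => G.
apply: (general_imp (G _) (G _)) => [x hx|x hx|f [hf hN] _].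
- by apply: Or31 => y /pv/andP[_ y1]; have /andP[x0 _] := pv x hx; apply: leq_trans y1 _.
- by apply: Or31 => y /pv/andP[_ y1]; have /andP[x0 _] := pv x hx; apply: leq_trans y1 _.
split=> //; exists (Posz (d + v)), (r - 1 - t)%N, t; apply: iso_split_perm hN.
have -> : [seq Posz (d + x.1 + 2 * x.2) | x <- ps] =
    map (fun y => Posz (d + y)) [seq x.1 + 2 * x.2 | x <- ps]%N.
  by rewrite -map_comp; apply: eq_map => x /=; rewrite addnA.
have -> : Posz (d + v) + 1 = Posz (d + v.+1) by clear; lia.
have -> : nseq (r - 1 - t) (Posz (d + v)) ++ nseq t (Posz (d + v.+1)) =
    map (fun y => Posz (d + y)) (nseq (r - 1 - t) v ++ nseq t v.+1).
  by rewrite map_cat !map_nseq.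
exact: perm_map.
Qed.
End Cases.

Theorem theorem6p1p1 (K : closedFieldType) (charK : 2%N \in [pchar K])
    (r s d k : nat) (hs : (s + 2 <= r)%N) (hkd : (k < d)%N)
    (hd : (k * (r - s - 1) < d)%N)
    (l : nat) (hl : l = ((d - 1) %% (r - 1))%N)
    (alpha : int)
    (halpha : alpha = (d + 2 * ((d - 1 - l) %/ (r - 1)))%N%:Z) :
  [/\ (* (a) *)
      k%:Z < Num.ceil (l%:Q / (r - s - 1)%N%:Q) ->
      general (fun f : map_X K r s d k => unramified f /\
        iso_split (normal_bundle f)
          (nseq (r - 1 - l) alpha
           ++ nseq (k * (r - s - 1)) (alpha + 1)
           ++ nseq (l - k * (r - s - 1)) (alpha + 2))),
      (* (b) *)
      k%:Z < Num.ceil ((r - 1 - l)%N%:Q / s%:Q) \/ s = 0%N ->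
      general (fun f : map_X K r s d k => unramified f /\
        iso_split (normal_bundle f)
          (nseq (r - 1 - l - k * s) (alpha - k%:Z)
           ++ nseq (k * s) (alpha - k%:Z + 1)
           ++ nseq l (alpha - k%:Z + 2))) &
      (* (c) *)
      [/\ s <> 0%N, Num.ceil (l%:Q / (r - s - 1)%N%:Q) <= k%:Z &
          Num.ceil ((r - 1 - l)%N%:Q / s%:Q) <= k%:Z] ->
      general (fun f : map_X K r s d k => unramified f /\
        balanced (normal_bundle f))].
Proof.
have r1 : (0 < r - 1)%N by move: hs; clear; lia.
have m0 : (0 < r - s - 1)%N by move: hs; clear; lia.
have lr : (l < r - 1)%N by rewrite hl ltn_mod.
pose q := ((d - 1) %/ (r - 1))%N.
have hq : (d - 1 = q * (r - 1) + l)%N by rewrite hl -divn_eq.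
have -> : alpha = Posz (d + 2 * q) by rewrite halpha hq addnK mulnK.
split.
- rewrite lt_ceil_nat // => h; exact: (splitting_small charK hkd hs hq lr h).
- move=> h; apply: (splitting_large charK hkd hs hd hq lr).
  case: h => [|->]; last by right.
  case: (posnP s) => [->|s0]; first by right.
  by rewrite lt_ceil_nat // => h; left.
case=> s0; have s1 : (0 < s)%N by rewrite lt0n; apply/eqP.
rewrite !le_ceil_nat // => h1 h2.
 exact: (splitting_balanced charK hkd hs hd hq lr h1 h2).
Qed.
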